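(* Let $\mathcal{A}$ be a hyperplane arrangement in $V=\mathbb{K}^\ell$, let $H\in\mathcal{A}$ and $\mathcal{A}':=\mathcal{A}\setminus\{H\}$. Assume that for every $0\le p\le \ell$, setting $k:=\operatorname{pd}_S D^p(\mathcal{A}')$, one has $k<\ell-2$ and the map $\rho^p: D^p(\mathcal{A})\to D^p(\mathcal{A}^H)$ is surjective in codimension $k+2$ along $H$. Then $$\Psi(\mathcal{A};x,t)=x\,\Psi(\mathcal{A}';x,t)+\Psi(\mathcal{A}^H;x,t)$$ and $$\Psi(\mathcal{A};x,-1)=x\,\Psi(\mathcal{A}';x,-1)+\Psi(\mathcal{A}^H;x,-1).$$
   Context: $\mathbb{K}$ is a field, $V=\mathbb{K}^\ell$, $S=\mathbb{K}[x_1,\dots,x_\ell]$ (standard grading). An arrangement is a finite set of linear hyperplanes; for a hyperplane $H$, $\alpha_H\in V^*$ is a defining linear form, and $Q(\mathcal{A})=\prod_{H\in\mathcal{A}}\alpha_H$. $\operatorname{Der}S=\bigoplus_i S\partial_{x_i}$, $\operatorname{Der}^pS=\wedge^p_S\operatorname{Der}S$, whose elements are viewed as alternating $S$-multilinear maps $S^p\to S$ that are derivations in each argument; it is graded with $\deg\partial_{x_i}=0$. The logarithmic derivation module of order $p$ is $D^p(\mathcal{A})=\{\theta\in\operatorname{Der}^pS:\theta(\alpha_H,f_2,\dots,f_p)\in\alpha_HS\ \forall H\in\mathcal{A},\ \forall f_j\in S\}$ (so $D^0(\mathcal{A})=S$). For $H\in\mathcal{A}$, the restriction $\mathcal{A}^H=\{L\cap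 H: L\in\mathcal{A}\setminus\{H\}\}$ is an arrangement in $H\cong\mathbb{K}^{\ell-1}$ with coordinate ring $\overline{S}=S/\alpha_HS$, and $D^p(\mathcal{A}^H)\subset\wedge^p\operatorname{Der}\overline{S}$ is defined in the same way. $\rho^p:D^p(\mathcal{A})\to D^p(\mathcal{A}^H)$ is $\rho^p(\theta)(\overline{f_1},\dots,\overline{f_p})=\overline{\theta(f_1,\dots,f_p)}$ (bar = image in $\overline{S}$). $L(\mathcal{A})$ is the set of intersections of subsets of $\mathcal{A}$; for $X\in L(\mathcal{A})$, $\mathcal{A}_X=\{L\in\mathcal{A}:X\subset L\}$. The map $\rho^p$ is surjective in codimension $k$ along $H$ if for every $X\in L(\mathcal{A}^H)$ with $\operatorname{codim}_VX=k$, the corresponding map $\rho^p:D^p(\mathcal{A}_X)\to D^p((\mathcal{A}_X)^H)$ for the localized arrangement $\mathcal{A}_X\ni H$ is surjective. $\operatorname{Hilb}(M;x)=\sum_j\dim_{\mathbb{K}}M_jx^j$. The Solomon–Terao polynomial is $\Psi(\mathcal{A};x,t)=\sum_{p=0}^{\ell}\operatorname{Hilb}(D^p(\mathcal{A});x)(t(x-1)-1)^p$ (defined likewise for $\mathcal{A}^H$ over $\overline{S}$ with $\ell-1$ in place of $\ell$). $\operatorname{pd}_S$ is projective dimension. *)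

(* Defs.v *)
From HB Require Import structures.
From mathcomp Require Import all_boot all_order all_algebra.
From mathcomp Require Import finmap boolp mpoly.

Set Implicit Arguments.
Unset Strict Implicit.
Unset Printing Implicit Defensive.

Import GRing.Theory.
Local Open Scope ring_scope.

Definition projective (R : pzRingType) (P : lmodType R) : Prop :=
  forall (M N : lmodType R) (g : {linear M -> N}) (f : {linear P -> N}),
    (forall y, exists x, g x = y) ->
    exists h : {linear P -> M}, forall x, g (h x) = f x.

(* There is an exact sequence 0 -> P k -> ... -> P 0 -> M -> 0 with every P i
   projective; it is stored as an infinite complex vanishing beyond k. *)
Definition projdim_le (R : pzRingType) (M : lmodType R) (k : nat) : Prop :=
  exists (P : nat -> lmodType R) (d : forall i, {linear P i.+1 -> P i})
         (e : {linear P 0%N -> M}),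
    [/\ forall i, projective (P i),
        forall y, exists x, e x = y,
        forall x, e x = 0 <-> exists y, d 0%N y = x,
        forall i (x : P i.+1), d i x = 0 <-> exists y, d i.+1 y = x
      & forall i (x : P i), (k < i)%N -> x = 0].

Definition is_projdim (R : pzRingType) (M : lmodType R) (k : nat) : Prop :=
  projdim_le M k /\ forall j, projdim_le M j -> (k <= j)%N.

Definition has_dim (K : fieldType) (M : lmodType K) (P : M -> Prop) (d : nat)
    : Prop :=
  exists b : 'I_d -> M,
    [/\ forall i, P (b i),
        forall c : 'I_d -> K, \sum_i c i *: b i = 0 -> forall i, c i = 0
      & forall m, P m -> exists c : 'I_d -> K, m = \sum_i c i *: b i].

(* 0 when there is no finite basis *)
Definition dimK (K : fieldType) (M : lmodType K) (P : M -> Prop) : nat :=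
  if pselect (exists d, has_dim P d) is left e then projT1 (cid e) else 0%N.

Lemma has_dim_inj (K : fieldType) (M : lmodType K) (P : M -> Prop)
    (d e : nat) : has_dim P d -> has_dim P e -> (d <= e)%N.
Proof.
case=> b [bP bI _] [c [_ _ cS]].
have [B hB] := choice (fun i => cS _ (bP i)).
pose T := \matrix_(i < d, j < e) B i j.
suff /eqP <- : row_free T by exact: rank_leq_col.
apply/row_freeP/row_freeP; rewrite -kermx_eq0; apply/eqP/row_matrixP => r.
rewrite row0; set u := row r _.
have uT : u *m T = 0 by rewrite -row_mul mulmx_ker row0.
apply/rowP => i; rewrite [RHS]mxE; apply: (bI (fun i => u 0 i)).
under eq_bigr => k _ do rewrite hB scaler_sumr.
rewrite exchange_big /= big1 // => j _.
under eq_bigr => k _ do rewrite scalerA.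
rewrite -scaler_suml; have := congr1 (fun m : 'rV_e => m 0 j) uT.
rewrite !mxE => uTj; rewrite -[X in X *: _](_ : \sum_k u 0 k * T k j = _).
  by rewrite uTj scale0r.
by apply: eq_bigr => k _; rewrite [T k j]mxE.
Qed.

Lemma dimK_eq (K : fieldType) (M : lmodType K) (P : M -> Prop) (d : nat) :
  has_dim P d -> dimK P = d.
Proof.
move=> Pd; rewrite /dimK; case: pselect => [e|]; last by case; exists d.
by case: (cid e) => d' /= Pd'; apply/eqP; rewrite eqn_leq !(@has_dim_inj _ _ P).
Qed.

Lemma has_dim_dimK (K : fieldType) (M : lmodType K) (P : M -> Prop)
    (E : vectType K) (phi : {linear M -> E}) :
  (forall m, P m -> phi m = 0 -> m = 0) ->
  P 0 -> (forall a m m', P m -> P m' -> P (a *: m + m')) ->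
  has_dim P (dimK P).
Proof.
move=> phiI P0 PL.
pose Q n := `[< exists b : n.-tuple M,
  (forall i, P (tnth b i)) /\ free (map phi b) >].
have Q0 : exists n, Q n.
  by exists 0%N; apply/asboolP; exists [tuple]; split; [case | exact: nil_free].
have Qb n : Q n -> (n <= \dim {:E})%N.
  case/asboolP=> b [_ /eqP bF].
  by rewrite -[n](size_tuple b) -(size_map phi) -bF dimvS ?subvf.
case: (ex_maxnP Q0 Qb) => d /asboolP[b [bP bF]] dmax.
suff Pd : has_dim P d by rewrite (dimK_eq Pd).
have phis (c : 'I_d -> K) :
    phi (\sum_i c i *: tnth b i) = \sum_i c i *: (map_tuple phi b)`_i.
  rewrite linear_sum; apply: eq_bigr => i _.
  by rewrite linearZ -tnth_nth tnth_map.
exists (tnth b); split=> // [c c0|m Pm].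
  have /freeP bF' := bF : free (map_tuple phi b).
  by apply: bF'; rewrite -phis c0 linear0.
have Psum (c : 'I_d -> K) : P (\sum_i c i *: tnth b i).
  by elim/big_rec: _ => // i x _ Px; apply: PL.
have phim : phi m \in <<map_tuple phi b>>%VS.
  apply: contraT => nm; suff : Q d.+1 by move=> /dmax; rewrite ltnn.
  apply/asboolP; exists [tuple of m :: b]; split; last first.
    by rewrite /= free_cons nm.
  move=> i; case: (unliftP ord0 i) => [j ->|->]; last by rewrite tnth0.
  by rewrite tnthS.
exists (fun i => coord (map_tuple phi b) i (phi m)).
apply/eqP; rewrite -subr_eq0; apply/eqP/phiI.
  by rewrite addrC -scaleN1r; apply: PL.
by rewrite linearB /= phis -coord_span // subrr.
Qed.

(* p-element subsets i_1 < ... < i_p of the indices *)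
Notation multiindex n p := {I : p.-tuple 'I_n | sorted ltn (map val I)}.

(* The exterior power of order p of the free S-module Der S, S = K[x_1..x_n]:
   theta stands for the sum over I of theta I *: d/dx_(i_1) ^ ... ^ d/dx_(i_p).
   The codomain is S^o to get the S-module structure. *)
Notation polyder K n p := {ffun multiindex n p -> {mpoly K[n]}^o}.

(* theta (f_1, ..., f_p) *)
Definition pdapply (K : fieldType) (n p : nat) (theta : polyder K n p)
    (f : 'I_p -> {mpoly K[n]}) : {mpoly K[n]} :=
  \sum_(I : multiindex n p)
     theta I * \det (\matrix_(a < p, b < p) mderiv (tnth (val I) a) (f b)).

Lemma pdapplyM (K : fieldType) (n p : nat) (theta : polyder K n p)
    (f g h : 'I_p -> {mpoly K[n]}) (i : 'I_p) :
  (forall j, j != i -> g j = f j) -> (forall j, j != i -> h j = f j) ->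
  f i = g i * h i ->
  pdapply theta f = g i * pdapply theta h + h i * pdapply theta g.
Proof.
move=> gE hE fE; rewrite /pdapply !mulr_sumr -big_split /=.
apply: eq_bigr => I _; rewrite !(mulrCA _ (theta I)) -mulrDr; congr (_ * _).
rewrite -!(det_tr (\matrix_(_, _) _)).
apply: (@determinant_multilinear _ _ _ _ _ i).
- by apply/rowP => a; rewrite !mxE fE mderivM addrC [_ * h i]mulrC.
- by apply/matrixP => b a; rewrite !mxE hE // eq_sym neq_lift.
- by apply/matrixP => b a; rewrite !mxE gE // eq_sym neq_lift.
Qed.

Lemma pdapply_linear (K : fieldType) (n p : nat) (theta : polyder K n p)
    (f g h : 'I_p -> {mpoly K[n]}) (i : 'I_p) (c : K) :
  (forall j, j != i -> g j = f j) -> (forall j, j != i -> h j = f j) ->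
  f i = c *: g i + h i ->
  pdapply theta f = c *: pdapply theta g + pdapply theta h.
Proof.
move=> gE hE fE; rewrite /pdapply -mul_mpolyC !mulr_sumr -big_split /=.
apply: eq_bigr => I _; rewrite !(mulrCA _ (theta I)) -mulrDr; congr (_ * _).
rewrite -!(det_tr (\matrix_(_, _) _)) -[X in _ = _ + X]mul1r.
apply: (@determinant_multilinear _ _ _ _ _ i).
- by apply/rowP => a; rewrite !mxE fE linearP mul_mpolyC mul1r.
- by apply/matrixP => b a; rewrite !mxE gE // eq_sym neq_lift.
- by apply/matrixP => b a; rewrite !mxE hE // eq_sym neq_lift.
Qed.

Lemma pdapply_alternate (K : fieldType) (n p : nat) (theta : polyder K n p)
    (f : 'I_p -> {mpoly K[n]}) (i j : 'I_p) :
  i != j -> f i = f j -> pdapply theta f = 0.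
Proof.
move=> ij fE; rewrite /pdapply big1 // => I _; rewrite -det_tr.
by rewrite (determinant_alternate ij) ?mulr0 // => a; rewrite !mxE fE.
Qed.

Section Arrangements.
Variables (K : fieldType) (V : vectType K).

Implicit Types (W H L X : {vspace V}) (A : {fset {vspace V}}).

Definition hyperplane_of W L : Prop := (L <= W)%VS /\ (\dim L).+1 = \dim W.

Definition is_arrangement W A : Prop := forall L, L \in A -> hyperplane_of W L.

Definition deletion A H : {fset {vspace V}} := (A `\ H)%fset.

Definition restriction A H : {fset {vspace V}} :=
  [fset (L :&: H)%VS | L in deletion A H]%fset.

Definition localization A X : {fset {vspace V}} :=
  [fset L in A | (X <= L)%VS]%fset.

(* X belongs to L(A); the empty intersection is W *)
Definition in_lattice W A X : Prop :=
  exists2 B : {fset {vspace V}},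
    (B `<=` A)%fset & X = (W :&: \bigcap_(L <- B) L)%VS.

(* The coordinate ring of W: 'X_i is the i-th coordinate function on W with
   respect to the basis vbasis W. *)
Notation coordring W := {mpoly K[\dim W]}.

Definition fun_at W (f : coordring W) (v : V) : K :=
  f.@[fun i => coord (vbasis W) i v].

(* The restriction of polynomial functions from W to H, written in the
   bases vbasis W and vbasis H. *)
Definition restrict_fun W H (f : coordring W) : coordring H :=
  f \mPo [tuple \sum_(j < \dim H)
            coord (vbasis W) i (tnth (vbasis H) j) *: 'X_j | i < \dim W].

Definition defining_form W L (alpha : coordring W) : Prop :=
  alpha \is 1.-homog /\
  forall v, v \in W -> (v \in L <-> fun_at alpha v = 0).

Lemma fun_at_restrict W H (f : coordring W) v :
  (H <= W)%VS -> v \in H -> fun_at (restrict_fun H f) v = fun_at f v.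
Proof.
move=> HW vH; rewrite /fun_at /restrict_fun comp_mpoly_meval.
apply: meval_eq => i; rewrite tnth_mktuple raddf_sum /= [in RHS](coord_vbasis vH).
rewrite linear_sum; apply: eq_bigr => j _.
by rewrite mevalZ mevalXU linearZ /= mulrC (tnth_nth 0).
Qed.

Definition linform W (phi : V -> K) : coordring W :=
  \sum_(m < \dim W) phi (tnth (vbasis W) m) *: 'X_m.

Lemma restrict_funXU W H i :
  restrict_fun H ('X_i : coordring W) = linform H (coord (vbasis W) i).
Proof. by rewrite /restrict_fun comp_mpolyXU -tnth_nth tnth_mktuple. Qed.

Lemma linform_coord W i : linform W (coord (vbasis W) i) = 'X_i.
Proof.
rewrite /linform (bigD1 i) //= big1 ?addr0 => [|j ji].
  rewrite (tnth_nth 0) coord_free ?(basis_free (vbasisP W)) //.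
  by rewrite eqxx scale1r.
rewrite (tnth_nth 0) coord_free ?(basis_free (vbasisP W)) //.
by rewrite (negbTE ji) scale0r.
Qed.

Lemma restrict_linform W H (phi : {linear V -> K^o}) :
  (H <= W)%VS -> restrict_fun H (linform W phi) = linform H phi.
Proof.
move=> HW; rewrite {1}/linform /restrict_fun raddf_sum /=.
under eq_bigr => m _ do
  rewrite comp_mpolyZ -[X in _ *: X]/(restrict_fun H 'X_m) restrict_funXU
    scaler_sumr.
rewrite exchange_big /=; apply: eq_bigr => k _.
have hW : tnth (vbasis H) k \in W.
  by apply: (subvP HW); apply: vbasis_mem; rewrite mem_tnth.
rewrite [in RHS](coord_vbasis hW) linear_sum scaler_suml.
by apply: eq_bigr => m _; rewrite scalerA linearZ /= mulrC !(tnth_nth 0).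
Qed.

Lemma homog1_linform W (alpha : coordring W) : alpha \is 1.-homog ->
  exists phi : {linear V -> K^o}, alpha = linform W phi.
Proof.
move=> ah; pose f v : K^o := \sum_m coord (vbasis W) m v * alpha@_U_(m).
have fL : linear f.
  move=> c u v; rewrite /f scaler_sumr -big_split /=; apply: eq_bigr => m _.
  by rewrite linearP mulrDl -mulrA.
pose fB := GRing.isLinear.Build K V K^o _ f fL.
exists (HB.pack f fB : {linear V -> K^o}).
have fE m : f (tnth (vbasis W) m) = alpha@_U_(m).
  rewrite /f (bigD1 m) //= big1 ?addr0 => [|j jm].
    rewrite (tnth_nth 0) coord_free ?(basis_free (vbasisP W)) //.
    by rewrite eqxx mul1r.
  rewrite (tnth_nth 0) coord_free ?(basis_free (vbasisP W)) //.
  by rewrite eq_sym (negbTE jm) mul0r.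
apply/mpolyP => mu; rewrite raddf_sum /=.
have [/eqP/mdeg1P[i /eqP ->]|mu1] := eqVneq (mdeg mu) 1%N.
  rewrite (bigD1 i) //= big1 ?addr0 => [|j ji].
    by rewrite mcoeffZ mcoeffX eqxx mulr1 fE.
  by rewrite mcoeffZ mcoeffX eq_mnm1 (negbTE ji) mulr0.
rewrite (dhomog_nemf_coeff ah mu1) big1 // => j _.
rewrite mcoeffZ mcoeffX; case: eqP => [e|]; last by rewrite mulr0.
by rewrite -e mdeg1 eqxx in mu1.
Qed.

Lemma fun_at_linform W (phi : {linear V -> K^o}) v :
  v \in W -> fun_at (linform W phi) v = phi v.
Proof.
move=> vW; rewrite /fun_at raddf_sum /= [in RHS](coord_vbasis vW) linear_sum.
apply: eq_bigr => i _.
by rewrite mevalZ mevalXU linearZ /= mulrC (tnth_nth 0).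
Qed.

Section LiftFun.
Variables W H : {vspace V}.
Hypothesis HW : (H <= W)%VS.

Definition lift_fun (g : coordring H) : coordring W :=
  g \mPo [tuple linform W (coord (vbasis H) j \o projv H) | j < \dim H].

Lemma lift_funK (g : coordring H) : restrict_fun H (lift_fun g) = g.
Proof.
elim/mpolyind: g => [|c m p _ _ IHp].
  by rewrite /lift_fun /restrict_fun !linear0.
rewrite -[in RHS]IHp /lift_fun /restrict_fun !(comp_mpolyD, comp_mpolyZ).
congr (_ *: _ + _).
rewrite (comp_mpolyX m) rmorph_prod [RHS]mpolyXE_id /=.
apply: eq_bigr => j _; rewrite rmorphXn /= tnth_mktuple; congr (_ ^+ _).
have := restrict_linform (coord (vbasis H) j \o projv H) HW.
rewrite /restrict_fun => ->; rewrite -[RHS]linform_coord.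
apply: eq_bigr => k _ /=.
by rewrite projv_id // vbasis_mem // mem_tnth.
Qed.

End LiftFun.

(* The two lemmas below identify the coordinate ring of a hyperplane H of W with
   the quotient of the coordinate ring of W by alpha_H, restrict_fun H being the
   projection. *)
Lemma restrict_fun_surjective W H (g : coordring H) :
  (H <= W)%VS -> exists f : coordring W, restrict_fun H f = g.
Proof. by move=> HW; exists (lift_fun W g); exact: lift_funK. Qed.

Lemma restrict_fun_eq0 W H (alpha f : coordring W) :
  hyperplane_of W H -> defining_form H alpha ->
  restrict_fun H f = 0 <-> exists g, f = alpha * g.
Proof.
move=> [HW dW] [/homog1_linform[phi aE] aH].
have aphi v : v \in W -> fun_at alpha v = phi v.
  by rewrite aE; exact: fun_at_linform.
have HphiE v : v \in W -> (v \in H) = (phi v == 0).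
  by move=> vW; rewrite -aphi //; apply/idP/eqP => /(aH v vW).
split=> [f0|[g ->]]; last first.
  rewrite /restrict_fun rmorphM /= -/(restrict_fun H alpha) aE.
  rewrite restrict_linform // [linform H phi]big1 ?mul0r // => k _.
  have kH : tnth (vbasis H) k \in H by rewrite vbasis_mem // mem_tnth.
  by have := kH; rewrite HphiE ?(subvP HW) // => /eqP ->; rewrite scale0r.
have [v0 v0W v0H] : exists2 v, v \in W & v \notin H.
  apply: contrapT => nex; suff /dimvS : (W <= H)%VS by rewrite -dW ltnn.
  by apply/subvP => v vW; apply: contrapT => /negP vH; apply: nex; exists v.
have phi0 : phi v0 != 0 by rewrite -HphiE.
pose u := (phi v0)^-1 *: (v0 - projv H v0).
have uE v : v \in W -> v = projv H v + phi v *: u.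
  move=> vW; have : v - (phi v / phi v0) *: v0 \in H.
    rewrite HphiE ?rpredB ?rpredZ //.
    by rewrite linearB linearZ /= -[_ *: phi v0]/(_ * phi v0) divfK // subrr.
  move/projv_id; rewrite linearB linearZ /= => e.
  rewrite /u scalerA scalerBr -[v in LHS](subrK ((phi v / phi v0) *: v0)) -e.
  by rewrite -addrA [- _ + _]addrC.
pose sg (h : coordring W) : coordring W := lift_fun W (restrict_fun H h).
suff [g] : exists g, f = sg f + alpha * g.
  by rewrite /sg f0 /lift_fun linear0 add0r => ->; exists g.
have sgX i : exists g, 'X_i = sg 'X_i + alpha * g.
  exists (coord (vbasis W) i u)%:MP.
  rewrite -[LHS]linform_coord mulrC mul_mpolyC aE /sg restrict_funXU.
  rewrite /lift_fun /linform raddf_sum scaler_sumr /=.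
  under [X in _ = X + _]eq_bigr => k _ do
    rewrite comp_mpolyZ comp_mpolyXU -tnth_nth tnth_mktuple scaler_sumr.
  rewrite [X in _ = X + _]exchange_big -big_split /=; apply: eq_bigr => m _.
  under eq_bigr => k _ do rewrite scalerA.
  rewrite -scaler_suml scalerA -scalerDl; congr (_ *: _).
  have mW : tnth (vbasis W) m \in W by rewrite vbasis_mem // mem_tnth.
  rewrite {1}(uE _ mW) linearD linearZ /= mulrC; congr (_ + _).
    rewrite [in LHS](coord_vbasis (memv_proj H (tnth (vbasis W) m))).
    rewrite linear_sum; apply: eq_bigr => k _.
    by rewrite linearZ /= (tnth_nth 0 (vbasis H)) mulrC.
have sgM a b : sg (a * b) = sg a * sg b.
  by rewrite /sg /restrict_fun /lift_fun !rmorphM.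
have sg1 : sg 1 = 1 by rewrite /sg /restrict_fun /lift_fun !rmorph1.
have cM a b : (exists g, a = sg a + alpha * g) ->
    (exists g, b = sg b + alpha * g) ->
    exists g, a * b = sg (a * b) + alpha * g.
  move=> [g ag] [h bh]; exists (g * b + sg a * h).
  rewrite sgM [in LHS]ag mulrDl [in X in X + _]bh.
  by rewrite mulrDr -addrA mulrDr !mulrA [alpha * sg a]mulrC [_ + alpha * g * b]addrC.
have c1 : exists g, 1 = sg 1 + alpha * g by exists 0; rewrite sg1 mulr0 addr0.
elim/mpolyind: f {f0} => [|c m p _ _ [g pg]].
  by exists 0; rewrite /sg /restrict_fun /lift_fun !linear0 mulr0 addr0.
have [h mh] : exists h, 'X_[m] = sg 'X_[m] + alpha * h.
  rewrite mpolyXE_id.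
  apply: (big_ind (fun a => exists g, a = sg a + alpha * g)) => // i _.
  elim: (m i) => [|n IHn]; first by rewrite expr0.
  by rewrite exprS; apply: cM.
exists (c *: h + g).
have -> : sg (c *: 'X_[m] + p) = c *: sg 'X_[m] + sg p.
  by rewrite /sg /restrict_fun /lift_fun !(comp_mpolyD, comp_mpolyZ).
rewrite [in LHS]mh [in LHS]pg scalerDr mulrDr -scalerAr.
by rewrite -!addrA; congr (_ + _); rewrite addrCA.
Qed.

(* The defining forms of a hyperplane are the nonzero scalar multiples of one of
   them, so the quantification over alpha amounts to a choice of alpha_L.  The
   first argument of theta has index 0; the condition is void for p = 0. *)
Definition is_logder W A p (theta : polyder K (\dim W) p) : Prop :=
  forall L alpha, L \in A -> defining_form L alpha ->
  forall (f : 'I_p -> coordring W) (i : 'I_p),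
    i = 0%N :> nat -> f i = alpha ->
    exists g, pdapply theta f = alpha * g.

Definition logder W A p : {pred polyder K (\dim W) p} :=
  fun theta => `[< is_logder A theta >].
Arguments logder : clear implicits.

Lemma pdapply_is_linear W p (f : 'I_p -> coordring W)
    (a : coordring W) (theta eta : polyder K (\dim W) p) :
  pdapply (a *: theta + eta) f = a * pdapply theta f + pdapply eta f.
Proof.
rewrite /pdapply mulr_sumr -big_split /=; apply: eq_bigr => I _.
by rewrite !ffunE mulrDl mulrA.
Qed.

Lemma logder_submod_closed W A p : submod_closed (logder W A p).
Proof.
have z : (0 : polyder K (\dim W) p) \in logder W A p.
  apply/asboolP => L al _ _ f i _ _; exists 0.
  by rewrite mulr0 /pdapply big1 // => I _; rewrite ffunE mul0r.
split=> // a u v /asboolP hu /asboolP hv; apply/asboolP => L al LA dL f i i0 fi.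
have [g eg] := hu L al LA dL f i i0 fi.
have [h eh] := hv L al LA dL f i i0 fi.
exists (a * g + h).
by rewrite pdapply_is_linear eg eh mulrDr mulrCA.
Qed.

HB.instance Definition _ W A p :=
  GRing.isSubmodClosed.Build _ (polyder K (\dim W) p) (logder W A p)
    (@logder_submod_closed W A p).

Record logderType W A p := LogDer {
  logder_val :> polyder K (\dim W) p;
  _ : logder_val \in logder W A p }.

HB.instance Definition _ W A p := [isSub for @logder_val W A p].
HB.instance Definition _ W A p := [Choice of logderType W A p by <:].
HB.instance Definition _ W A p := [SubChoice_isSubLmodule of logderType W A p by <:].

Definition logder_module W A p : lmodType (coordring W) := logderType W A p.

(* The degree j part; d/dx_i has degree 0. *)
Definition logder_part W A p (j : nat) (theta : {ffun multiindex (\dim W) p -> coordring W})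
    : Prop :=
  theta \in logder W A p /\ forall I, theta I \is j.-homog.
Arguments logder_part : clear implicits.

Definition hilb W A p (j : nat) : nat := @dimK K _ (logder_part W A p j).

Lemma has_dim_hilb W A p j : has_dim (logder_part W A p j) (hilb W A p j).
Proof.
pose E := {ffun (multiindex (\dim W) p * 'X_{1..(\dim W) < j.+1})%type -> K^o}.
pose f (theta : {ffun multiindex (\dim W) p -> coordring W}) : E :=
  [ffun x => (theta x.1)@_(val x.2)].
have fL : linear f.
  by move=> a u v; apply/ffunP => x; rewrite !ffunE mcoeffD mcoeffZ.
pose phi := GRing.isLinear.Build K _ E _ f fL.
pose F : {linear _ -> E} := HB.pack f phi.
apply: (has_dim_dimK (phi := F)) => [m [_ mj] fm0||a u v [uD uj] [vD vj]].
- apply/ffunP => I; rewrite ffunE; apply/mpolyP => mu; rewrite mcoeff0.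
  have [muj|muj] := eqVneq (mdeg mu) j; last exact: dhomog_nemf_coeff (mj I) muj.
  have lt : (mdeg mu < j.+1)%N by rewrite muj.
  have /ffunP/(_ (I, BMultinom lt)) := fm0.
  by rewrite !ffunE.
- by split; [exact: rpred0 | move=> I; rewrite ffunE dhomog0].
- split=> [|I]; last by rewrite !ffunE rpredD ?rpredZ.
  have [_ DL] := @logder_submod_closed W A p.
  suff -> : a *: u + v = (a%:MP *: (u : polyder K _ _) + v) by apply: DL.
  by apply/ffunP => I; rewrite !ffunE -mul_mpolyC.
Qed.

(* eta = rho^p theta: since restrict_fun H is surjective for H <= W, this
   equation determines eta. *)
Definition rho_eq W H p (theta : polyder K (\dim W) p)
    (eta : polyder K (\dim H) p) : Prop :=
  forall f : 'I_p -> coordring W,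
    pdapply eta (fun i => restrict_fun H (f i)) =
    restrict_fun H (pdapply theta f).

Definition rho_surjective W A H p : Prop :=
  forall eta, eta \in logder H (restriction A H) p ->
  exists2 theta, theta \in logder W A p & rho_eq theta eta.

Definition rho_surjective_codim A H p (k : nat) : Prop :=
  forall X, in_lattice H (restriction A H) X -> (\dim {:V} - \dim X)%N = k ->
  rho_surjective fullv (localization A X) H p.

(* Power series in x are represented by their coefficient sequences; here the
   coefficients are polynomials in t. *)
Definition psmul (R : nzRingType) (a b : nat -> R) : nat -> R :=
  fun n => \sum_(i < n.+1) a i * b (n - i)%N.

(* t (x - 1) - 1, as a polynomial in x over Z[t] *)
Definition STbase : {poly {poly int}} := ('X%:P * ('X - 1) - 1)%R.

Definition Psi W A : nat -> {poly int} :=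
  fun n => \sum_(p < (\dim W).+1)
    psmul (fun j => (hilb W A p j)%:R) (fun j => (STbase ^+ p)`_j) n.

Definition Psi_at W A (t : int) : nat -> int := fun n => (Psi W A n).[t].

End Arrangements.

(* Multiplication by x *)
Definition xmul (R : nzRingType) (a : nat -> R) : nat -> R :=
  fun n => if n is m.+1 then a m else 0.

(* Main.v *)
(* Multiplication by alpha_H and rho^p give an exact sequence
     0 -> D^p(A')[-1] -> D^p(A) -> D^p(A^H),
   so the surjectivity of every rho^p yields the identity on Hilbert series, and
   the one on Psi follows termwise.

   To lift eta in D^p(A^H), let I be the ideal of the f such that f eta is in the
   image of rho^p, and Q_X the product of the alpha_L for the L not containing X.
   Surjectivity in codimension k + 2 says that Q_X is in I for the flats X of
   codimension k + 2 in H, and the aim is 1 = Q_Y for the centre Y of A.  By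
   induction on the codimension of a flat Y, powers of linear forms vanishing on Y,
   multiplied by Q_Y, are in I.  There are at least k + 3 independent such forms;
   lifts of the multiples of Q_Y eta by their powers form a Koszul cochain, whose
   obstruction lies in H^2 of a regular sequence of length k + 3 on D^p(A'), which
   vanishes as pd D^p(A') = k.  If A has rank r < k + 2, the surjectivity
   hypothesis is void; but D^p(A') is a second syzygy defined over a polynomial
   ring in r variables, so pd D^p(A') <= max(r - 2, 0) by Hilbert's syzygy theorem,
   which forces k = 0 and A = {H}. *)
Require Import Defs.
From HB Require Import structures.
From mathcomp Require Import all_boot all_fingroup all_algebra.
From mathcomp Require Import finmap boolp freeg mpoly.
From mathcomp Require classical_sets.

Set Implicit Arguments.
Unset Strict Implicit.
Unset Printing Implicit Defensive.

Import GRing.Theory.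
Local Open Scope ring_scope.

(** * Linear maps and projective dimension *)

Section LinearMaps.
Variable R : nzRingType.
Implicit Types M N P : lmodType R.

(** Projective dimension is measured by arbitrary projective modules, ungraded and possibly of
    infinite rank, and K may be finite, so three classical tools appear in elementary form. Depth is
    replaced by Koszul cohomology: it vanishes in low degrees on free modules, hence on projective
    ones, and each syzygy costs one degree; an obstruction in H^2 on a module with pd = k thus asks
    for 2 + k < length, whence k + 3 forms. The Nullstellensatz is replaced by branching over the
    hyperplanes whose forms are added to an ideal. For the syzygy theorem, linearity is first
    relaxed to a polynomial subring over which the equations of D^p(A') have coefficients in K:
    there the image of their matrix is a direct summand, so that all Ext vanish, and the coordinates
    are then restored one by one. Since k is the least bound, it is enough to lower a bound m + 1 to
    m; Ext therefore enters only as the possibility of extending linear maps, never as a group. *)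

Definition pack_linear M N (f : M -> N) (fL : linear f) : {linear M -> N} :=
  HB.pack f (GRing.isLinear.Build R M N _ f fL).

Definition submodule M (I : M -> Prop) : Prop :=
  I 0 /\ forall a x y, I x -> I y -> I (a *: x + y).

Lemma submoduleD M (I : M -> Prop) : submodule I ->
  forall x y, I x -> I y -> I (x + y).
Proof. by case=> _ IL x y Ix Iy; rewrite -[x]scale1r; apply: IL. Qed.

Lemma submoduleZ M (I : M -> Prop) : submodule I ->
  forall a x, I x -> I (a *: x).
Proof. by case=> I0 IL a x Ix; rewrite -[_ *: _]addr0; apply: IL. Qed.

Lemma submodule_sum M (I : M -> Prop) (T : Type) (r : seq T) (F : T -> M) :
  submodule I -> (forall t, I (F t)) -> I (\sum_(t <- r) F t).
Proof.
move=> IS IF; elim/big_rec: _ => [|t x _ Ix]; first by case: IS.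
exact: submoduleD.
Qed.

(** [IS] is a parameter so that the closure instance can be inferred from the predicate alone. *)
Definition submod_pred M (I : M -> Prop) (IS : submodule I) : {pred M} :=
  fun x => `[< I x >].

Lemma submod_pred_closed M (I : M -> Prop) (IS : submodule I) :
  submod_closed (submod_pred IS).
Proof.
case: (IS) => I0 IL; split=> [|a x y /asboolP Ix /asboolP Iy]; apply/asboolP => //.
exact: IL.
Qed.

HB.instance Definition _ M (I : M -> Prop) (IS : submodule I) :=
  GRing.isSubmodClosed.Build _ M (submod_pred IS) (submod_pred_closed IS).

Record submod M (I : M -> Prop) (IS : submodule I) := Submod {
  submod_val :> M;
  _ : submod_val \in submod_pred IS }.

HB.instance Definition _ M (I : M -> Prop) (IS : submodule I) :=
  [isSub for @submod_val M I IS].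
HB.instance Definition _ M (I : M -> Prop) (IS : submodule I) :=
  [Choice of submod IS by <:].
HB.instance Definition _ M (I : M -> Prop) (IS : submodule I) :=
  [SubChoice_isSubLmodule of submod IS by <:].

Definition incl M (I : M -> Prop) (IS : submodule I) :
  {linear submod IS -> M} := \val.

Lemma inclP M (I : M -> Prop) (IS : submodule I) (x : submod IS) : I (incl IS x).
Proof. by case: x => x /= /asboolP. Qed.

Lemma incl_inj M (I : M -> Prop) (IS : submodule I) : injective (incl IS).
Proof. exact: val_inj. Qed.

Lemma incl_surj M (I : M -> Prop) (IS : submodule I) (x : M) :
  I x -> exists y, incl IS y = x.
Proof. by move=> Ix; have h : x \in submod_pred IS; [exact/asboolP | exists (Submod h)]. Qed.

Lemma corestrict M N (I : N -> Prop) (IS : submodule I) (f : {linear M -> N}) :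
  (forall x, I (f x)) -> exists g : {linear M -> submod IS}, forall x, incl IS (g x) = f x.
Proof.
move=> If; have [g gE] := choice (fun x => incl_surj IS (If x)).
have gL : linear g.
  by move=> a x y; apply: (@incl_inj _ _ IS); rewrite linearP !gE linearP.
by exists (pack_linear gL).
Qed.

Lemma ker_submodule M N (f : {linear M -> N}) : submodule (fun x => f x = 0).
Proof.
by split=> [|a x y]; rewrite ?linear0 // linearP => -> ->; rewrite scaler0 addr0.
Qed.

Lemma im_submodule M N (f : {linear M -> N}) :
  submodule (fun y => exists x, f x = y).
Proof.
split=> [|a x y [x' <-] [y' <-]]; first by exists 0; rewrite linear0.
by exists (a *: x' + y'); rewrite linearP.
Qed.

Definition short_exact M N P (i : {linear N -> P}) (e : {linear P -> M}) : Prop :=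
  [/\ injective i, forall x, e x = 0 <-> exists y, i y = x
    & forall y, exists x, e x = y].

Lemma ker_short_exact M P (e : {linear P -> M}) : (forall y, exists x, e x = y) ->
  short_exact (incl (ker_submodule e)) e.
Proof.
move=> eS; split=> // [|x]; first exact: incl_inj.
by split=> [/(incl_surj (ker_submodule e))//|[y <-]]; exact: (inclP y).
Qed.

Lemma retract_projective M P (s : {linear M -> P}) (r : {linear P -> M}) :
  (forall x, r (s x) = x) -> projective P -> projective M.
Proof.
move=> rs Pp A B g f gS.
have [h hE] := Pp A B g (f \o r) gS.
by exists (h \o s) => x /=; rewrite hE /= rs.
Qed.

(** One syzygy at a time: a recursive form of [projdim_le], on which inductions can run. *)
Fixpoint pd_le M n : Prop :=
  if n is n'.+1 then
    exists (P N : lmodType R) (i : {linear N -> P}) (e : {linear P -> M}),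
      [/\ projective P, short_exact i e & pd_le N n']
  else projective M.

Lemma projdim_le_pd_le M k : projdim_le M k -> pd_le M k.
Proof.
elim: k M => [|k IHk] M [P [d [e [Pp eS eK dK P0]]]] /=.
  (* Here [P 1] vanishes, so e is an isomorphism and M inherits projectivity from [P 0]. *)
  have eI : forall x, e x = 0 -> x = 0.
    by move=> x /eK[y <-]; rewrite (P0 1%N y) // linear0.
  have [s sE] := choice eS.
  have sL : linear s.
    move=> a x y; apply/eqP; rewrite -subr_eq0; apply/eqP/eI.
    by rewrite linearB linearP /= !sE subrr.
  by apply: (@retract_projective _ _ (pack_linear sL) e) => //.
exists (P 0%N), (submod (ker_submodule e)), (incl _), e; split=> //.
  exact: ker_short_exact.
apply: IHk.
have dker x : e (d 0%N x) = 0 by apply/eK; exists x.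
have [g gE] := corestrict (ker_submodule e) dker.
exists (fun i => P i.+1), (fun i => d i.+1), g; split=> // [y|x|i x ki].
- have [x xE] := (eK _).1 (inclP y); exists x.
  by apply: (@incl_inj _ _ (ker_submodule e)); rewrite gE.
- rewrite -dK -gE; split=> [->|]; first by rewrite linear0.
  by move=> h; apply: (@incl_inj _ _ (ker_submodule e)); rewrite h linear0.
- exact: P0.
Qed.

(** The kernel of the identity serves as the zero module that fills a resolution beyond its
    length. *)
Let zero_mod M : lmodType R := submod (ker_submodule (idfun : {linear M -> M})).

Lemma zero_modE M (x : zero_mod M) : x = 0.
Proof. by apply: (@incl_inj _ _ (ker_submodule _)); rewrite linear0; apply: inclP x. Qed.

Definition lmod_cons M (Q : nat -> lmodType R) (j : nat) : lmodType R :=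
  if j is j'.+1 then Q j' else M.

Lemma pd_le_projdim_le M k : pd_le M k -> projdim_le M k.
Proof.
elim: k M => [|k IHk] M /=.
  move=> Mp; pose Z := zero_mod M.
  exists (lmod_cons M (fun=> Z)).
  have zL (A B : lmodType R) : linear (fun _ : A => (0 : B)).
    by move=> a x y; rewrite scaler0 addr0.
  exists (fun i => match i return {linear Z -> lmod_cons M (fun=> Z) i} with
     | 0%N => pack_linear (zL Z M) | _ => pack_linear (zL Z Z) end), idfun.
  split=> [[|i]|y|x|[|i] x|[|i] x] //=; last by rewrite [x](@zero_modE M).
  - by move=> A B g f _; exists (pack_linear (zL Z A)) => x /=;
    rewrite (@zero_modE M x) !linear0.
  - by exists y.
  - by split=> [->|[_ <-]//]; exists 0.
  - by split=> // _; exists 0; rewrite [x](@zero_modE M).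
  - by split=> // _; exists 0; rewrite [x](@zero_modE M).
case=> P [N [i [e [Pp [iI eK eS] /IHk[Q [d [f [Qp fS fK dK Q0]]]]]]]].
exists (lmod_cons P Q).
exists (fun j => match j return {linear Q j -> lmod_cons P Q j} with
   | 0%N => i \o f | j'.+1 => d j' end), e.
split=> [[|j]|y|x|[|j] x|[|j] x] //=.
- rewrite eK; split=> [[y <-]|[z <-]]; last by exists (f z).
  by have [z <-] := fS y; exists z.
- by rewrite -fK -[0](linear0 i); split=> [/iI|->].
- exact: dK.
- exact: Q0.
Qed.

(* Every linear map Z -> N extends along i; for projective P and e : P -> M with
   kernel i this says Ext^1(M, N) = 0. *)
Definition extends N Z P (i : {linear Z -> P}) : Prop :=
  forall f : {linear Z -> N}, exists g : {linear P -> N}, forall z, g (i z) = f z.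

Fixpoint ext_vanish N n M : Prop :=
  forall (P Z : lmodType R) (i : {linear Z -> P}) (e : {linear P -> M}),
    projective P -> short_exact i e ->
    if n is n'.+1 then ext_vanish N n' Z else extends N i.

(** Passing to syzygies reduces to n = 0. There the vanishing of Ext^1(M, N) for the syzygy N itself
    extends the identity of N to a retraction of i, so the sequence splits and M is a summand of
    P. *)
Lemma pd_le_pred M n : (forall N, ext_vanish N n M) -> pd_le M n.+1 -> pd_le M n.
Proof.
elim: n M => [|n IHn] M extM /= [P [N [i [e [Pp ie pN]]]]].
  have [r rE] := extM N P N i e Pp ie idfun.
  case: ie => iI eK eS.
  have [s sE] := choice eS.
  (* The difference x - i (r x) depends only on e x, so t does not depend on the choice of s and is
     linear. *)
  pose t y := s y - i (r (s y)).
  have et y : e (t y) = y.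
    rewrite /t linearB sE /= (_ : e (i _) = 0) ?subr0 //.
    by apply/eK; eexists.
  have tu x : t (e x) = x - i (r x).
    have : e (s (e x) - x) = 0 by rewrite linearB sE /= subrr.
    move/eK => [y yE]; have sE' : s (e x) = i y + x by rewrite yE subrK.
    by rewrite /t sE' (linearD r) rE (linearD i) /= opprD addrACA subrr add0r.
  have tL : linear t.
    move=> a x y; have [u <-] := eS x; have [v <-] := eS y.
    by rewrite -linearP !tu (linearP r) (linearP i) scalerBr opprD addrACA.
  exact: (@retract_projective _ _ (pack_linear tL) e).
exists P, N, i, e; split=> //; apply: IHn => // Q.
exact: extM ie.
Qed.

End LinearMaps.

(** * Free modules, and projective modules as their summands *)

Section FreeCover.
Variable R : nzRingType.

Lemma coeff_sum_freeg (T : choiceType) (r : seq T) (g : T -> R) (x : T) :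
  uniq r -> coeff x (\sum_(y <- r) << g y *g y >>) = if x \in r then g x else 0.
Proof.
move=> ur; rewrite raddf_sum /=; under eq_bigr do rewrite coeffU.
case: ifP => xr.
  rewrite (bigD1_seq x) //= eqxx mulr1 big1 ?addr0 // => y yx.
  by rewrite (negbTE yx) mulr0.
rewrite big_seq big1 // => y yr; case: eqP => [yx|]; last by rewrite mulr0.
by rewrite -yx yr in xr.
Qed.

Lemma freeg_ext (T : choiceType) (x y : {freeg T / R}) :
  (forall t, coeff t x = coeff t y) -> x = y.
Proof. by move=> h; apply/eqP/freeg_eqP. Qed.

(** With one list containing the supports of two elements and of their combination, linearity can be
    checked term by term. *)
Lemma fglift_big (T : choiceType) (M : lmodType R) (f : T -> M) (r : seq T)
    (x : {freeg T / R}) : uniq r -> {subset dom x <= r} ->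
  fglift f x = \sum_(t <- r) coeff t x *: f t.
Proof.
move=> ur xr; rewrite -[in LHS](Freeg_dom x) fglift_Freeg /prelift big_map /=.
rewrite [RHS](bigID (fun t => t \in dom x)) /= addrC.
rewrite [X in _ = X + _]big1 ?add0r => [|t tx]; last first.
  by rewrite (coeff_outdom tx) scale0r.
rewrite -[RHS]big_filter; apply: perm_big; apply: uniq_perm.
- exact: uniq_dom.
- exact: filter_uniq.
- by move=> t; rewrite mem_filter; case: (boolP (t \in dom x)) => // /xr ->.
Qed.

Lemma fglift_linear (T : choiceType) (M : lmodType R) (f : T -> M) :
  linear (fglift f : {freeg T / R} -> M).
Proof.
move=> a x y; pose r := undup (dom x ++ dom y ++ dom (a *: x + y)).
have ur : uniq r by exact: undup_uniq.
rewrite !(@fglift_big _ _ _ r) //;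
  try by move=> t; rewrite mem_undup !mem_cat => ->; rewrite ?orbT.
rewrite scaler_sumr -big_split /=; apply: eq_bigr => t _.
by rewrite coeffD coeffZ scalerDl scalerA.
Qed.

(** The cover is the free module on the elements of P itself. *)
Lemma projective_summand (P : lmodType R) : projective P ->
  exists (s : {linear P -> {freeg P / R}}) (r : {linear {freeg P / R} -> P}),
    forall x, r (s x) = x.
Proof.
move=> Pp; pose r := pack_linear (fglift_linear (idfun : P -> P)).
have rS y : exists x, r x = y by exists << y >>; rewrite /= liftU scale1r.
by have [s sE] := Pp _ _ r idfun rS; exists s, r.
Qed.

End FreeCover.

(** * Koszul complexes *)

Section Koszul.
Variable R : comNzRingType.
Implicit Types (M N P Z : lmodType R) (f : R) (fs : seq R) (b : seq bool).

(* A Koszul cochain of M on the sequence fs is a function on the subsets of the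
   indices of fs, encoded as bit vectors; only those of size (size fs) matter. *)
Fixpoint koszul_d M fs (c : seq bool -> M) b : M :=
  match fs, b with
  | f :: fs', x :: b' =>
      if x then f *: c (false :: b') - koszul_d fs' (fun s => c (true :: s)) b'
      else koszul_d fs' (fun s => c (false :: s)) b'
  | _, _ => 0
  end.

Definition koszul_deg M n j (c : seq bool -> M) : Prop :=
  forall b, ~~ ((size b == n) && (count id b == j)) -> c b = 0.

(** Cochains of degree j - 1, written so that j = 0 leaves only the zero cochain; this lets
    [koszul_vanish] cover H^0 as well. *)
Definition koszul_deg_pred M n j (c : seq bool -> M) : Prop :=
  forall b, ~~ ((size b == n) && ((count id b).+1 == j)) -> c b = 0.

Definition koszul_vanish fs M j : Prop :=
  forall c : seq bool -> M, koszul_deg (size fs) j c -> (forall b, koszul_d fs c b = 0) ->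
  exists2 e : seq bool -> M, koszul_deg_pred (size fs) j e & forall b, koszul_d fs e b = c b.

Lemma eq_koszul_d M fs (c c' : seq bool -> M) b : c =1 c' -> koszul_d fs c b = koszul_d fs c' b.
Proof.
elim: fs c c' b => [|f fs IHfs] c c' [|[] b] //= cc'; last exact: IHfs.
by rewrite cc'; congr (_ - _); apply: IHfs.
Qed.

Lemma koszul_d_linear M fs a (c c' : seq bool -> M) b :
  koszul_d fs (fun s => a *: c s + c' s) b = a *: koszul_d fs c b + koszul_d fs c' b.
Proof.
elim: fs c c' b => [|f fs IHfs] c c' [|[] b] /=; rewrite ?scaler0 ?addr0 //.
rewrite IHfs scalerDr scalerBr !scalerA [f * a]mulrC opprD !addrA.
by congr (_ - _); rewrite -!addrA; congr (_ + _); rewrite addrC.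
Qed.

Lemma koszul_d0 M fs b : koszul_d fs (fun=> 0 : M) b = 0.
Proof.
elim: fs b => [|f fs IHfs] [|[] b] //=.
by rewrite scaler0 sub0r IHfs oppr0.
Qed.

Lemma koszul_dB M fs (c c' : seq bool -> M) b :
  koszul_d fs (fun s => c s - c' s) b = koszul_d fs c b - koszul_d fs c' b.
Proof.
rewrite -scaleN1r addrC -koszul_d_linear; apply: eq_koszul_d => s.
by rewrite scaleN1r addrC.
Qed.

Lemma koszul_dZ M fs a (c : seq bool -> M) b :
  koszul_d fs (fun s => a *: c s) b = a *: koszul_d fs c b.
Proof.
rewrite -[RHS]addr0 -(koszul_d0 M fs b) -koszul_d_linear.
by apply: eq_koszul_d => s; rewrite addr0.
Qed.

Lemma koszul_dN M fs (c : seq bool -> M) b :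
  koszul_d fs (fun s => - c s) b = - koszul_d fs c b.
Proof. by rewrite -scaleN1r -koszul_dZ; apply: eq_koszul_d => s; rewrite scaleN1r. Qed.

Lemma koszul_d_map M N fs (phi : {linear M -> N}) (c : seq bool -> M) b :
  phi (koszul_d fs c b) = koszul_d fs (phi \o c) b.
Proof.
elim: fs c b => [|f fs IHfs] c [|[] b] /=; rewrite ?linear0 //.
by rewrite linearB linearZ /= IHfs.
Qed.

Lemma koszul_dK M fs (c : seq bool -> M) b : koszul_d fs (koszul_d fs c) b = 0.
Proof.
elim: fs c b => [|f fs IHfs] c [|[] b] //=.
by rewrite koszul_dB koszul_dZ IHfs subr0 subrr.
Qed.

Lemma koszul_d_deg M fs j (c : seq bool -> M) :
  koszul_deg_pred (size fs) j c -> koszul_deg (size fs) j (koszul_d fs c).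
Proof.
elim: fs j c => [|f fs IHfs] j c cj [|[] b] //= bj; last first.
  apply: (IHfs j) => [s sj|]; first by apply: cj; rewrite /= eqSS add0n.
  by rewrite add0n in bj.
rewrite cj ?scaler0 ?sub0r /=; last by move: bj; rewrite /= eqSS add0n add1n.
case: j cj bj => [|j] cj bj.
  rewrite (@eq_koszul_d _ _ _ (fun=> 0)) ?koszul_d0 ?oppr0 // => s.
  by apply: cj; rewrite andbF.
rewrite (IHfs j) ?oppr0 // => s sj.
by apply: cj; rewrite /= !eqSS add1n.
Qed.

Lemma koszul_deg_predS M n j (c : seq bool -> M) :
  koszul_deg n j c -> koszul_deg_pred n j.+1 c.
Proof. by move=> cj b; rewrite eqSS; apply: cj. Qed.

Lemma koszul_deg_cons M n j (c : seq bool -> M) :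
  koszul_deg n.+1 j c -> koszul_deg n j (fun s => c (false :: s)) /\
                   koszul_deg_pred n j (fun s => c (true :: s)).
Proof.
by move=> cj; split=> s sj; apply: cj; rewrite /= eqSS ?add0n ?add1n.
Qed.

Lemma count_nseqP n b : (size b == n) && (count id b == n) = (b == nseq n true).
Proof.
apply/andP/eqP => [[/eqP <- /eqP bn]|->]; last first.
  by rewrite size_nseq count_nseq mul1n !eqxx.
have := bn; move/eqP; rewrite -all_count => /allP h.
apply: (@eq_from_nth _ true) => [|i ib]; first by rewrite size_nseq.
by rewrite nth_nseq ib; apply: h; rewrite mem_nth.
Qed.

Fixpoint seq_ideal fs (x : R) : Prop :=
  if fs is f :: fs' then exists a, seq_ideal fs' (x - a * f) else x = 0.

(** The top Koszul cohomology is R/(fs): the all-true vector is the only index in top degree, and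
    the coboundaries there are the combinations of fs, up to signs absorbed by e. *)
Lemma seq_ideal_koszul fs x :
  seq_ideal fs x <-> exists2 e : seq bool -> R^o, koszul_deg_pred (size fs) (size fs) e
                  & koszul_d fs e (nseq (size fs) true) = x.
Proof.
elim: fs x => [|f fs IHfs] x /=.
  by split=> [->|[e _ <-]//]; exists (fun=> 0).
split=> [[a /IHfs[e ej eE]]|[e ej eE]].
  exists (fun b => if b is h :: s then
      if h then - e s else (if s == nseq (size fs) true then a else 0)
    else 0).
  - case=> [|[] s] //=; rewrite !eqSS ?add1n ?add0n => sj.
      by rewrite ej ?oppr0.
    by rewrite -count_nseqP (negbTE sj).
  - by rewrite eqxx koszul_dN opprK eE addrC mulrC subrK.
exists (e (false :: nseq (size fs) true)); apply/IHfs.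
exists (fun s => - e (true :: s)).
  by move=> s sj; rewrite ej ?oppr0 //= eqSS add1n.
by rewrite koszul_dN -eE mulrC addrAC subrr sub0r.
Qed.

(** The sequence is read from its end, each element being a nonzerodivisor modulo those after it, to
    match the recursion of [koszul_d]. *)
Fixpoint regseq fs : Prop :=
  if fs is f :: fs' then
    regseq fs' /\ forall x, seq_ideal fs' (f * x) -> seq_ideal fs' x
  else True.

(** The complex of f :: fs is the cone of multiplication by f on the complex of fs, so induction
    settles all degrees but [size fs]. There the component of c without f has a class in R/(fs); the
    cocycle condition says that f kills it, and regularity that it is zero. *)
Lemma regseq_koszul fs j : regseq fs -> (j < size fs)%N ->
  koszul_vanish fs R^o j.
Proof.
elim: fs j => [|f fs IHfs] j //= [rfs freg]; rewrite ltnS => jfs c cj c0.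
have [cj0 cj1] := koszul_deg_cons cj.
have [e0 e0j e0E] : exists2 e : seq bool -> R^o, koszul_deg_pred (size fs) j e
    & forall b, koszul_d fs e b = c (false :: b).
  move: jfs; rewrite leq_eqVlt => /orP[/eqP jE|jfs]; last first.
    by apply: IHfs => // b; exact: (c0 (false :: b)).
  set u := nseq (size fs) true.
  have /seq_ideal_koszul[e ej eE] : seq_ideal fs (c (false :: u)).
    apply: freg; apply/seq_ideal_koszul; exists (fun s => c (true :: s)).
      by rewrite -{2}jE.
    by apply/esym/eqP; rewrite -subr_eq0; apply/eqP; exact: (c0 (true :: u)).
  exists e => [|b]; first by rewrite jE.
  have [->//|bu] := eqVneq b u.
  rewrite (koszul_d_deg ej) ?(cj (false :: b)) //= ?eqSS ?add0n ?jE count_nseqP //.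
have c1E b : f *: c (false :: b) = koszul_d fs (fun s => c (true :: s)) b.
  by apply/eqP; rewrite -subr_eq0; apply/eqP; exact: (c0 (true :: b)).
(* The index of f itself counts one, so [e1] has degree j - 2 in the complex of fs. *)
have [e1 e1j e1E] : exists2 e : seq bool -> R^o,
    forall b, ~~ ((size b == size fs) && ((count id b).+2 == j)) -> e b = 0
    & forall b, koszul_d fs e b = f *: e0 b - c (true :: b).
  case: j jfs cj cj0 cj1 e0j => [|j] jfs cj cj0 cj1 e0j.
    exists (fun=> 0) => // b; rewrite koszul_d0 e0j ?andbF // cj ?andbF //.
    by rewrite scaler0 subrr.
  apply: IHfs => // [b bj|b]; last by rewrite koszul_dB koszul_dZ e0E c1E subrr.
  by rewrite e0j ?(cj (true :: b)) ?eqSS //= ?add1n ?eqSS // scaler0 subrr.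
exists (fun b => if b is h :: s then if h then e1 s else e0 s else 0).
  case=> [|[] b] //=; rewrite eqSS ?add1n ?add0n => bj; first exact: e1j.
  exact: e0j.
case=> [|[] b] //=; first by rewrite cj.
by rewrite (e1E b) subKr.
Qed.

Lemma koszul_retract fs M P j (s : {linear M -> P}) (r : {linear P -> M}) :
  (forall x, r (s x) = x) -> koszul_vanish fs P j -> koszul_vanish fs M j.
Proof.
move=> rs vP c cj c0.
have [|b|e ej eE] := vP (s \o c).
- by move=> b bj /=; rewrite cj ?linear0.
- by rewrite -koszul_d_map c0 linear0.
exists (r \o e) => [b bj|b]; first by rewrite /= ej ?linear0.
by rewrite -koszul_d_map eE /= rs.
Qed.

Lemma coeff_is_linear (T : choiceType) (t : T) :
  linear (coeff t : {freeg T / R} -> R^o).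
Proof. by move=> a x y; rewrite coeffD coeffZ. Qed.

(** One coordinate at a time. Only finitely many bit vectors matter, so c has finitely many nonzero
    coordinates; taking the zero primitive on the others keeps the sum finite, whatever the size of
    the basis. *)
Lemma koszul_freeg fs (T : choiceType) j :
  koszul_vanish fs R^o j -> koszul_vanish fs {freeg T / R} j.
Proof.
move=> vR c cj c0; pose ct t b : R^o := coeff t (c b).
have ctE t b : koszul_d fs (ct t) b = 0.
  have := koszul_d_map fs (pack_linear (coeff_is_linear t)) c b.
  by rewrite c0 linear0 => <-.
have /choice[e eE] : forall t, exists e : seq bool -> R^o,
    [/\ koszul_deg_pred (size fs) j e, forall b, koszul_d fs e b = ct t b
      & (forall b, ct t b = 0) -> forall b, e b = 0].
  move=> t; have [z|nz] := pselect (forall b, ct t b = 0).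
    by exists (fun=> 0); split=> // b; rewrite koszul_d0 z.
  have [|e ej eE] := vR (ct t) _ (ctE t); last by exists e; split.
  by move=> b bj; rewrite /ct cj // coeff0.
pose n := size fs.
pose D := undup (flatten [seq dom (c (val b)) | b : n.-tuple bool]).
have uD : uniq D by exact: undup_uniq.
have outD t : t \notin D -> forall b, ct t b = 0.
  move=> tD b; have [bn|bn] := boolP (size b == n); last first.
    by rewrite /ct cj ?coeff0 // (negbTE bn).
  apply: coeff_outdom; apply: contra tD => tb; rewrite mem_undup.
  apply/flattenP; exists (dom (c b)) => //.
  by apply/mapP; exists (Tuple bn); rewrite ?mem_enum.
exists (fun b => \sum_(t <- D) << e t b *g t >>) => [b bj|b].
  by apply: big1 => t _; have [ej _ _] := eE t; rewrite ej // freegU0.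
apply: freeg_ext => t; have [_ eb ez] := eE t.
apply: (etrans (koszul_d_map fs (pack_linear (coeff_is_linear t)) _ b)).
apply: etrans (eb b); apply: eq_koszul_d => s /=.
rewrite coeff_sum_freeg //; case: ifP => // /negbT tD.
by rewrite ez //; exact: outD.
Qed.

Lemma koszul_projective fs P j :
  koszul_vanish fs R^o j -> projective P -> koszul_vanish fs P j.
Proof.
move=> vR /projective_summand[s [r rs]].
by apply: koszul_retract rs _; exact: koszul_freeg.
Qed.

(** A chase through H^j(P) -> H^j(M) -> H^(j+1)(Z) in the long exact sequence. *)
Lemma koszul_short_exact fs Z P M (i : {linear Z -> P}) (e : {linear P -> M}) j :
  short_exact i e -> koszul_vanish fs P j -> koszul_vanish fs Z j.+1 ->
  koszul_vanish fs M j.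
Proof.
move=> [iI eK eS] vP vZ c cj c0.
have [l lE] := choice eS.
(* The chosen preimage of 0 need not be 0, so [c'] is cut off outside degree j. *)
pose c' b := if (size b == size fs) && (count id b == j) then l (c b) else 0.
have c'j : koszul_deg (size fs) j c' by move=> b; rewrite /c' => /negbTE ->.
have ec' b : e (c' b) = c b.
  by rewrite /c'; case: ifP => [_|/negbT /cj ->]; rewrite ?lE ?linear0.
have /choice[z zE] : forall b, exists z, i z = koszul_d fs c' b.
  move=> b; apply/eK; rewrite koszul_d_map -[RHS](c0 b); apply: eq_koszul_d => s /=.
  exact: ec'.
have [|b|w wj wE] := vZ z.
- move=> b bj; apply: iI; rewrite zE linear0.
  by apply: (koszul_d_deg (koszul_deg_predS c'j)).
- apply: iI; rewrite linear0 koszul_d_map -[RHS](koszul_dK fs c' b).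
  by apply: eq_koszul_d => s /=.
have [|b|g gj gE] := vP (fun b => c' b - i (w b)).
- by move=> b bj; rewrite c'j // wj // !linear0 addr0.
- rewrite koszul_dB; have := koszul_d_map fs i w b; rewrite /comp => <-.
  by rewrite wE zE subrr.
exists (e \o g) => [b bj|b]; first by rewrite /= gj ?linear0.
rewrite -koszul_d_map gE linearB ec' (_ : e (i _) = 0) ?subr0 //.
by apply/eK; exists (w b).
Qed.

(** Passing to a syzygy raises the degree by one and lowers k by one, so j + k stays below the
    length until the module is projective. *)
Lemma pd_koszul fs M k j :
  regseq fs -> pd_le M k -> (j + k < size fs)%N -> koszul_vanish fs M j.
Proof.
move=> rfs; elim: k M j => [|k IHk] M j /=.
  by rewrite addn0 => Mp jn; apply: koszul_projective Mp; exact: regseq_koszul.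
case=> P [N [i [e [Pp ie pN]]]] jn.
apply: (koszul_short_exact ie); last by apply: IHk; rewrite // addSnnS.
apply: koszul_projective Pp; apply: regseq_koszul => //.
by apply: leq_ltn_trans jn; exact: leq_addr.
Qed.

End Koszul.

(** * Splitting of subspaces over the ground field *)

Section VectorSpaceSplitting.
Variables (K : fieldType) (R : nzRingType) (kappa : {rmorphism K -> R}).

Definition klinear (E N : lmodType R) (f : E -> N) : Prop :=
  forall c x y, f (kappa c *: x + y) = kappa c *: f x + f y.

Lemma klinear0 (E N : lmodType R) (f : E -> N) : klinear f -> f 0 = 0.
Proof.
by move=> /(_ (-1) 0 0); rewrite scaler0 addr0 rmorphN1 scaleN1r addNr.
Qed.

Lemma klinearB (E N : lmodType R) (f : E -> N) : klinear f ->
  forall x y, f (x - y) = f x - f y.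
Proof.
move=> /(_ (-1)) fL x y; rewrite addrC -[in LHS]scaleN1r.
by rewrite -(rmorphN1 kappa) fL rmorphN1 scaleN1r addrC.
Qed.

(** By Zorn's lemma some subset, closed under combinations, is maximal among those meeting I in 0 at
    most. If x were not in its sum with I, adding the line of x would contradict maximality; p
    projects to I along it. *)
Lemma klinear_projection (E : lmodType R) (I : E -> Prop) :
  I 0 -> (forall c x y, I x -> I y -> I (kappa c *: x + y)) ->
  exists p : E -> E, [/\ klinear p, forall x, I (p x) & forall x, I x -> p x = x].
Proof.
move=> I0 IL.
pose P (C : E -> Prop) := (forall c x y, C x -> C y -> C (kappa c *: x + y)) /\
  (forall x, C x -> I x -> x = 0).
have [F FP Ftot|C [[CL CI] Cmax]] := @classical_sets.Zorn_bigcup E P.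
  split=> [c x y [X FX Xx] [Y FY Yy]|x [X FX Xx]]; last exact: (FP _ FX).2.
  have [XY|YX] := Ftot _ _ FX FY.
    by exists Y => //; apply: (FP _ FY).1 => //; exact: XY.
  by exists X => //; apply: (FP _ FX).1 => //; exact: YX.
(* The union of the empty chain is empty, so 0 could not be demanded of C; it is adjoined here. *)
pose C' x := x = 0 \/ C x.
have C'L c x y : C' x -> C' y -> C' (kappa c *: x + y).
  move=> [->|Cx] [->|Cy]; rewrite ?scaler0 ?addr0 ?add0r; [by left|by right| |].
    right; have -> : kappa c *: x = kappa (c - 1) *: x + x.
      by rewrite rmorphB rmorph1 scalerBl scale1r subrK.
    exact: CL.
  by right; exact: CL.
have C'I x : C' x -> I x -> x = 0 by case=> // /CI.
have dec x : exists y, I y /\ C' (x - y).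
  apply: contrapT => nx.
  pose B u := exists a w, C' w /\ u = kappa a *: x + w.
  have CB u : C u -> B u.
    by exists 0, u; rewrite rmorph0 scale0r add0r; split=> //; right.
  have Bx : B x by exists 1, 0; rewrite rmorph1 scale1r addr0; split=> //; left.
  apply: (Cmax B).
    split=> // /(_ x Bx) Cx; apply: nx; exists 0; split=> //.
    by rewrite subr0; right.
  split=> [c _ _ [a [w [Cw ->]]] [b [v [Cv ->]]]|_ [a [w [Cw ->]]] Iu].
    exists (c * a + b), (kappa c *: w + v); split; first exact: C'L.
    by rewrite rmorphD rmorphM scalerDl scalerDr scalerA addrACA.
  have [a0|a0] := eqVneq a 0.
    by move: Iu; rewrite a0 rmorph0 scale0r add0r; exact: C'I.
  exfalso; apply: nx; exists (kappa a^-1 *: (kappa a *: x + w)); split.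
    by rewrite -[_ *: _]addr0; exact: IL.
  rewrite scalerDr scalerA -rmorphM mulVf // rmorph1 scale1r opprD addrA subrr.
  have : C' (kappa (- a^-1) *: w + 0) by apply: C'L => //; left.
  by rewrite addr0 rmorphN scaleNr sub0r.
have uniq_dec x y z : I y -> I z -> C' (x - y) -> C' (x - z) -> y = z.
  move=> Iy Iz Cy Cz; apply/eqP; rewrite -subr_eq0; apply/eqP; apply: C'I.
    have -> : y - z = kappa (-1) *: (x - y) + (x - z).
      by rewrite rmorphN1 scaleN1r opprB addrA subrK.
    exact: C'L.
  have -> : y - z = kappa (-1) *: z + y by rewrite rmorphN1 scaleN1r addrC.
  exact: IL.
have [p pE] := choice dec.
exists p; split=> [c x y|x|x Ix]; last 1 first.
- have [Ip Cp] := pE x; apply: (uniq_dec x) => //.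
  by rewrite subrr; left.
- have [Ix Cx] := pE x; have [Iy Cy] := pE y; have [Ixy Cxy] := pE (kappa c *: x + y).
  apply: (uniq_dec (kappa c *: x + y)) => //; first exact: IL.
  by rewrite opprD addrACA -scalerBr; exact: C'L.
- by case: (pE x).
Qed.

(** An arbitrary preimage minus its projection to the kernel of g no longer depends on the choice,
    hence is linear in y. *)
Lemma klinear_section (E N : lmodType R) (g : E -> N) :
  klinear g -> (forall y, exists x, g x = y) ->
  exists s : N -> E, klinear s /\ forall y, g (s y) = y.
Proof.
move=> gL gS; have g0 := klinear0 gL.
have [||p [pL pI pid]] := @klinear_projection E (fun x => g x = 0).
- exact: g0.
- by move=> c x y gx gy; rewrite gL gx gy scaler0 addr0.
have [l lE] := choice gS.
exists (fun y => l y - p (l y)); split=> [c x y|y]; last first.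
  by rewrite klinearB // lE pI subr0.
have := pid (l (kappa c *: x + y) - (kappa c *: l x + l y)).
rewrite klinearB // gL !lE subrr => /(_ erefl).
rewrite (klinearB pL) pL => e; rewrite scalerBr addrACA -opprD.
set a := l (_ + _) in e *; set b := kappa c *: l x + l y in e *.
by apply/eqP; rewrite subr_eq -addrA [- _ + _]addrC e addrC subrK.
Qed.

End VectorSpaceSplitting.

(** * Coordinate changes and regular sequences *)

Section Coordinates.
Variables (K : fieldType) (n : nat).
Local Notation S := {mpoly K[n]}.
Implicit Types (z : 'I_n -> S) (f g : S) (i j : 'I_n) (mu nu : 'X_{1..n}).

Definition subst z f : S := f \mPo [tuple z i | i < n].

Lemma substX z i : subst z 'X_i = z i.
Proof. by rewrite /subst comp_mpolyXU -tnth_nth tnth_mktuple. Qed.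

Lemma substM z : {morph subst z : f g / f * g}.
Proof. by move=> f g; rewrite /subst rmorphM. Qed.

Lemma substXn z f k : subst z (f ^+ k) = subst z f ^+ k.
Proof. by rewrite /subst rmorphXn. Qed.

Lemma subst_linear z c f g : subst z (c *: f + g) = c *: subst z f + subst z g.
Proof. by rewrite /subst comp_mpolyD comp_mpolyZ. Qed.

Lemma mpoly_lin_ind (P : S -> Prop) :
  (forall c f g, P f -> P g -> P (c *: f + g)) -> (forall mu, P 'X_[mu]) ->
  forall f, P f.
Proof.
move=> PL PX; elim/mpolyind => [|c m p _ _ IHp]; last exact: PL.
have := PL (-1) _ _ (PX 0%MM) (PX 0%MM).
by rewrite scaleN1r addNr.
Qed.

Lemma mnm_ind (P : 'X_{1..n} -> Prop) :
  P 0%MM -> (forall mu i, P mu -> P (mu + U_(i))%MM) -> forall mu, P mu.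
Proof.
move=> P0 PU mu; elim: (mdeg mu) {-2}mu (erefl (mdeg mu)) => {mu} [|k IHk] mu mk.
  by move/eqP: mk; rewrite mdeg_eq0 => /eqP ->.
have [i mi] : exists i, mu i != 0%N.
  apply: contrapT => h; suff mu0 : mu = 0%MM by rewrite mu0 mdeg0 in mk.
  apply/mnmP => i; rewrite mnm0E; apply/eqP; apply: contraT => mi.
  by case: h; exists i.
have le1 : (U_(i) <= mu)%MM by rewrite lep1mP.
rewrite -(submK le1); apply: PU; apply: IHk.
by apply/eqP; rewrite -(eqn_add2r 1) -{1}(mdeg1 i) -mdegD submK // mk addn1.
Qed.

Lemma substK z z' : (forall i, subst z (z' i) = 'X_i) ->
  forall f, subst z (subst z' f) = f.
Proof.
move=> zz; apply: mpoly_lin_ind => [c f g fE gE|].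
  by rewrite !subst_linear fE gE.
elim/mnm_ind => [|mu i IH]; last by rewrite mpolyXD !substM IH substX zz.
by rewrite mpolyX0 /subst !rmorph1.
Qed.

Definition coordinates z z' : Prop :=
  (forall i, subst z (z' i) = 'X_i) /\ (forall i, subst z' (z i) = 'X_i).

Fixpoint in_ideal_powers (s : seq ('I_n * nat)) mu : bool :=
  if s is (i, k) :: s' then (k <= mu i)%N || in_ideal_powers s' mu else false.

Lemma seq_idealD fs (f g : S) : seq_ideal fs f -> seq_ideal fs g -> seq_ideal fs (f + g).
Proof.
elim: fs f g => [|h fs IHfs] f g /=; first by move=> -> ->; rewrite addr0.
move=> [a fa] [b gb]; exists (a + b).
by rewrite mulrDl opprD addrACA; exact: IHfs.
Qed.

Lemma seq_idealM fs (f g : S) : seq_ideal fs g -> seq_ideal fs (f * g).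
Proof.
elim: fs g => [|h fs IHfs] g /=; first by move=> ->; rewrite mulr0.
by move=> [a ga]; exists (f * a); rewrite -mulrA -mulrBr; exact: IHfs.
Qed.

Lemma seq_ideal0 fs : seq_ideal fs (0 : S).
Proof. by elim: fs => [|h fs IHfs] //=; exists 0; rewrite mul0r subr0. Qed.

Lemma seq_ideal_Xpow (s : seq ('I_n * nat)) f :
  seq_ideal [seq 'X_(x.1) ^+ x.2 | x <- s] f <->
  forall mu, mu \in msupp f -> in_ideal_powers s mu.
Proof.
split.
  elim: s f => [|[i k] s IHs] f /=; first by move=> ->; rewrite msupp0.
  move=> [a /IHs fa] mu; rewrite mcoeff_msupp => fmu.
  have [_|nmu] := boolP (in_ideal_powers s mu); first by rewrite orbT.
  rewrite orbF.
  apply: contraNT fmu; rewrite -ltnNge => lt_mu.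
  have : mu \notin msupp (f - a * 'X_i ^+ k) by apply: contra nmu => /fa.
  rewrite -mcoeff_eq0 mcoeffB => /eqP/eqP; rewrite subr_eq0 => /eqP ->.
  rewrite mpolyXn mcoeff_eq0; apply/negP => /msuppM_le/allpairsP[[m1 m2] /= [_]].
  rewrite msuppX mem_seq1 => /eqP -> mE; move: lt_mu.
  by rewrite mE mnmDE mulmnE mnm1E eqxx mul1n ltnNge leq_addl.
move=> fs; rewrite (mpolyE f) big_seq.
apply: (big_ind (seq_ideal _)) => [|g h|mu /fs mus]; [exact: seq_ideal0|exact: seq_idealD|].
rewrite -mul_mpolyC; apply: seq_idealM; elim: s {fs} mus => [|[i k] s IHs] //=.
case/orP => [kmu|/IHs Xs]; last by exists 0; rewrite mul0r subr0.
exists 'X_[mu - U_(i) *+ k]; rewrite mpolyXn -mpolyXD submK ?subrr; first exact: seq_ideal0.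
by apply/mnm_lepP => j; rewrite mulmnE mnm1E; case: eqP => [<-|_]; rewrite ?mul1n.
Qed.

(** Membership in a monomial ideal is read off the monomials of f, and multiplication by a power of
    'X_i leaves their exponents in the other variables unchanged. *)
Lemma regseq_Xpow (s : seq ('I_n * nat)) : uniq (unzip1 s) ->
  regseq [seq ('X_(x.1) ^+ x.2 : S) | x <- s].
Proof.
elim: s => [|[i k] s IHs] //= /andP[iNs us]; split; first exact: IHs.
move=> f /seq_ideal_Xpow fs; apply/seq_ideal_Xpow => mu muf.
have : in_ideal_powers s (U_(i) *+ k + mu)%MM.
  apply: fs; rewrite mcoeff_msupp mpolyXn mulrC mcoeffMX.
  by rewrite -mcoeff_msupp.
elim: s iNs {IHs us fs} => [|[j h] s IHs] //=; rewrite inE negb_or => /andP[ij iNs].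
rewrite mnmDE mulmnE mnm1E (negbTE ij) mul0n add0n.
by case/orP => [->//|/(IHs iNs) ->]; rewrite orbT.
Qed.

Lemma seq_ideal_subst z fs f : seq_ideal fs f -> seq_ideal (map (subst z) fs) (subst z f).
Proof.
elim: fs f => [|h fs IHfs] f /=; first by move=> ->; rewrite /subst rmorph0.
move=> [a /IHfs fa]; exists (subst z a); move: fa.
by rewrite /subst rmorphB rmorphM.
Qed.

Lemma regseq_subst z z' fs : coordinates z z' -> regseq fs ->
  regseq (map (subst z) fs).
Proof.
move=> [zz' z'z]; elim: fs => [|h fs IHfs] //= [/IHfs rfs hfs]; split=> // f.
move=> /(seq_ideal_subst z'); rewrite -map_comp.
rewrite (eq_map (g := id)); last by move=> x /=; rewrite substK.
rewrite map_id substM substK // => /hfs /(seq_ideal_subst z).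
by rewrite substK.
Qed.

Lemma regseq_coordinates z z' (s : seq ('I_n * nat)) :
  coordinates z z' -> uniq (unzip1 s) -> regseq [seq z x.1 ^+ x.2 | x <- s].
Proof.
move=> zz' us; have := regseq_subst zz' (regseq_Xpow us); rewrite -map_comp.
by congr regseq; apply: eq_map => x /=; rewrite substXn substX.
Qed.

End Coordinates.

(** * The syzygy theorem *)

Section SyzygyTheorem.
Variables (K : fieldType) (n : nat) (z z' : 'I_n -> {mpoly K[n]}).
Hypothesis zz' : coordinates z z'.
Local Notation S := {mpoly K[n]}.
Implicit Types (M N P E Z : lmodType S) (J : {set 'I_n}) (mu nu : 'X_{1..n}).

Local Notation kappa := (@mpolyC n K : {rmorphism K -> S}).

Definition zmon mu : S := subst z 'X_[mu].

Lemma zmonD mu nu : zmon (mu + nu)%MM = zmon mu * zmon nu.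
Proof. by rewrite /zmon mpolyXD substM. Qed.

Lemma zmonU i : zmon U_(i)%MM = z i.
Proof. exact: substX. Qed.

Lemma zmon0 : zmon 0%MM = 1.
Proof. by rewrite /zmon mpolyX0 /subst rmorph1. Qed.

Lemma z_ind (P : S -> Prop) :
  (forall c f g, P f -> P g -> P (c%:MP * f + g)) -> (forall mu, P (zmon mu)) ->
  forall f, P f.
Proof.
move=> PL Pz f; rewrite -(substK zz'.1 f).
elim/mpoly_lin_ind: (subst z' f) => // c g h Pg Ph.
by rewrite subst_linear -mul_mpolyC; exact: PL.
Qed.

(* Linearity over the subring K[z_j : j in J] *)
Definition Jlinear J M N (f : M -> N) : Prop :=
  klinear kappa f /\ forall j x, j \in J -> f (z j *: x) = z j *: f x.

Lemma Jlinear_linear J M N (f : {linear M -> N}) : Jlinear J f.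
Proof. by split=> [c x y|j x _]; rewrite ?linearP ?linearZ. Qed.

Lemma Jlinear_comp J M N P (f : M -> N) (g : N -> P) :
  Jlinear J f -> Jlinear J g -> Jlinear J (g \o f).
Proof.
move=> [fL fJ] [gL gJ]; split=> [c x y|j x jJ] /=; first by rewrite fL gL.
by rewrite fJ ?gJ.
Qed.

Lemma JlinearB J M N (f g : M -> N) :
  Jlinear J f -> Jlinear J g -> Jlinear J (fun x => f x - g x).
Proof.
move=> [fL fJ] [gL gJ]; split=> [c x y|j x jJ]; last by rewrite fJ ?gJ ?scalerBr.
by rewrite fL gL scalerBr opprD addrACA.
Qed.

Lemma Jlinear_sub J J' M N (f : M -> N) : J' \subset J -> Jlinear J f -> Jlinear J' f.
Proof. by move=> /subsetP J'J [fL fJ]; split=> // j x /J'J; exact: fJ. Qed.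

Lemma Jlinear_zmon J M N (f : M -> N) mu x : Jlinear J f ->
  (forall i, i \notin J -> mu i = 0%N) -> f (zmon mu *: x) = zmon mu *: f x.
Proof.
move=> [fL fJ]; elim/mnm_ind: mu x => [|mu i IH] x muJ.
  by rewrite zmon0 !scale1r.
rewrite zmonD zmonU -!scalerA IH ?fJ //.
  by apply: contraT => /muJ; rewrite mnmDE mnm1E eqxx addn1.
by move=> k /muJ; rewrite mnmDE => /eqP; rewrite addn_eq0 => /andP[/eqP].
Qed.

Lemma Jlinear_linear_all M N (f : M -> N) : Jlinear setT f -> linear f.
Proof.
move=> fB; have [fL fJ] := fB; have f0 := klinear0 fL.
move=> a x y; elim/z_ind: a x y => [c f1 f2 IH1 IH2|mu] x y.
  rewrite !scalerDl -!scalerA -addrA fL -[f1 *: x]addr0 IH1 f0 addr0 IH2.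
  by rewrite addrA.
have fD u v : f (u + v) = f u + f v.
  by have := fL 1 u v; rewrite rmorph1 !scale1r.
by rewrite fD (Jlinear_zmon _ fB) // => i; rewrite inE.
Qed.

(** The [zmon mu] form a K-basis of S, so the values of a K-linear map on them are free. *)
Lemma z_ext N (v : 'X_{1..n} -> N) :
  exists w : S^o -> N, klinear kappa w /\ forall mu, w (zmon mu) = v mu.
Proof.
pose w0 (g : S) := \sum_(mu <- msupp g) (g@_mu)%:MP *: v mu.
have w0E r (g : S) : uniq r -> {subset msupp g <= r} ->
    w0 g = \sum_(mu <- r) (g@_mu)%:MP *: v mu.
  move=> ur gr; rewrite /w0 [RHS](bigID (fun mu => mu \in msupp g)) /= addrC.
  rewrite [X in _ = X + _]big1 ?add0r => [|mu mug]; last first.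
    by rewrite memN_msupp_eq0 // mpolyC0 scale0r.
  rewrite -[RHS]big_filter; apply: perm_big; apply: uniq_perm.
  - exact: msupp_uniq.
  - exact: filter_uniq.
  - by move=> t; rewrite mem_filter; case: (boolP (t \in msupp g)) => // /gr ->.
have w0L c g h : w0 (c *: g + h) = c%:MP *: w0 g + w0 h.
  pose r := undup (msupp g ++ msupp h ++ msupp (c *: g + h)).
  have ur : uniq r by exact: undup_uniq.
  rewrite !(@w0E r) //;
    try by move=> t; rewrite mem_undup !mem_cat => ->; rewrite ?orbT.
  rewrite scaler_sumr -big_split /=; apply: eq_bigr => t _.
  by rewrite mcoeffD mcoeffZ mpolyCD mpolyCM scalerDl scalerA.
exists (fun f => w0 (subst z' f)); split=> [c f g|mu].
  have -> : c%:MP *: (f : S^o) + g = c *: f + g :> S by rewrite -mul_mpolyC.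
  by rewrite subst_linear w0L.
by rewrite /zmon (substK zz'.2) /w0 msuppX big_seq1 mcoeffX eqxx scale1r.
Qed.

Lemma z_ext_Jlinear J N (w : S^o -> N) : klinear kappa w ->
  (forall mu j, j \in J -> w (zmon (mu + U_(j))%MM) = z j *: w (zmon mu)) ->
  Jlinear J w.
Proof.
move=> wL wJ; split=> // j x jJ; elim/z_ind: x => [c f g wf wg|mu].
  rewrite scalerDr; have -> : z j *: (c%:MP * f : S^o) = c%:MP *: (z j *: (f : S^o)).
    by rewrite -[_ * _]/(c%:MP *: (f : S^o)) !scalerA mulrC.
  rewrite wL wf wg -[c%:MP * f]/(c%:MP *: (f : S^o)) wL scalerDr !scalerA.
  by rewrite [z j * _]mulrC.
by rewrite -wJ // zmonD zmonU mulrC.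
Qed.

Lemma z_unique N (w w' : S^o -> N) : klinear kappa w -> klinear kappa w' ->
  (forall mu, w (zmon mu) = w' (zmon mu)) -> w =1 w'.
Proof.
move=> wL w'L ww'; elim/z_ind => [c f g fE gE|//].
by rewrite -[c%:MP * f]/(c%:MP *: (f : S^o)) wL w'L fE gE.
Qed.

(** The commutator of w with multiplication by [z j], which measures the failure of linearity in
    that coordinate. *)
Definition zdiff j M N (w : M -> N) (x : M) : N := w (z j *: x) - z j *: w x.

(** The equation prescribes w (z j * x) in terms of w x and chi x. Starting from 0 on the monomials
    without [z j], it is solved by recursion on the exponent of [z j]; [F mu a] is the value at the
    monomial mu with that exponent replaced by a. *)
Lemma ring_zdiff_surj j J N (chi : S^o -> N) : j \notin J -> Jlinear J chi ->
  exists2 w : S^o -> N, Jlinear J w & forall x, zdiff j w x = chi x.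
Proof.
move=> jJ [chiL chiJ].
pose update mu a := [multinom if i == j then a else mu i | i < n].
pose F mu := fix F a := if a is b.+1 then z j *: F b + chi (zmon (update mu b)) else 0.
have updU mu i a : i != j -> update (mu + U_(i))%MM a = (update mu a + U_(i))%MM.
  move=> ij; apply/mnmP => k; rewrite mnmDE !mnmE.
  by case: (eqVneq k j) => // ->; rewrite (negbTE ij) addn0.
have updUj mu a : update (mu + U_(j))%MM a = update mu a.
  apply/mnmP => k; rewrite !mnmE; case: (eqVneq k j) => // kj.
  by rewrite addn0.
have [w [wL wE]] := z_ext (fun mu => F mu (mu j)).
exists w.
  apply: z_ext_Jlinear => // mu i iJ; rewrite !wE.
  have ij : i != j by apply: contraNneq jJ => <-.
  rewrite mnmDE mnm1E (negbTE ij) addn0.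
  elim: (mu j) => [|a IHa] /=; first by rewrite scaler0.
  rewrite IHa updU // zmonD zmonU scalerDr !scalerA [z j * _]mulrC; congr (_ + _).
  by rewrite mulrC -[_ * _]/(z i *: (zmon (update mu a) : S^o)) chiJ.
have zjL : klinear kappa (zdiff j w).
  move=> c x y; rewrite /zdiff scalerDr scalerA [z j * _]mulrC -scalerA !wL.
  by rewrite scalerBr scalerDr !scalerA [z j * _]mulrC opprD addrACA.
apply: z_unique => // mu.
have -> : zdiff j w (zmon mu) = w (zmon (mu + U_(j))%MM) - z j *: w (zmon mu).
  by rewrite /zdiff zmonD zmonU mulrC.
rewrite !wE mnmDE mnm1E eqxx addn1.
have -> : F (mu + U_(j))%MM =1 F mu.
  by elim=> //= a ->; rewrite updUj.
rewrite /= addrC addKr; congr (chi (zmon _)).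
by apply/mnmP => k; rewrite mnmE; case: eqP => // ->.
Qed.

Lemma freeg_Jlinear J (T : choiceType) N (w : T -> S^o -> N) :
  (forall t, Jlinear J (w t)) ->
  exists2 v : {freeg T / S} -> N, Jlinear J v & forall t s, v << s *g t >> = w t s.
Proof.
move=> wJ; have w0 t : w t 0 = 0 by case: (wJ t) => /klinear0.
pose v (x : {freeg T / S}) := \sum_(t <- dom x) w t (coeff t x).
have vE r x : uniq r -> {subset dom x <= r} -> v x = \sum_(t <- r) w t (coeff t x).
  move=> ur xr; rewrite /v [RHS](bigID (fun t => t \in dom x)) /= addrC.
  rewrite [X in _ = X + _]big1 ?add0r => [|t tx]; last first.
    by rewrite coeff_outdom.
  rewrite -[RHS]big_filter; apply: perm_big; apply: uniq_perm.
  - exact: uniq_dom.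
  - exact: filter_uniq.
  - by move=> t; rewrite mem_filter; case: (boolP (t \in dom x)) => // /xr ->.
exists v => [|t s].
  split=> [c x y|j x jJ].
    pose r := undup (dom x ++ dom y ++ dom (c%:MP *: x + y)).
    have ur : uniq r by exact: undup_uniq.
    rewrite !(@vE r) //;
      try by move=> t; rewrite mem_undup !mem_cat => ->; rewrite ?orbT.
    rewrite scaler_sumr -big_split /=; apply: eq_bigr => t _.
    by rewrite coeffD coeffZ; case: (wJ t) => wL _; rewrite -wL.
  pose r := undup (dom x ++ dom (z j *: x)).
  have ur : uniq r by exact: undup_uniq.
  rewrite !(@vE r) //;
    try by move=> t; rewrite mem_undup !mem_cat => ->; rewrite ?orbT.
  rewrite scaler_sumr; apply: eq_bigr => t _.
  by rewrite coeffZ; case: (wJ t) => _ wt; rewrite -wt.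
rewrite (@vE [:: t]) ?big_seq1 ?coeffU ?eqxx ?mulr1 // => u.
rewrite mem_dom coeffU mem_seq1 (eq_sym t); apply: contraR => /negbTE ->.
by rewrite mulr0.
Qed.

Lemma freeg_unique (T : choiceType) N (v v' : {freeg T / S} -> N) :
  klinear kappa v -> klinear kappa v' ->
  (forall t s, v << s *g t >> = v' << s *g t >>) -> v =1 v'.
Proof.
move=> vL v'L vv' x.
have vD (u : {freeg T / S} -> N) : klinear kappa u -> forall x y, u (x + y) = u x + u y.
  by move=> uL x1 y; have := uL 1 x1 y; rewrite rmorph1 !scale1r.
rewrite -(freeg_sumE x); elim: (dom x) => [|t r IHr].
  by rewrite big_nil (klinear0 vL) (klinear0 v'L).
by rewrite big_cons !vD // IHr vv'.
Qed.

Lemma freeg_basis_Jlinear J (T : choiceType) N (f : {freeg T / S} -> N) t :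
  Jlinear J f -> Jlinear J (fun s : S^o => f << s *g t >>).
Proof.
move=> [fL fJ].
have fgZ (a s : S) : << (a * s) *g t >> = a *: << s *g t >> :> {freeg T / S}.
  by apply: freeg_ext => u; rewrite coeffZ !coeffU mulrA.
split=> [c x y|j x jJ]; last by rewrite fgZ fJ.
by rewrite -freegUD fgZ fL.
Qed.

Lemma projective_zdiff_surj j J P N (chi : P -> N) :
  projective P -> j \notin J -> Jlinear J chi ->
  exists2 w : P -> N, Jlinear J w & forall x, zdiff j w x = chi x.
Proof.
move=> /projective_summand[s [r rs]] jJ chiJ.
have chirJ : Jlinear J (chi \o r) by apply: Jlinear_comp => //; exact: Jlinear_linear.
have [w0 w0J] : exists2 w : {freeg P / S} -> N, Jlinear J w &
    forall x, zdiff j w x = chi (r x).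
  have /choice[w wE] : forall t, exists w : S^o -> N, Jlinear J w /\
      forall x, zdiff j w x = chi (r << x *g t >>).
    move=> t; have [w wJ wE] := ring_zdiff_surj jJ (freeg_basis_Jlinear t chirJ).
    by exists w.
  have [v vJ vE] := freeg_Jlinear (fun t => (wE t).1).
  exists v => //; apply: freeg_unique; last first.
  - move=> t x; rewrite -(wE t).2 /zdiff -!vE; congr (v _ - _).
    by apply: freeg_ext => u; rewrite coeffZ !coeffU mulrA.
  - by case: chirJ.
  - case: vJ => vL _ c x y; rewrite /zdiff scalerDr scalerA [z j * _]mulrC -scalerA !vL.
    by rewrite scalerBr scalerDr !scalerA [z j * _]mulrC opprD addrACA.
move=> w0E; exists (w0 \o s).
  by apply: Jlinear_comp => //; exact: Jlinear_linear.
move=> x; rewrite -[in RHS](rs x) -w0E /zdiff /=; congr (w0 _ - _).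
exact: linearZZ.
Qed.

(** Projectivity over the subring K[z_j : j in J], tested with J-linear maps between modules over
    S. *)
Definition Jprojective J M : Prop := forall E N (g : E -> N) (f : M -> N),
  Jlinear J g -> (forall y, exists x, g x = y) -> Jlinear J f ->
  exists2 h : M -> E, Jlinear J h & forall x, g (h x) = f x.

Lemma Jprojective_retract J M P (s : M -> P) (r : P -> M) : Jlinear J s -> Jlinear J r ->
  (forall x, r (s x) = x) -> Jprojective J P -> Jprojective J M.
Proof.
move=> sJ rJ rs Pp E N g f gJ gS fJ.
have [h hJ hE] := Pp E N g (f \o r) gJ gS (Jlinear_comp rJ fJ).
exists (h \o s); first exact: Jlinear_comp.
by move=> x /=; rewrite hE /= rs.
Qed.

Definition mnm_in J mu : 'X_{1..n} := [multinom if i \in J then mu i else 0%N | i < n].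
Definition mnm_out J mu : 'X_{1..n} := [multinom if i \in J then 0%N else mu i | i < n].

Lemma mnm_in_out J mu : (mnm_in J mu + mnm_out J mu)%MM = mu.
Proof.
by apply/mnmP => i; rewrite mnmDE !mnmE; case: ifP; rewrite ?addn0 ?add0n.
Qed.

(** S is free over K[z_j : j in J] on the monomials in the other coordinates; w is the map that
    agrees with h on this basis. *)
Lemma Jlinear_extension J N (h : S^o -> N) :
  exists2 w : S^o -> N, Jlinear J w
    & forall mu, w (zmon mu) = zmon (mnm_in J mu) *: h (zmon (mnm_out J mu)).
Proof.
have [w [wL wE]] := z_ext (fun mu => zmon (mnm_in J mu) *: h (zmon (mnm_out J mu))).
exists w => //; apply: z_ext_Jlinear => // mu j jJ; rewrite !wE.
have -> : mnm_in J (mu + U_(j))%MM = (mnm_in J mu + U_(j))%MM.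
  apply/mnmP => i; rewrite mnmDE !mnmE; case: ifP => // /negbT iJ.
  by rewrite (_ : j == i = false) //; apply: contraNF iJ => /eqP <-.
have -> : mnm_out J (mu + U_(j))%MM = mnm_out J mu.
  apply/mnmP => i; rewrite !mnmE; case: ifP => // /negbT iJ.
  by rewrite (_ : j == i = false) ?addn0 //; apply: contraNF iJ => /eqP <-.
by rewrite zmonD zmonU scalerA [z j * _]mulrC.
Qed.

(** A free S-module stays free over the subring, on the products of its basis with the monomials in
    the other coordinates; [sec] lifts the values of f on these. *)
Lemma projective_Jprojective J P : projective P -> Jprojective J P.
Proof.
move=> /projective_summand[s [r rs]].
apply: (Jprojective_retract (s := s) (r := r)); try exact: Jlinear_linear; first exact: rs.
move=> E N g f gJ gS fJ; have [gL gJ'] := gJ.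
have [sec [secL secE]] := klinear_section gL gS.
have /choice[h hE] : forall t, exists h : S^o -> E, Jlinear J h /\
    forall x, g (h x) = f << x *g t >>.
  move=> t; have ftJ := freeg_basis_Jlinear t fJ.
  have [w wJ wE] := Jlinear_extension J (fun x : S^o => sec (f << x *g t >>)).
  exists w; split=> //; apply: z_unique; [|by case: ftJ|].
    by case: (Jlinear_comp wJ gJ).
  move=> mu; rewrite wE (Jlinear_zmon _ gJ) ?secE; last first.
    by move=> i iJ; rewrite mnmE (negbTE iJ).
  rewrite -(Jlinear_zmon (f := fun x : S^o => f << x *g t >>) _ ftJ); last first.
    by move=> i iJ; rewrite mnmE (negbTE iJ).
  by rewrite -[_ *: _]/(zmon _ * zmon _) -zmonD mnm_in_out.
have [v vJ vE] := freeg_Jlinear (fun t => (hE t).1).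
exists v => //; apply: freeg_unique; [|by case: fJ|].
  by case: (Jlinear_comp vJ gJ).
by move=> t x; rewrite vE (hE t).2.
Qed.

(* For short exact 0 -> Z -> P -> M -> 0 with P projective and m > 0, this is the
   vanishing of Ext^m(Z, N) over S when J is everything; it holds as soon as i has
   a J-linear retraction. *)
Fixpoint ext_emb J N m (Z P : lmodType S) (i : {linear Z -> P}) : Prop :=
  if m is m'.+1 then
    forall (P' Z' : lmodType S) (i' : {linear Z' -> P'}) (e' : {linear P' -> Z}),
    projective P' -> short_exact i' e' -> ext_emb J N m' i'
  else forall f : Z -> N, Jlinear J f ->
    exists2 g : P -> N, Jlinear J g & forall x, g (i x) = f x.

(** The splitting passes to syzygies: Z being J-projective, e' has a J-linear section s, and x - s
    (e' x) yields a J-linear retraction of P' to Z'. *)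
Lemma ext_emb_split J N m (Z P : lmodType S) (i : {linear Z -> P}) (r : P -> Z) :
  Jlinear J r -> (forall x, r (i x) = x) -> Jprojective J Z -> ext_emb J N m i.
Proof.
elim: m Z P i r => [|m IHm] Z P i r rJ ri Zp /=.
  by move=> f fJ; exists (f \o r) => [|x /=]; [exact: Jlinear_comp | rewrite ri].
move=> P' Z' i' e' P'p [iI eK eS].
have [s sJ sE] := Zp _ _ e' idfun (Jlinear_linear J e') eS (Jlinear_linear J idfun).
have /choice[r' r'E] : forall x, exists y, i' y = x - s (e' x).
  by move=> x; apply/eK; rewrite linearB sE subrr.
have rJ' : Jlinear J (i' \o r').
  have [tL tJ] : Jlinear J (fun x => x - s (e' x)).
    apply: JlinearB; first exact: (Jlinear_linear J idfun).
    by apply: Jlinear_comp sJ; exact: Jlinear_linear.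
  by split=> [c x y|j x jJ] /=; rewrite !r'E ?tL ?tJ.
have r'J : Jlinear J r'.
  case: rJ' => tL tJ; split=> [c x y|j x jJ]; apply: iI.
    by rewrite linearP; exact: tL.
  by rewrite linearZ; exact: tJ.
have r'i x : r' (i' x) = x.
  apply: iI; rewrite r'E (_ : e' _ = 0); last by apply/eK; exists x.
  by case: sJ => /klinear0 ->; rewrite subr0.
apply: (IHm _ _ i' r') => //.
apply: (Jprojective_retract (s := i') (r := r')) => //; first exact: Jlinear_linear.
exact: projective_Jprojective.
Qed.

(* An extension psi given by J-linearity may fail to commute with z_j; the defect
   zdiff j psi factors through e' and is itself the defect of a map w o i o e', so
   psi can be corrected.  Each coordinate added to J costs one syzygy. *)
Lemma ext_emb_shift J j N m (Z P : lmodType S) (i : {linear Z -> P}) :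
  projective P -> j \notin J -> ext_emb J N m i -> ext_emb J N m.+1 i ->
  ext_emb (j |: J) N m.+1 i.
Proof.
move=> Pp jJ; elim: m Z P i Pp => [|m IHm] Z P i Pp ext0 ext1; last first.
  move=> P' Z' i' e' P'p ie; apply: IHm => //; first exact: ext0 ie.
  exact: ext1 ie.
move=> P' Z' i' e' P'p ie phi phiJ.
have [iI eK eS] := ie.
have [psi psiJ psiE] := ext1 P' Z' i' e' P'p ie phi (Jlinear_sub (subsetUr _ _) phiJ).
have dJ : Jlinear J (zdiff j psi).
  case: psiJ => pL pJ; split=> [c x y|k x kJ]; rewrite /zdiff.
    rewrite scalerDr scalerA [z j * _]mulrC -scalerA !pL.
    by rewrite scalerBr scalerDr !scalerA [z j * _]mulrC opprD addrACA.
  by rewrite scalerA [z j * _]mulrC -scalerA !(pJ k) // scalerBr !scalerA [z j * _]mulrC.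
have d0 x y : e' x = e' y -> zdiff j psi x = zdiff j psi y.
  move=> /eqP; rewrite -subr_eq0 -linearB => /eqP/eK[u uE].
  apply/eqP; rewrite -subr_eq0 -(klinearB dJ.1) -uE /zdiff -linearZ !psiE.
  by rewrite phiJ.2 ?subrr // setU11.
have [l lE] := choice eS.
have chiE x : zdiff j psi (l (e' x)) = zdiff j psi x by apply: d0.
have chiJ : Jlinear J (fun y => zdiff j psi (l y)).
  case: (dJ) => dL dJ'; split=> [c x y|k x kJ].
    by rewrite -dL; apply: d0; rewrite lE linearP !lE.
  by rewrite -dJ' //; apply: d0; rewrite lE linearZ /= lE.
have [chi chiJ' chi'E] := ext0 _ chiJ.
have [w wJ wE] := projective_zdiff_surj Pp jJ chiJ'.
have wieJ : Jlinear J (w \o (i \o e')).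
  by apply: Jlinear_comp wJ; exact: (Jlinear_linear J (i \o e')).
exists (fun x => psi x - w (i (e' x))) => [|x]; last first.
  rewrite psiE (_ : e' _ = 0); last by apply/eK; exists x.
  by rewrite linear0 (klinear0 wJ.1) subr0.
have [gL gJ] := JlinearB psiJ wieJ.
split=> // k x; rewrite inE => /orP[|kJ]; last exact: gJ.
rewrite inE => /eqP ->.
have : w (i (e' (z j *: x))) - z j *: w (i (e' x)) = psi (z j *: x) - z j *: psi x.
  rewrite -/(zdiff j psi x) -chiE -chi'E -wE /zdiff; congr (w _ - _).
  by rewrite (linearZZ e') (linearZZ i).
rewrite scalerBr; set a := psi _; set b := w _; set c := _ *: psi _.
set d := _ *: w _ => e.
by rewrite -[a](subrK c) -e addrAC [X in X + _]addrAC subrr sub0r addrC.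
Qed.

Lemma ext_emb_full J N a (Z P : lmodType S) (i : {linear Z -> P}) :
  projective P -> (forall m, (a <= m)%N -> ext_emb J N m i) ->
  forall m, (a + #|~: J| <= m)%N -> ext_emb setT N m i.
Proof.
move=> Pp; move: {2}#|~: J| (erefl #|~: J|) => k.
elim: k J a => [|k IHk] J a Jk extJ m.
  have -> : setT = J by rewrite -[J]setCK (cards0_eq Jk) setC0.
  by rewrite Jk addn0; exact: extJ.
have /card_gt0P[j] : (0 < #|~: J|)%N by rewrite Jk.
rewrite inE => jJ.
have J'k : #|~: (j |: J)| = k.
  have := cardsC J; rewrite Jk; have := cardsC (j |: J).
  by rewrite cardsU1 jJ add1n => <-; rewrite addSn addnS => -[] /addnI.
rewrite Jk addnS -addSn -J'k; apply: IHk => // -[//|m'] am.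
by apply: ext_emb_shift => //; apply: extJ => //; exact: leqW.
Qed.

End SyzygyTheorem.

Section FiniteFree.
Variables (R : nzRingType) (T : finType).

Definition fbasis (t : T) : {ffun T -> R^o} := [ffun u => (u == t)%:R].

Lemma fbasisE (e : {ffun T -> R^o}) : e = \sum_t e t *: fbasis t.
Proof.
apply/ffunP => u; rewrite sum_ffunE (bigD1 u) //= big1 ?addr0 => [|t tu].
  by rewrite !ffunE eqxx -[RHS]/(_ * _) mulr1.
by rewrite !ffunE eq_sym (negbTE tu) scaler0.
Qed.

Lemma ffun_projective : projective {ffun T -> R^o}.
Proof.
move=> M N g f gS; have [m mE] := choice (fun t => gS (f (fbasis t))).
have hL : linear (fun e : {ffun T -> R^o} => \sum_t e t *: m t).
  move=> a x y; rewrite scaler_sumr -big_split /=; apply: eq_bigr => t _.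
  by rewrite !ffunE scalerDl scalerA.
exists (pack_linear hL) => x /=; rewrite linear_sum [in RHS](fbasisE x) linear_sum.
by apply: eq_bigr => t _; rewrite !linearZ /= mE.
Qed.

End FiniteFree.

(** * Kernels of matrices that involve few coordinates *)

Section KernelOfMatrix.
Variables (K : fieldType) (n : nat) (z z' : 'I_n -> {mpoly K[n]}).
Hypothesis zz' : coordinates z z'.
Local Notation S := {mpoly K[n]}.
Local Notation kappa := (@mpolyC n K : {rmorphism K -> S}).
Variable J : {set 'I_n}.

(** The subring K[z_i : i not in J], as the K-span of its monomials. *)
Inductive free_of : S -> Prop :=
  | free_of_zmon (mu : 'X_{1..n}) : (forall j, j \in J -> mu j = 0%N) -> free_of (zmon z mu)
  | free_of_lin c f g : free_of f -> free_of g -> free_of (c%:MP * f + g).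

Lemma free_ofC c : free_of c%:MP.
Proof.
have z1 : free_of 1 by rewrite -(zmon0 z); apply: free_of_zmon => j _; rewrite mnm0E.
by have := free_of_lin (c - 1) z1 z1; rewrite mulr1 mpolyCB subrK.
Qed.

Lemma free_of_coord i : i \notin J -> free_of (z i).
Proof.
move=> iJ; rewrite -zmonU; apply: free_of_zmon => j jJ; rewrite mnm1E.
by case: eqP => // ij; rewrite -ij (negbTE iJ) in jJ.
Qed.

Lemma free_ofD f g : free_of f -> free_of g -> free_of (f + g).
Proof. by move=> ff fg; rewrite -[f]mul1r; exact: free_of_lin. Qed.

Lemma free_ofM f g : free_of f -> free_of g -> free_of (f * g).
Proof.
elim=> {f} [mu muJ|c f1 f2 _ IH1 _ IH2] fg; last first.
  by rewrite mulrDl -mulrA; apply: free_of_lin; [exact: IH1|exact: IH2].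
elim: fg => [nu nuJ|c g1 g2 _ IH1 _ IH2]; last first.
  by rewrite mulrDr mulrCA; exact: free_of_lin.
by rewrite -zmonD; apply: free_of_zmon => j jJ; rewrite mnmDE muJ ?nuJ.
Qed.

Lemma free_of_sum (I : Type) (r : seq I) (F : I -> S) :
  (forall i, free_of (F i)) -> free_of (\sum_(i <- r) F i).
Proof.
move=> fF; apply: (big_ind free_of) => [|f g|i _]; [|exact: free_ofD|exact: fF].
by rewrite -mpolyC0; exact: free_ofC.
Qed.

Variables (T0 T1 : finType) (A : T0 -> T1 -> S).
Hypothesis freeA : forall t s, free_of (A t s).
Local Notation E0 := {ffun T0 -> S^o}.
Local Notation E1 := {ffun T1 -> S^o}.

Definition mapA (e : E1) : E0 := [ffun t => \sum_s A t s * e s].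

Lemma mapA_linear : linear mapA.
Proof.
move=> a x y; apply/ffunP => t; rewrite !ffunE scaler_sumr -big_split /=.
by apply: eq_bigr => s _; rewrite !ffunE mulrDr mulrCA.
Qed.

Let Phi := pack_linear mapA_linear.
Let B := im_submodule Phi.

(** Over K[z_i : i not in J], where A has its entries, a K-linear projection p to the image of A
    exists. Its extension q by K[z_j : j in J]-linearity projects to the image over S, because A
    commutes with that extension. *)
Lemma image_retraction : exists2 r : E0 -> submod B,
  Jlinear z J r & forall b, r (incl B b) = b.
Proof.
pose I (y : E0) := exists2 e : E1, (forall s, free_of (e s)) & Phi e = y.
have [||p [pL pI pid]] := @klinear_projection K S kappa E0 I.
- exists 0; last by rewrite linear0.
  by move=> s; rewrite ffunE -mpolyC0; exact: free_ofC.
- move=> c _ _ [e fe <-] [e' fe' <-].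
  exists (c%:MP *: e + e'); last by rewrite linearP.
  by move=> s; rewrite !ffunE; exact: free_of_lin.
have pim x : exists e, Phi e = p x by have [e _ eE] := pI x; exists e.
have /choice[w wE] : forall t, exists w : S^o -> E0, Jlinear z J w /\
    forall mu, w (zmon z mu) =
      zmon z (mnm_in J mu) *: p (zmon z (mnm_out J mu) *: fbasis S t).
  by move=> t; have [w wJ wE] :=
    Jlinear_extension zz' J (fun s : S^o => p (s *: fbasis S t)); exists w.
pose q (e : E0) := \sum_t w t (e t).
have qJ : Jlinear z J q.
  split=> [c x y|j x jJ]; rewrite /q scaler_sumr -?big_split /=; apply: eq_bigr => t _;
    case: (wE t) => -[wL wJ] _; rewrite !ffunE; first exact: wL.
  exact: wJ.
have qim e : exists b, incl B b = q e.
  apply: incl_surj; apply: (submodule_sum _ B) => t; case: (wE t) => -[wL wJ] wz.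
  elim/(z_ind zz'): (e t) => [c f g|mu]; last first.
    by rewrite wz; apply: (submoduleZ B); exact: pim.
  move=> Bf Bg; rewrite -[c%:MP * f]/(c%:MP *: (f : S^o)) wL.
  by case: B => _; apply.
have pq (y : E0) : (forall t, free_of (y t)) -> q y = p y.
  move=> fy; rewrite [in RHS](fbasisE y).
  have -> : p (\sum_t y t *: fbasis S t) = \sum_t p (y t *: fbasis S t).
    apply: (big_morph p) => [u v|]; last exact: klinear0 pL.
    by have := pL 1 u v; rewrite rmorph1 !scale1r.
  apply: eq_bigr => t _; case: (wE t) => -[wL _] wz.
  elim: (fy t) => [mu muJ|c f g _ IHf _ IHg]; last first.
    rewrite -[c%:MP * f]/(c%:MP *: (f : S^o)) wL IHf IHg -pL scalerDl.
    by rewrite scalerA.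
  rewrite wz (_ : mnm_in J mu = 0%MM) ?zmon0 ?scale1r; last first.
    by apply/mnmP => i; rewrite !mnmE; case: ifP => // /muJ.
  rewrite (_ : mnm_out J mu = mu) //.
  by apply/mnmP => i; rewrite !mnmE; case: ifP => // /muJ.
have PhiJ : Jlinear z J Phi by exact: Jlinear_linear.
have qPhiJ := Jlinear_comp PhiJ qJ.
have qPhi e : q (Phi e) = Phi e.
  have kD (N : lmodType S) (u : E1 -> N) : klinear kappa u -> {morph u : x y / x + y}.
    by move=> uL x y; have := uL 1 x y; rewrite rmorph1 !scale1r.
  rewrite (fbasisE e) -[LHS]/((q \o Phi) _).
  rewrite (big_morph _ (kD _ _ qPhiJ.1) (klinear0 qPhiJ.1)) linear_sum.
  apply: eq_bigr => s _; move: (e s) => f; set b := fbasis S s.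
  elim/(z_ind zz'): f => [c f g IHf IHg|mu].
    have -> : (c%:MP * f + g) *: b = c%:MP *: (f *: b) + g *: b.
      by rewrite scalerA -scalerDl.
    by rewrite (qPhiJ.1 c (f *: b) (g *: b)) IHf IHg (PhiJ.1 c (f *: b) (g *: b)).
  have -> : zmon z mu *: b = zmon z (mnm_in J mu) *: (zmon z (mnm_out J mu) *: b).
    by rewrite scalerA -zmonD mnm_in_out.
  have muJ i : i \notin J -> mnm_in J mu i = 0%N by move=> iJ; rewrite mnmE (negbTE iJ).
  rewrite (Jlinear_zmon _ qPhiJ) // (Jlinear_zmon _ PhiJ) //; congr (_ *: _).
  set u := _ *: b.
  have fu s' : free_of (u s').
    rewrite !ffunE; apply: free_ofM; last first.
      by case: eqP => _; [exact: (free_ofC 1) | rewrite mulr0n -mpolyC0; exact: free_ofC].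
    by apply: free_of_zmon => j jJ; rewrite mnmE jJ.
  have fPu t : free_of (Phi u t).
    by rewrite /= ffunE; apply: free_of_sum => s'; apply: free_ofM.
  by rewrite [LHS]/= pq // pid //; exists u.
have [r rE] := choice qim.
exists r => [|b].
  split=> [c x y|j x jJ]; apply: (@incl_inj _ _ _ B); rewrite ?linearP ?linearZ !rE.
    exact: qJ.1.
  exact: qJ.2.
apply: (@incl_inj _ _ _ B); rewrite rE.
by have [e <-] := inclP b; rewrite qPhi.
Qed.

(** D is the first syzygy of the image B of A, so Ext^(m+1)(D, N) is Ext^(m+2)(B, N). B is
    J-linearly a summand of [E0], and restoring the at most m + 2 coordinates outside J leaves
    Ext^(m+2)(B, N) = 0. *)
Lemma pd_kernel (D : lmodType S) (i : {linear D -> E1}) m :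
  injective i -> (forall x, mapA x = 0 <-> exists y, i y = x) ->
  (#|~: J| <= m.+2)%N -> pd_le D m.+1 -> pd_le D m.
Proof.
move=> iI iK Jm; apply: pd_le_pred => N.
have E0p : projective E0 by exact: ffun_projective.
have [e eE] := corestrict B (fun x => ex_intro (fun y => Phi y = Phi x) x erefl).
have eK x : e x = 0 <-> exists y, i y = x.
  rewrite -iK -[mapA x]/(Phi x) -eE; split=> [->|h]; first by rewrite linear0.
  by apply: (@incl_inj _ _ _ B); rewrite h linear0.
have eS y : exists x, e x = y.
  have [x xE] := inclP y; exists x.
  by apply: (@incl_inj _ _ _ B); rewrite eE.
have ext : ext_emb z setT N m.+2 (incl B).
  apply: (ext_emb_full zz' (J := J) (a := 0)) => // k _.
  have [r rJ rB] := image_retraction.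
  apply: (ext_emb_split zz' _ _ rJ) => //.
  apply: (Jprojective_retract (Jlinear_linear z J (incl B)) rJ rB).
  exact: (projective_Jprojective zz' (J := J) E0p).
have ie : short_exact i e by split.
have {}ext := ext E1 D i e (@ffun_projective _ _) ie.
(* [ext_vanish] counts from Ext^1 at index 0, hence the shift by one. *)
suff H k (F G : lmodType S) (j : {linear F -> G}) :
    ext_emb z setT N k.+1 j -> ext_vanish N k F by exact: (H m D E1 i ext).
elim: k F G j => [|k IHk] F G j extj P Z i' e' Pp ie'; last first.
  by apply: (IHk Z P i'); exact: (extj P Z i' e' Pp ie').
move=> f; have [g gJ gE] := extj P Z i' e' Pp ie' f (Jlinear_linear z setT f).
by exists (pack_linear (Jlinear_linear_all zz' gJ)).
Qed.

End KernelOfMatrix.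

(** * Multiderivations *)

Section Multiderivations.
Variables (K : fieldType) (n p : nat).
Local Notation S := {mpoly K[n]}.
Implicit Types (D : ('I_p -> S) -> S) (f : 'I_p -> S) (g h : S) (i j : 'I_p).

Definition update f i g : 'I_p -> S := fun j => if j == i then g else f j.

Lemma update_id f i : update f i (f i) = f.
Proof. by apply: funext => j; rewrite /update; case: eqP => [->|]. Qed.

Lemma updateE f i g : update f i g i = g.
Proof. by rewrite /update eqxx. Qed.

Lemma updateNE f i j g : j != i -> update f i g j = f j.
Proof. by rewrite /update => /negbTE ->. Qed.

Definition multider D : Prop :=
  [/\ forall f i g h, D (update f i (g * h)) = g * D (update f i h) + h * D (update f i g),
      forall f i c g h, D (update f i (c *: g + h)) = c *: D (update f i g) + D (update f i h)
    & forall f i j, i != j -> f i = f j -> D f = 0].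

Lemma pdapply_multider (theta : polyder K n p) : multider (pdapply theta).
Proof.
split=> [f i g h|f i c g h|f i j].
- have := @pdapplyM K n p theta (update f i (g * h)) (update f i g) (update f i h) i.
  by rewrite !updateE; apply=> // j ji; rewrite !updateNE.
- apply: (@pdapply_linear K n p theta _ _ _ i c) => [j ji|j ji|].
  + by rewrite !updateNE.
  + by rewrite !updateNE.
  + by rewrite !updateE.
- exact: pdapply_alternate.
Qed.

Section Theory.
Variable D : ('I_p -> S) -> S.
Hypothesis DD : multider D.

Lemma multiderD f i g h : D (update f i (g + h)) = D (update f i g) + D (update f i h).
Proof. by case: DD => _ DL _; have := DL f i 1 g h; rewrite !scale1r. Qed.

Lemma multider0 f i : D (update f i 0) = 0.
Proof.
have := multiderD f i 0 0; rewrite addr0 => /eqP.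
by rewrite -subr_eq0 opprD addrA subrr sub0r oppr_eq0 => /eqP.
Qed.

Lemma multiderZ f i c g : D (update f i (c *: g)) = c *: D (update f i g).
Proof.
case: DD => _ DL _; have := DL f i c g 0.
by rewrite addr0 multider0 addr0.
Qed.

Lemma multider1 f i : D (update f i 1) = 0.
Proof.
case: DD => DM _ _; have := DM f i 1 1; rewrite mulr1 mul1r => /eqP.
by rewrite -subr_eq0 opprD addrA subrr sub0r oppr_eq0 => /eqP.
Qed.

Lemma multider_tperm f i j : i != j -> D (fun k => f (tperm i j k)) = - D f.
Proof.
move=> ij; have [_ _ DA] := DD; have ji : j != i by rewrite eq_sym.
pose F a b := update (update f i a) j b.
have FD a b c : D (F a (b + c)) = D (F a b) + D (F a c) by exact: multiderD.
have FC a b : F a b = update (update f j b) i a.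
  apply: funext => k; rewrite /F /update; case: (eqVneq k j) => // ->.
  by rewrite (negbTE ji).
have FDl a b c : D (F (a + b) c) = D (F a c) + D (F b c).
  by rewrite !FC; exact: multiderD.
have FA a : D (F a a) = 0.
  by apply: (DA _ i j ij); rewrite /F updateE updateNE // updateE.
have := FA (f i + f j); rewrite FD !FDl !FA add0r addr0.
rewrite (_ : F (f i) (f j) = f); last first.
  by rewrite /F update_id -[f j](updateNE f (f i) ji) !update_id.
rewrite (_ : F (f j) (f i) = fun k => f (tperm i j k)) => [/eqP|].
  by rewrite addrC addr_eq0 => /eqP ->; rewrite ?opprK.
apply: funext => k; rewrite /F /update; case: tpermP => [->|->|/eqP/negbTE-> /eqP/negbTE->//].
  by rewrite (negbTE ij) eqxx.
by rewrite eqxx.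
Qed.

Lemma multider_perm f (s : 'S_p) : D f = 0 -> D (fun k => f (s k)) = 0.
Proof.
case: (prod_tpermP s) => ts -> ts2 {s}.
elim: ts ts2 f => [|[i j] ts IH] /= ts2 f f0.
  by rewrite big_nil -[RHS]f0; congr D; apply: funext => k; rewrite perm1.
case/andP: ts2 => ij ts2; rewrite big_cons.
pose g k := f ((\prod_(t <- ts) tperm t.1 t.2)%g k).
rewrite (_ : (fun k => _) = fun k => g (tperm i j k)); last first.
  by apply: funext => k; rewrite permM.
by rewrite (@multider_tperm g i j ij) IH // oppr0.
Qed.

(** By the Leibniz rule, the values of D lie in the ideal generated by its values at coordinate
    functions. Some arguments may be kept fixed, as is needed for the one that holds alpha_L. *)
Lemma multider_ideal (G : S -> Prop) (fixed : pred 'I_p) (f0 : 'I_p -> S) :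
  G 0 -> (forall a x y, G x -> G y -> G (a * x + y)) ->
  (forall f, (forall i, fixed i -> f i = f0 i) ->
     (forall i, ~~ fixed i -> exists k, f i = 'X_k) -> G (D f)) ->
  forall f, (forall i, fixed i -> f i = f0 i) -> G (D f).
Proof.
move=> G0 GL GX f ff0; have [DM DL _] := DD.
have GZ (c : K) x y : G x -> G y -> G (c *: x + y).
  by rewrite -mul_mpolyC; exact: GL.
have GM a x : G x -> G (a * x) by move=> Gx; rewrite -[_ * _]addr0; exact: GL.
have GD x y : G x -> G y -> G (x + y) by rewrite -[x in G (x + y)]mul1r; exact: GL.
suff H (s : seq 'I_p) : forall f, (forall i, fixed i -> f i = f0 i) ->
    (forall i, ~~ fixed i -> i \notin s -> exists k, f i = 'X_k) -> G (D f).
  by apply: (H (ord_enum p)) => // i _; rewrite mem_ord_enum.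
elim: s {f ff0} => [|i s IHs] f ff0 fX.
  by apply: GX => // i iF; exact: fX.
have [iF|iF] := boolP (fixed i).
  apply: IHs => // j jF js; apply: fX; rewrite ?inE ?negb_or ?js ?andbT //.
  by apply: contraNneq jF => ->.
have IH k : G (D (update f i 'X_k)).
  apply: IHs => [j jF|j jF js].
    by rewrite updateNE ?ff0 //; apply: contraTneq jF => ->.
  have [->|ji] := eqVneq j i; first by exists k; rewrite updateE.
  by rewrite updateNE //; apply: fX; rewrite // inE negb_or ji.
rewrite -(update_id f i); elim/mpoly_lin_ind: (f i) => [c g h Gg Gh|mu].
  by rewrite DL; exact: GZ.
elim/mnm_ind: mu => [|mu k Gmu]; first by rewrite mpolyX0 multider1.
by rewrite mpolyXD DM; apply: GD; exact: GM.
Qed.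

Lemma sorted_multiindex (t : p.-tuple 'I_n) : uniq t ->
  exists (I : multiindex n p) (s : 'S_p), forall i, tnth t i = tnth (val I) (s i).
Proof.
move=> ut; pose le := fun a b : 'I_n => (a <= b)%N.
have sz : size (sort le t) == p by rewrite size_sort size_tuple.
have srt : sorted ltn (map val (Tuple sz)).
  rewrite /= ltn_sorted_uniq_leq map_inj_uniq ?sort_uniq ?ut; last exact: val_inj.
  by rewrite sorted_map; apply: sort_sorted => a b; exact: leq_total.
have /tuple_permP[s sE] : perm_eq t (Tuple sz) by rewrite perm_sym perm_sort.
exists (exist _ (Tuple sz) srt), s => i.
have := congr1 (fun u => nth (tnth t i) u i) sE; rewrite -tnth_nth => ->.
by rewrite -tnth_nth tnth_mktuple.
Qed.

Lemma multider_eq0 : (forall I : multiindex n p, D (fun i => 'X_(tnth (val I) i)) = 0) ->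
  forall f, D f = 0.
Proof.
move=> DI f; have [_ _ DA] := DD.
apply: (@multider_ideal (fun g => g = 0) pred0 f) => //.
  by move=> a x y -> ->; rewrite mulr0 addr0.
move=> {}f _ fX.
have /choice[sg sgE] : forall i, exists k, f i = 'X_k by move=> i; exact: fX.
have -> : f = fun i => 'X_(tnth [tuple sg i | i < p] i).
  by apply: funext => i; rewrite tnth_mktuple.
set t := mktuple _; have [ut|] := boolP (uniq t).
  have [I [s sE]] := sorted_multiindex ut.
  rewrite (_ : (fun i => _) = fun i => 'X_(tnth (val I) (s i))); last first.
    by apply: funext => i; rewrite sE.
  exact: (@multider_perm (fun i => 'X_(tnth (val I) i)) s (DI I)).
move=> nu; have [i [j [ij tij]]] : exists i j : 'I_p, i != j /\ tnth t i = tnth t j.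
  apply: contrapT => ninj; case/tuple_uniqP: nu => i j tij.
  by apply/eqP; apply: contraT => ij; case: ninj; exists i, j.
by apply: (DA _ i j ij); rewrite tij.
Qed.

End Theory.

Lemma multiderB D1 D2 : multider D1 -> multider D2 -> multider (fun f => D1 f - D2 f).
Proof.
move=> [M1 L1 A1] [M2 L2 A2]; split=> [f i g h|f i c g h|f i j ij fij].
- by rewrite M1 M2 !mulrBr opprD addrACA.
- by rewrite L1 L2 scalerBr opprD addrACA.
- by rewrite (A1 f i j) // (A2 f i j) // subrr.
Qed.

Lemma multiindex_sub (I J : multiindex n p) : {subset val J <= val I} -> J = I.
Proof.
move=> JI; apply/val_inj/val_inj/(inj_map val_inj).
have uI (I' : multiindex n p) : uniq (map val (val I')).
  by apply: (sorted_uniq ltn_trans ltnn); exact: (valP I').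
apply: (irr_sorted_eq ltn_trans ltnn); [exact: (valP J)|exact: (valP I)|].
apply: (uniq_min_size (uI J) _ _).2; last by rewrite !size_map !size_tuple.
by move=> x /mapP[y /JI yI ->]; apply: map_f.
Qed.

Lemma pdapply_X (theta : polyder K n p) (I : multiindex n p) :
  pdapply theta (fun i => 'X_(tnth (val I) i)) = theta I.
Proof.
rewrite /pdapply (bigD1 I) //= big1 ?addr0 => [|J JI].
  rewrite (_ : \matrix_(_, _) _ = 1%:M) ?det1 ?mulr1 //.
  apply/matrixP => a b; rewrite !mxE mderivX mnm1E.
  have uI : uniq (val I).
    by apply: (@map_uniq _ _ val); apply: (sorted_uniq ltn_trans ltnn); exact: (valP I).
  rewrite (inj_eq (tuple_uniqP _ uI)) eq_sym; case: eqP => [->|_].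
    rewrite scale1r (_ : (U_(_) - U_(_))%MM = 0%MM) ?mpolyX0 //.
    by apply/mnmP => k; rewrite mnmBE subnn mnm0E.
  by rewrite mulr0n scale0r.
(* An index of J missing from I gives a zero row. *)
have [a aI] : exists a, tnth (val J) a \notin val I.
  apply: contrapT => h; case/eqP: JI; apply: multiindex_sub => x /tnthP[a ->].
  by apply: contraT => ha; case: h; exists a.
rewrite (expand_det_row _ a) big1 ?mulr0 // => b _.
rewrite !mxE mderivX mnm1E (_ : (_ == _) = false) ?mulr0n ?scale0r ?mul0r //.
by apply: contraNF aI => /eqP <-; exact: mem_tnth.
Qed.

(** Hence elements of Der^p S can be given by formulas for their values, as in [rho_exists] and
    [in_image_single]. *)
Lemma multider_pdapply D : multider D ->
  exists theta : polyder K n p, forall f, pdapply theta f = D f.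
Proof.
move=> DD; exists [ffun I : multiindex n p => D (fun i => 'X_(tnth (val I) i))] => f.
apply/eqP; rewrite -subr_eq0; apply/eqP.
apply: (multider_eq0 (multiderB (pdapply_multider _) DD)) => I.
by rewrite pdapply_X ffunE subrr.
Qed.

Lemma pdapplyZ (a : S) (theta : polyder K n p) f :
  pdapply (a *: theta) f = a * pdapply theta f.
Proof.
by rewrite /pdapply mulr_sumr; apply: eq_bigr => I _; rewrite ffunE mulrA.
Qed.

Lemma pdapplyD (theta eta : polyder K n p) f :
  pdapply (theta + eta) f = pdapply theta f + pdapply eta f.
Proof.
by rewrite /pdapply -big_split; apply: eq_bigr => I _; rewrite ffunE mulrDl.
Qed.

Lemma pdapply0 f : pdapply (0 : polyder K n p) f = 0.
Proof. by rewrite /pdapply big1 // => I _; rewrite ffunE mul0r. Qed.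

End Multiderivations.

(** * Linear forms, hyperplanes and adapted bases *)

Section LinearForms.
Variables (K : fieldType) (V : vectType K).
Implicit Types (phi beta : {linear V -> K^o}) (W X Y L H : {vspace V}).
Local Notation W0 := (fullv : {vspace V}).
Local Notation S := {mpoly K[\dim W0]}.

Lemma linform_eq W (f g : V -> K) : (forall v, v \in W -> f v = g v) ->
  linform W f = linform W g.
Proof.
move=> fg; apply: eq_bigr => m _; rewrite fg //.
by rewrite vbasis_mem // mem_tnth.
Qed.

Lemma linformZ W c (f : V -> K) : linform W (fun v => c * f v) = c *: linform W f.
Proof.
by rewrite /linform scaler_sumr; apply: eq_bigr => m _; rewrite scalerA.
Qed.

Lemma linform_sum W (I : Type) (r : seq I) (c : I -> K) (f : I -> V -> K) :
  linform W (fun v => \sum_(i <- r) c i * f i v) = \sum_(i <- r) c i *: linform W (f i).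
Proof.
rewrite /linform; under [RHS]eq_bigr do rewrite scaler_sumr.
rewrite exchange_big; apply: eq_bigr => m _; rewrite scaler_suml.
by apply: eq_bigr => i _; rewrite scalerA.
Qed.

Lemma linform_homog W (f : V -> K) : linform W f \is 1.-homog.
Proof.
apply: rpred_sum => m _; apply: rpredZ.
by rewrite dhomogX; apply/eqP; exact: mdeg1.
Qed.

Lemma linear_form_ratio X phi beta :
  (forall v, v \in X -> phi v = 0 -> beta v = 0) ->
  exists c : K, forall v, v \in X -> beta v = c * phi v.
Proof.
move=> pb; have [[v0 v0X p0]|nX] := pselect (exists2 v, v \in X & phi v != 0).
  exists (beta v0 / phi v0) => v vX.
  have : beta (v - (phi v / phi v0) *: v0) = 0.
    apply: pb; first by rewrite rpredB ?rpredZ.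
    by rewrite linearB linearZ /= -[_ *: _]/(_ * _) divfK ?subrr.
  rewrite linearB linearZ /= -[_ *: _]/(_ * _) => /eqP; rewrite subr_eq0 => /eqP ->.
  by rewrite mulrC mulrA mulrAC.
exists 0 => v vX; rewrite mul0r; apply: pb => //; apply/eqP.
by apply: contraT => pv; case: nX; exists v.
Qed.

Lemma hyperplane_form L : hyperplane_of W0 L ->
  exists phi, forall v, (v \in L) = (phi v == 0).
Proof.
move=> [_ dL]; have [v0 v0L] : exists v0, v0 \notin L.
  apply: contrapT => nv; have : (W0 <= L)%VS.
    apply/subvP => v _; apply: contraT => vL; case: nv; by exists v.
  by move/dimvS; rewrite -dL ltnn.
have full : (L + <[v0]>)%VS = W0.
  apply/eqP; rewrite eqEdim subvf /= -dL.
  have := ltn_neqAle (\dim L) (\dim (L + <[v0]>)).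
  rewrite dimvS ?addvSl // andbT => ->; apply: contra v0L => /eqP dE.
  have /eqP -> : L == (L + <[v0]>)%VS by rewrite eqEdim addvSl -dE leqnn.
  by apply: (subvP (addvSr L <[v0]>)); exact: memv_line.
have /choice[f fE] : forall v, exists c : K, v - c *: v0 \in L.
  move=> v; have : v \in (L + <[v0]>)%VS by rewrite full; exact: memvf.
  by case/memv_addP=> u uL [_ /vlineP[c ->] ->]; exists c; rewrite addrK.
have f_uniq v (c : K) : v - c *: v0 \in L -> f v = c.
  move=> vc; apply/eqP; apply: contraNT v0L => fc.
  have : (f v - c) *: v0 \in L.
    have -> : (f v - c) *: v0 = (v - c *: v0) - (v - f v *: v0).
      by rewrite scalerBl opprB [RHS]addrC addrA subrK.
    exact: rpredB.
  move=> h; have : (f v - c)^-1 *: ((f v - c) *: v0) \in L by rewrite rpredZ.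
  by rewrite scalerA mulVf ?scale1r // subr_eq0.
have fL : linear (f : V -> K^o).
  move=> a u v; apply: f_uniq.
  have -> : a *: u + v - (a * f u + f v) *: v0 =
      a *: (u - f u *: v0) + (v - f v *: v0).
    by rewrite scalerDl scalerBr opprD addrACA scalerA.
  by rewrite rpredD ?rpredZ.
pose fB := GRing.isLinear.Build K V K^o _ f fL.
exists (HB.pack (f : V -> K^o) fB : {linear V -> K^o}) => v /=; apply/idP/eqP => [vL|fv].
  by apply: f_uniq; rewrite scale0r subr0.
by have := fE v; rewrite fv scale0r subr0.
Qed.

Lemma basis_coordinates (b : (\dim W0).-tuple V) : basis_of W0 b ->
  exists z', coordinates (fun i => linform W0 (coord b i)) z'.
Proof.
move=> bB; have bv v : v = \sum_i coord b i v *: b`_i by exact: (coord_basis bB (memvf v)).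
have vv (v : V) : v = \sum_i coord (vbasis W0) i v *: (vbasis W0)`_i.
  by exact: (coord_vbasis (memvf v)).
exists (fun j => \sum_(i < \dim W0) coord (vbasis W0) j b`_i *: 'X_i); split=> i.
  rewrite /subst raddf_sum /=.
  under eq_bigr => k _ do rewrite comp_mpolyZ -[X in _ *: X]/(subst _ 'X_k) substX.
  rewrite -linform_sum -[RHS]linform_coord; apply: linform_eq => v _.
  rewrite [in RHS](bv v) linear_sum; apply: eq_bigr => k _.
  by rewrite linearZ /= mulrC.
rewrite /subst /linform raddf_sum /=.
under eq_bigr => m _ do rewrite comp_mpolyZ -[X in _ *: X]/(subst _ 'X_m) substX scaler_sumr.
rewrite exchange_big (bigD1 i) //= [X in _ + X]big1 ?addr0 => [|k ki].
  under eq_bigr => m _ do rewrite scalerA.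
  rewrite -scaler_suml (_ : \sum_m _ = 1) ?scale1r //.
  have := coord_free i i (basis_free bB); rewrite eqxx mulr1n => bii; rewrite -[RHS]bii.
  rewrite [in RHS](vv b`_i) linear_sum; apply: eq_bigr => m _.
  by rewrite linearZ /= mulrC (tnth_nth 0).
under eq_bigr => m _ do rewrite scalerA.
rewrite -scaler_suml (_ : \sum_m _ = 0) ?scale0r //.
have bki := coord_free k i (basis_free bB); rewrite (negbTE ki) mulr0n in bki.
rewrite -[RHS]bki.
rewrite [in RHS](vv b`_k) linear_sum; apply: eq_bigr => m _.
by rewrite linearZ /= mulrC (tnth_nth 0).
Qed.

(** The coordinates of index at least [\dim Y] vanish on Y. They supply the regular sequence of
    [kills_step]; when Y is the centre of A, they are the only ones that occur in the forms of A. *)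
Lemma adapted_basis Y : exists b : (\dim W0).-tuple V,
  [/\ basis_of W0 b, forall i : 'I_(\dim W0), (i < \dim Y)%N -> b`_i \in Y
    & forall (i : 'I_(\dim W0)) v, (\dim Y <= i)%N -> v \in Y -> coord b i v = 0].
Proof.
have bB : basis_of W0 (vbasis Y ++ vbasis (Y^C)%VS).
  rewrite -(addv_complf Y); apply: cat_basis; try exact: vbasisP.
  by apply/directv_addP; exact: capv_compl.
have sb : size (vbasis Y ++ vbasis (Y^C)%VS) == \dim W0.
  by rewrite size_cat !size_tuple dimv_compl subnKC // dimvS ?subvf.
exists (Tuple sb); split=> // [i iY|i v iY /coord_vbasis ->].
  by rewrite /= nth_cat size_tuple iY vbasis_mem // mem_nth // size_tuple.
rewrite linear_sum big1 // => j _; rewrite linearZ /=.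
have jW : (j < \dim W0)%N by apply: leq_trans (ltn_ord j) _; rewrite dimvS ?subvf.
have -> : (vbasis Y)`_j = (Tuple sb)`_(Ordinal jW).
  by rewrite /= nth_cat size_tuple ltn_ord.
rewrite coord_free ?(basis_free bB) // (_ : (_ == _) = false) ?mulr0n ?mulr0 //.
by apply/negbTE; apply: contraTneq iY => <-; rewrite -ltnNge /=.
Qed.

Lemma linform_basis (b : (\dim W0).-tuple V) phi : basis_of W0 b ->
  linform W0 phi = \sum_(i < \dim W0) phi b`_i *: linform W0 (coord b i).
Proof.
move=> bB; rewrite -linform_sum; apply: linform_eq => v _.
rewrite [in LHS](coord_basis bB (memvf v)) linear_sum; apply: eq_bigr => i _.
by rewrite linearZ /= mulrC.
Qed.

End LinearForms.

(** * Logarithmic derivations and their restriction *)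

Section LogarithmicDerivations.
Variables (K : fieldType) (V : vectType K).
Local Notation W0 := (fullv : {vspace V}).
Local Notation S := {mpoly K[\dim W0]}.
Variable phi : {vspace V} -> {linear V -> K^o}.
Hypothesis phiP : forall L, hyperplane_of W0 L -> forall v, (v \in L) = (phi L v == 0).
Implicit Types (L H X Y : {vspace V}) (A : {fset {vspace V}}) (f g h : S) (p : nat).

Definition form L : S := linform W0 (phi L).

Definition dvd f g : Prop := exists h, g = f * h.

Lemma dvd0 f : dvd f 0.
Proof. by exists 0; rewrite mulr0. Qed.

Lemma dvd_lin f a g h : dvd f g -> dvd f h -> dvd f (a * g + h).
Proof. by move=> [u ->] [v ->]; exists (a * u + v); rewrite mulrDr mulrCA. Qed.

Lemma dvdM f g h : dvd f g -> dvd f (h * g).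
Proof. by move=> [u ->]; exists (h * u); rewrite mulrCA. Qed.

Lemma form_defining L : hyperplane_of W0 L -> defining_form L (form L).
Proof.
move=> hL; split=> [|v _]; first exact: linform_homog.
by rewrite fun_at_linform ?memvf // phiP //; split=> /eqP.
Qed.

Lemma defining_form_scalar L f : hyperplane_of W0 L -> defining_form L f ->
  exists c, f = c *: form L.
Proof.
move=> hL [/homog1_linform[beta ->] fL].
have [|c cE] := @linear_form_ratio K V W0 (phi L) beta.
  move=> v vW /eqP; rewrite -phiP // => /(fL v vW).
  by rewrite fun_at_linform.
by exists c; rewrite -linformZ; apply: linform_eq.
Qed.

Lemma restrict_form L f : hyperplane_of W0 L -> restrict_fun L f = 0 <-> dvd (form L) f.
Proof. by move=> hL; apply: restrict_fun_eq0 => //; exact: form_defining. Qed.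

Lemma restrictM H f g : restrict_fun H (f * g) = restrict_fun H f * restrict_fun H g.
Proof. by rewrite /restrict_fun rmorphM. Qed.

Lemma restrictD H f g : restrict_fun H (f + g) = restrict_fun H f + restrict_fun H g.
Proof. by rewrite /restrict_fun rmorphD. Qed.

Lemma restrictB H f g : restrict_fun H (f - g) = restrict_fun H f - restrict_fun H g.
Proof. by rewrite /restrict_fun rmorphB. Qed.

Lemma restrictZ H c f : restrict_fun H (c *: f) = c *: restrict_fun H f.
Proof. by rewrite /restrict_fun comp_mpolyZ. Qed.

Lemma restrict0 H : restrict_fun H (0 : S) = 0.
Proof. by rewrite /restrict_fun rmorph0. Qed.

Lemma restrict1 H : restrict_fun H (1 : S) = 1.
Proof. by rewrite /restrict_fun rmorph1. Qed.

Lemma form_prime L f g : hyperplane_of W0 L -> dvd (form L) (f * g) ->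
  dvd (form L) f \/ dvd (form L) g.
Proof.
move=> hL; rewrite -!restrict_form // restrictM => /eqP.
by rewrite mulf_eq0 => /orP[] /eqP; [left|right].
Qed.

Lemma dvd_linform L (beta : {linear V -> K^o}) : hyperplane_of W0 L ->
  dvd (form L) (linform W0 beta) <-> forall v, v \in L -> beta v = 0.
Proof.
move=> hL; rewrite -restrict_form // restrict_linform ?subvf //.
split=> [e v vL|b0].
  by rewrite -(fun_at_linform beta vL) e /fun_at meval0.
by rewrite /linform big1 // => m _; rewrite b0 ?scale0r // vbasis_mem // mem_tnth.
Qed.

Lemma dvd_form L L' : hyperplane_of W0 L -> hyperplane_of W0 L' ->
  dvd (form L) (form L') -> L = L'.
Proof.
move=> hL hL' /(dvd_linform _ hL) LL'; apply/eqP; rewrite eqEdim.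
have -> : (L <= L')%VS by apply/subvP => v /LL' v0; rewrite phiP // v0.
by move: hL.2; rewrite -hL'.2 => -[->]; exact: leqnn.
Qed.

Lemma form_neq0 L : hyperplane_of W0 L -> form L != 0.
Proof.
move=> hL; apply/eqP => a0; have : (W0 <= L)%VS.
  apply/subvP => v vW; rewrite phiP // -(fun_at_linform (phi L) vW) -/(form L).
  by rewrite a0 /fun_at meval0.
by move/dimvS; rewrite -hL.2 ltnn.
Qed.

(** Antisymmetry moves the form from position 0 to any other, and all defining forms of L are
    multiples of the chosen one. *)
Lemma logderP A p (theta : polyder K (\dim W0) p) : is_arrangement W0 A ->
  (theta \in @logder K V W0 A p) <->
  (forall L (i : 'I_p) (f : 'I_p -> S), L \in A ->
     dvd (form L) (pdapply theta (update f i (form L)))).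
Proof.
move=> arrA; have mt := pdapply_multider theta; split.
  move=> /asboolP td L i f LA.
  have p0 : (0 < p)%N by apply: leq_ltn_trans (ltn_ord i).
  pose i0 := Ordinal p0.
  have d0 (f' : 'I_p -> S) : f' i0 = form L -> dvd (form L) (pdapply theta f').
    by move=> f'E; apply: (td L (form L) LA _ f' i0) => //; exact: form_defining (arrA _ LA).
  have [->|ii0] := eqVneq i i0; first by apply: d0; rewrite updateE.
  have := @multider_tperm _ _ _ _ mt (update f i (form L)) i i0 ii0.
  move=> /(congr1 -%R); rewrite opprK => <-; rewrite -mulN1r; apply: dvdM.
  by apply: d0; rewrite tpermR updateE.
move=> td; apply/asboolP => L alpha LA dL f i _ fi.
have [c aE] := defining_form_scalar (arrA _ LA) dL.
have [g gE] := td L i f LA; exists g.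
by rewrite -(update_id f i) fi aE (multiderZ mt) gE scalerAl.
Qed.

Lemma logder_coord A p (theta : polyder K (\dim W0) p) : is_arrangement W0 A ->
  (forall L (i : 'I_p) (f : 'I_p -> S), L \in A -> f i = form L ->
     (forall j, j != i -> exists k, f j = 'X_k) ->
     dvd (form L) (pdapply theta f)) ->
  theta \in @logder K V W0 A p.
Proof.
move=> arrA h; apply/(logderP _ arrA) => L i f LA.
apply: (@multider_ideal _ _ _ _ (pdapply_multider theta) (dvd (form L)) (pred1 i)
  (fun _ => form L)) => [|a x y|f' f'i f'X|j /eqP ->].
- exact: dvd0.
- exact: dvd_lin.
- by apply: (h L i) => //; apply: f'i; rewrite /= eqxx.
- by rewrite updateE.
Qed.

Section Restriction.
Variable H : {vspace V}.
Hypothesis hH : hyperplane_of W0 H.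

(** rho^p is well defined: by the Leibniz rule, changing an argument by a multiple of alpha_H
    changes the value by a multiple of alpha_H. *)
Lemma restrict_pdapply p (theta : polyder K (\dim W0) p) (f f' : 'I_p -> S) :
  (forall i (g : 'I_p -> S), dvd (form H) (pdapply theta (update g i (form H)))) ->
  (forall i, restrict_fun H (f i) = restrict_fun H (f' i)) ->
  restrict_fun H (pdapply theta f) = restrict_fun H (pdapply theta f').
Proof.
move=> td ff'; have mt := pdapply_multider theta.
suff Hs (s : seq 'I_p) : forall f : 'I_p -> S,
    (forall i, restrict_fun H (f i) = restrict_fun H (f' i)) ->
    (forall i, i \notin s -> f i = f' i) ->
    restrict_fun H (pdapply theta f) = restrict_fun H (pdapply theta f').
  by apply: (Hs (ord_enum p)) => // i; rewrite mem_ord_enum.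
elim: s {f ff'} => [|i s IHs] f ff' fs.
  by congr (restrict_fun H (pdapply theta _)); apply: funext => i; exact: fs.
have [g gE] : dvd (form H) (f i - f' i).
  by apply/restrict_form => //; rewrite restrictB ff' subrr.
have -> : f = update f i (f' i + form H * g) by rewrite -gE addrC subrK update_id.
rewrite (multiderD mt f i (f' i) (form H * g)) restrictD.
have e0 : restrict_fun H (pdapply theta (update f i (form H * g))) = 0.
  have [mtM _ _] := mt; rewrite (mtM f i (form H) g).
  apply/restrict_form => //; have [w ->] := td i f.
  by exists (pdapply theta (update f i g) + g * w); rewrite mulrDr mulrCA.
rewrite [X in _ + X = _]e0 addr0; apply: IHs => j => [|js]; have [->|ji] := eqVneq j i.
- by rewrite updateE.
- by rewrite updateNE.
- by rewrite updateE.
- by rewrite updateNE // fs // inE negb_or ji.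
Qed.

Lemma rho_eq_uniq p (theta : polyder K (\dim W0) p) (eta eta' : polyder K (\dim H) p) :
  rho_eq theta eta -> rho_eq theta eta' -> eta = eta'.
Proof.
move=> e e'; apply/ffunP => I; rewrite -!pdapply_X.
have -> : (fun i => 'X_(tnth (val I) i)) = fun i =>
    restrict_fun H (lift_fun W0 ('X_(tnth (val I) i) : {mpoly K[\dim H]})).
  by apply: funext => i; rewrite lift_funK ?subvf.
by rewrite e e'.
Qed.

Lemma rho_eq0 p (theta : polyder K (\dim W0) p) :
  rho_eq theta (0 : polyder K (\dim H) p) <-> exists theta', theta = form H *: theta'.
Proof.
split=> [e|[t' ->] f]; last first.
  rewrite pdapply0 pdapplyZ; apply/esym/restrict_form => //.
  by exists (pdapply t' f).
have /choice[t' tE] : forall I, exists g, theta I = form H * g.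
  move=> I; apply/restrict_form => //.
  by rewrite -pdapply_X -e pdapply0.
exists [ffun I => t' I]; apply/ffunP => I.
by rewrite !ffunE tE.
Qed.

Lemma rho_eq_lin p (a : S) (theta theta' : polyder K (\dim W0) p)
    (eta eta' : polyder K (\dim H) p) :
  rho_eq theta eta -> rho_eq theta' eta' ->
  rho_eq (a *: theta + theta') (restrict_fun H a *: eta + eta').
Proof.
by move=> e e' f; rewrite !pdapplyD !pdapplyZ restrictD restrictM e e'.
Qed.

Lemma rho_eqZ p (a : S) (theta : polyder K (\dim W0) p) (eta : polyder K (\dim H) p) :
  rho_eq theta eta -> rho_eq (a *: theta) (restrict_fun H a *: eta).
Proof. by move=> e f; rewrite !pdapplyZ restrictM e. Qed.

Lemma rho_eq_zero p : rho_eq (0 : polyder K (\dim W0) p) (0 : polyder K (\dim H) p).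
Proof. by move=> f; rewrite !pdapply0 restrict0. Qed.

Section RhoA.
Variable A : {fset {vspace V}}.
Hypotheses (arrA : is_arrangement W0 A) (HA : H \in A).

Lemma arr_deletion : is_arrangement W0 (deletion A H).
Proof. by move=> L; rewrite !inE => /andP[_]; exact: arrA. Qed.

Lemma restriction_form L (beta : {mpoly K[\dim H]}) : L \in deletion A H ->
  defining_form (L :&: H)%VS beta -> exists c, beta = c *: restrict_fun H (form L).
Proof.
move=> LA [/homog1_linform[b ->] bL].
have [|c cE] := @linear_form_ratio K V H (phi L) b.
  move=> v vH /eqP; rewrite -phiP; last exact: arr_deletion.
  move=> vL; rewrite -(fun_at_linform b vH); apply/(bL v vH).
  by rewrite memv_cap vL vH.
by exists c; rewrite restrict_linform ?subvf // -linformZ; apply: linform_eq.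
Qed.

(** eta evaluates theta at lifts of its arguments; by [restrict_pdapply] the choice of the lifts
    does not matter. *)
Lemma rho_exists p (theta : polyder K (\dim W0) p) : theta \in @logder K V W0 A p ->
  exists2 eta, eta \in @logder K V H (restriction A H) p & rho_eq theta eta.
Proof.
move=> td; have tdH i (g : 'I_p -> S) : dvd (form H) (pdapply theta (update g i (form H))).
  by move/(logderP _ arrA): td; apply.
have lD (g h : {mpoly K[\dim H]}) c :
    lift_fun W0 (c *: g + h) = c *: lift_fun W0 g + lift_fun W0 h.
  by rewrite /lift_fun comp_mpolyD comp_mpolyZ.
have lM (g h : {mpoly K[\dim H]}) : lift_fun W0 (g * h) = lift_fun W0 g * lift_fun W0 h.
  by rewrite /lift_fun rmorphM.
pose lu (f : 'I_p -> {mpoly K[\dim H]}) i := lift_fun W0 (f i).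
have luE (f : 'I_p -> {mpoly K[\dim H]}) i (g : {mpoly K[\dim H]}) :
    lu (update f i g) = update (lu f) i (lift_fun W0 g).
  by apply: funext => j; rewrite /lu /update; case: eqP.
have [tM tL tA] := pdapply_multider theta.
have [|eta etaE] := @multider_pdapply K (\dim H) p
  (fun f : 'I_p -> {mpoly K[\dim H]} => restrict_fun H (pdapply theta (lu f))).
  split=> [f i g h|f i c g h|f i j ij fij].
  - rewrite (luE f i (g * h)) (luE f i g) (luE f i h).
    rewrite lM.
    rewrite (tM (lu f) i (lift_fun W0 g)).
    apply: etrans (restrictD _ _ _) _; congr (_ + _).
      by apply: etrans (restrictM _ _ _) _; rewrite lift_funK ?subvf.
    by apply: etrans (restrictM _ _ _) _; rewrite lift_funK ?subvf.
  - rewrite (luE f i (c *: g + h)) (luE f i g) (luE f i h) lD.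
    rewrite (tL (lu f) i c (lift_fun W0 g)).
    apply: etrans (restrictD _ _ _) _; congr (_ + _); exact: restrictZ.
  - by rewrite (tA _ i j) ?restrict0 // /lu fij.
have rE : rho_eq theta eta.
  move=> f; rewrite etaE; apply: restrict_pdapply => // i.
  by rewrite /lu lift_funK ?subvf.
exists eta => //; apply/asboolP => L' beta /imfsetP[L /= LA ->] dL f i _ fi.
have [c bE] := restriction_form LA dL.
have LA' : L \in A by move: LA; rewrite !inE => /andP[].
(* Among the lifts of beta, the multiple of alpha_L itself is the one to which the condition on
   theta applies. *)
pose f' := update (lu f) i (c *: form L).
have -> : f = fun j => restrict_fun H (f' j).
  apply: funext => j; have [->|ji] := eqVneq j i.
    by rewrite /f' updateE restrictZ -bE.
  by rewrite /f' updateNE // /lu lift_funK ?subvf.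
rewrite rE /f' (multiderZ (pdapply_multider theta)) bE restrictZ.
have /(logderP _ arrA)/(_ L i (lu f) LA')[g ->] := td.
by exists (restrict_fun H g); rewrite restrictM scalerAl.
Qed.

(** With [rho_eq0] this identifies the kernel of rho^p on D^p(A) with alpha_H D^p(A'). For L other
    than H, alpha_L is a prime that does not divide alpha_H and can be cancelled. *)
Lemma logder_mul_form p (theta : polyder K (\dim W0) p) :
  theta \in @logder K V W0 (deletion A H) p <-> form H *: theta \in @logder K V W0 A p.
Proof.
rewrite (logderP _ arrA) (logderP _ arr_deletion); split=> td L i f LA.
  rewrite pdapplyZ; have [->|LH] := eqVneq L H.
    by exists (pdapply theta (update f i (form H))).
  by apply: dvdM; apply: td; rewrite !inE LH.
have hL := arr_deletion LA.
move: LA; rewrite !inE => /andP[LH LA].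
have := td L i f LA; rewrite pdapplyZ => /(form_prime hL)[|//].
by move/(dvd_form hL hH) => e; rewrite e eqxx in LH.
Qed.

End RhoA.
End Restriction.

End LogarithmicDerivations.

(** * Lifting along a regular sequence *)

Section KoszulExtra.

Fixpoint onehot n i : seq bool :=
  if n is n'.+1 then
    if i is i'.+1 then false :: onehot n' i' else true :: nseq n' false
  else [::].

Lemma koszul_d_onehot (R : comNzRingType) (M : lmodType R) (fs : seq R) (g : seq bool -> M) i :
  koszul_deg_pred (size fs) 1 g -> (i < size fs)%N ->
  koszul_d fs g (onehot (size fs) i) = nth 0 fs i *: g (nseq (size fs) false).
Proof.
elim: fs g i => [|f fs IHfs] g [|i] //= g1 ilt.
  rewrite (@eq_koszul_d _ _ _ _ (fun=> 0)) ?koszul_d0 ?subr0 // => s.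
  by apply: g1; rewrite /= eqSS add1n andbF.
apply: (IHfs (fun s => g (false :: s))) => // s sj.
by apply: g1; rewrite /= eqSS add0n.
Qed.

Lemma koszul_deg_pred1P (R : comNzRingType) (M : lmodType R) n (g : seq bool -> M) :
  (forall b, b != nseq n false -> g b = 0) -> koszul_deg_pred n 1 g.
Proof.
move=> g0 b bn; apply: g0; apply: contra bn => /eqP ->.
by rewrite size_nseq count_nseq mul0n !eqxx.
Qed.

Lemma koszul_d_ind (R : comNzRingType) (M : lmodType R) (P : M -> Prop) (fs : seq R)
    (c : seq bool -> M) b :
  P 0 -> (forall x y, P x -> P y -> P (x - y)) ->
  (forall f s, f \in fs -> P (f *: c s)) -> P (koszul_d fs c b).
Proof.
move=> P0 PB; elim: fs c b => [|f fs IHfs] c [|[] b] //= Pf.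
  apply: PB; first by apply: Pf; rewrite mem_head.
  by apply: IHfs => h s hfs; apply: Pf; rewrite inE hfs orbT.
by apply: IHfs => h s hfs; apply: Pf; rewrite inE hfs orbT.
Qed.

(** Meant for [rho_eq], a relation between modules over two different rings, to which maps of
    modules over one ring do not apply. *)
Lemma koszul_d_rel (R R' : comNzRingType) (sg : R -> R') (M : lmodType R) (M' : lmodType R')
    (rel : M -> M' -> Prop) (fs : seq R) (c : seq bool -> M) (c' : seq bool -> M') b :
  rel 0 0 -> (forall x y u v, rel x u -> rel y v -> rel (x - y) (u - v)) ->
  (forall f x u, rel x u -> rel (f *: x) (sg f *: u)) ->
  (forall s, rel (c s) (c' s)) -> rel (koszul_d fs c b) (koszul_d (map sg fs) c' b).
Proof.
move=> r0 rB rZ; elim: fs c c' b => [|f fs IHfs] c c' [|[] b] //= rc.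
  by apply: rB; [exact: rZ|exact: IHfs].
exact: IHfs.
Qed.

End KoszulExtra.

Section Lifting.
Variables (K : fieldType) (V : vectType K).
Local Notation W0 := (fullv : {vspace V}).
Local Notation S := {mpoly K[\dim W0]}.
Variable phi : {vspace V} -> {linear V -> K^o}.
Hypothesis phiP : forall L, hyperplane_of W0 L -> forall v, (v \in L) = (phi L v == 0).
Variables (A : {fset {vspace V}}) (H : {vspace V}).
Hypotheses (arrA : is_arrangement W0 A) (HA : H \in A).
Variable p : nat.
Local Notation LD := (@logder K V W0 A p).
Local Notation LD' := (@logder K V W0 (deletion A H) p).
Local Notation LDH := (@logder K V H (restriction A H) p).
Local Notation alpha := (form phi H).
Let hH : hyperplane_of W0 H := arrA HA.
Implicit Types (eta : polyder K (\dim H) p) (theta : polyder K (\dim W0) p).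

Definition in_image eta : Prop := exists2 theta, theta \in LD & rho_eq theta eta.

Lemma in_image0 : in_image 0.
Proof. by exists 0; [exact: rpred0 | exact: rho_eq_zero]. Qed.

Lemma in_imageD eta eta' : in_image eta -> in_image eta' -> in_image (eta + eta').
Proof.
move=> [t tD e] [t' tD' e']; exists (t + t'); first exact: rpredD.
have := rho_eq_lin 1 e e'.
by rewrite restrict1 !scale1r.
Qed.

Lemma in_imageZ (a : S) eta : in_image eta -> in_image (restrict_fun H a *: eta).
Proof.
move=> [t tD e]; exists (a *: t); first exact: rpredZ.
exact: rho_eqZ.
Qed.

Lemma rho_eqB theta theta' eta eta' :
  rho_eq theta eta -> rho_eq theta' eta' -> rho_eq (theta - theta') (eta - eta').
Proof.
move=> e e'; have := rho_eq_lin (-1) e' e.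
have -> : restrict_fun H (-1 : S) = -1 by rewrite /restrict_fun rmorphN rmorph1.
by rewrite !scaleN1r ![- _ + _]addrC.
Qed.

Lemma in_imageB eta eta' : in_image eta -> in_image eta' -> in_image (eta - eta').
Proof.
move=> [t tD e] [t' tD' e']; exists (t - t'); first exact: rpredB.
exact: rho_eqB.
Qed.

Lemma polyder_torsion_free n (f : {mpoly K[n]}) (t : polyder K n p) :
  f != 0 -> f *: t = 0 -> t = 0.
Proof.
move=> f0 /ffunP ft; apply/ffunP => I; have := ft I; rewrite !ffunE.
by move=> /eqP; rewrite -[_ *: _]/(_ * _) mulf_eq0 (negbTE f0) => /eqP.
Qed.

(* A compatible family of preimages of the f * eta is corrected to a Koszul
   cocycle of D^p(A) by the vanishing of H^2 on D^p(A'), and divided out by the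
   vanishing of H^1 on the free module. *)
Lemma koszul_lift (fs : seq S) k eta : eta \in LDH ->
  pd_le (logder_module W0 (deletion A H) p) k -> regseq fs -> size fs = k.+3 ->
  (forall f, f \in fs -> in_image (restrict_fun H f *: eta)) ->
  (forall L, L \in A -> exists2 f, f \in fs & ~ dvd (form phi L) f) ->
  in_image eta.
Proof.
move=> etaD pdk rfs sfs fs_im fs_nd; set n := size fs in sfs.
pose zeros := nseq n false.
(* eta is taken as a 0-cochain; its coboundary has the values f * eta on singletons, which lift to
   D^p(A). *)
pose eta0 b := if b == zeros then eta else 0.
have eta0d : koszul_deg_pred n 1 eta0.
  by apply: koszul_deg_pred1P => b /negbTE bz; rewrite /eta0 bz.
pose fs' := map (@restrict_fun K V W0 H) fs.
have sfs' : size fs' = n by rewrite size_map.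
pose d b := koszul_d fs' eta0 b.
have d1 : koszul_deg n 1 d by rewrite -sfs'; apply: koszul_d_deg; rewrite sfs'.
have /choice[th thE] : forall b, exists t, t \in LD /\ rho_eq t (d b).
  move=> b; suff [t tD tE] : in_image (d b) by exists t.
  apply: koszul_d_ind => [||_ s /mapP[f ffs ->]]; [exact: in_image0|exact: in_imageB|].
  rewrite /eta0; case: eqP => _; first exact: fs_im.
  by rewrite scaler0; exact: in_image0.
pose c b := if (size b == n) && (count id b == 1%N) then th b else 0.
have c1 : koszul_deg n 1 c by move=> b; rewrite /c => /negbTE ->.
have cD b : c b \in LD.
  by rewrite /c; case: ifP => _; [exact: (thE b).1 | exact: rpred0].
have cr b : rho_eq (c b) (d b).
  rewrite /c; case: ifP => [_|/negbT/d1 ->]; first exact: (thE b).2.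
  exact: rho_eq_zero.
(* The coboundary of the lift restricts to a double coboundary, that is to 0, so it is alpha_H times
   a cochain of D^p(A'). *)
have kcr b : rho_eq (koszul_d fs c b) (0 : polyder K (\dim H) p).
  suff : rho_eq (koszul_d fs c b) (koszul_d fs' d b).
    by have -> : koszul_d fs' d b = 0 by exact: koszul_dK.
  apply: (@koszul_d_rel _ _ (@restrict_fun K V W0 H)) => //.
  - exact: rho_eq_zero.
  - exact: rho_eqB.
  - by move=> f x u; exact: rho_eqZ.
have kcD b : koszul_d fs c b \in LD.
  apply: (koszul_d_ind (P := fun t => t \in LD)) => [|x y|f s _].
  - exact: rpred0.
  - exact: rpredB.
  - by apply: rpredZ.
have /choice[t tE] : forall b, exists t : logder_module W0 (deletion A H) p,
    koszul_d fs c b = alpha *: \val t.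
  move=> b; have [t' t'E] := (rho_eq0 phiP hH _).1 (kcr b).
  have t'D : t' \in LD' by apply/(logder_mul_form phiP hH arrA); rewrite -t'E.
  by exists (LogDer t'D).
have al0 : alpha != 0 by exact: form_neq0.
have val_inj0 (u : logder_module W0 (deletion A H) p) : alpha *: \val u = 0 -> u = 0.
  by move=> /(polyder_torsion_free al0) u0; apply: val_inj; rewrite u0.
have kval (e : seq bool -> logder_module W0 (deletion A H) p) b :
    koszul_d fs (fun s => alpha *: \val (e s)) b = alpha *: \val (koszul_d fs e b).
  rewrite koszul_dZ; congr (_ *: _).
  have vL : linear (fun u : logder_module W0 (deletion A H) p => \val u).
    by move=> a x y; rewrite linearP.
  exact: esym (koszul_d_map fs (pack_linear vL) e b).
have kv2 : koszul_vanish fs (logder_module W0 (deletion A H) p) 2.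
  by apply: pd_koszul rfs pdk _; rewrite -/n sfs.
have [||e ej eE] := kv2 t.
- move=> b bn; apply: val_inj0; rewrite -tE.
  by apply: (koszul_d_deg (koszul_deg_predS c1)).
- move=> b; apply: val_inj0; rewrite -kval -[RHS](koszul_dK fs c b).
  by apply: eq_koszul_d => s; rewrite tE.
pose c' b := c b - alpha *: \val (e b).
have c'1 : koszul_deg n 1 c'.
  by move=> b bn; rewrite /c' c1 // ej ?eqSS // !raddf0 addr0.
have c'0 b : koszul_d fs c' b = 0 by rewrite koszul_dB kval eE -tE subrr.
have kv1 : koszul_vanish fs (polyder K (\dim W0) p) 1.
  apply: koszul_projective; last exact: ffun_projective.
  by apply: regseq_koszul => //; rewrite -/n sfs.
have [g gj gE] := kv1 c' c'1 c'0.
set th0 := g zeros.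
have fth0 f : f \in fs -> f *: th0 \in LD /\ rho_eq (f *: th0) (restrict_fun H f *: eta).
  move=> ffs; pose i := index f fs; have ilt : (i < n)%N by rewrite index_mem.
  have fE : nth 0 fs i = f by exact: nth_index.
  have := koszul_d_onehot gj ilt; rewrite gE fE -/th0 => <-.
  have dE : d (onehot n i) = restrict_fun H f *: eta.
    have := koszul_d_onehot (fs := fs') (g := eta0) (i := i).
    rewrite sfs' (nth_map 0) // fE /eta0 eqxx; exact.
  split; first by rewrite rpredB ?cD //; apply/(logder_mul_form phiP hH arrA); case: (e _).
  rewrite -dE -[X in rho_eq _ X]subr0; apply: rho_eqB; first exact: cr.
  by apply/(rho_eq0 phiP hH); eexists.
(* So far only the multiples f * th0 are known to be logarithmic; for each L, some f in fs is prime
   to alpha_L and can be cancelled. *)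
have th0D : th0 \in LD.
  apply/(logderP phiP _ arrA) => L i f LA.
  have [h hfs hL] := fs_nd L LA; have [hth _] := fth0 h hfs.
  have := (logderP phiP _ arrA).1 hth L i f LA; rewrite pdapplyZ.
  by case/(form_prime phiP (arrA LA)) => // /hL.
have [eta1 _ th0E] := rho_exists phiP hH arrA HA th0D.
(* For an f not divisible by alpha_H, both eta and the restriction of th0 become the same after
   multiplication by the nonzero image of f. *)
have [f ffs fH] := fs_nd H HA.
suff -> : eta = eta1 by exists th0.
apply/eqP; rewrite -subr_eq0; apply/eqP.
apply: (@polyder_torsion_free _ (restrict_fun H f)).
  by apply/eqP => /(restrict_form phiP) f0; apply: fH; exact: f0.
rewrite scalerBr; apply/eqP; rewrite subr_eq0; apply/eqP.
apply: rho_eq_uniq (fth0 f ffs).2 _ => //.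
exact: rho_eqZ.
Qed.

End Lifting.

(** * Ideals and radicals *)

Section Ideals.
Variable R : comNzRingType.
Implicit Types (G : R -> Prop).

Definition ideal G : Prop := G 0 /\ forall a x y, G x -> G y -> G (a * x + y).

Lemma idealM G a x : ideal G -> G x -> G (a * x).
Proof. by move=> [G0 GL] Gx; rewrite -[_ * _]addr0; exact: GL. Qed.

Lemma idealD G x y : ideal G -> G x -> G y -> G (x + y).
Proof. by move=> [G0 GL] Gx Gy; rewrite -[x]mul1r; exact: GL. Qed.

Definition ideal_add G (a : R) : R -> Prop := fun x => exists b, G (x - b * a).

Lemma ideal_addP G a : ideal G -> ideal (ideal_add G a).
Proof.
move=> IG; split; first by exists 0; rewrite mul0r subr0; case: IG.
move=> c x y [b xb] [d yd]; exists (c * b + d).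
rewrite mulrDl -mulrA opprD addrACA -mulrBr.
by case: IG => _; apply.
Qed.

(** If powers of x lie in G + (a) and in G + (b), then their product lies in G + (a b). *)
Lemma ideal_add_prod (T : eqType) (r : seq T) (F : T -> R) G (x : R) : ideal G ->
  (forall t, t \in r -> exists m, ideal_add G (F t) (x ^+ m)) ->
  exists m, ideal_add G (\prod_(t <- r) F t) (x ^+ m).
Proof.
move=> IG; elim: r => [|t r IHr] Fr.
  by exists 0%N, 1; rewrite big_nil mulr1 expr0 subrr; case: IG.
have [m [b xb]] := Fr t (mem_head _ _).
have [|m' [c xc]] := IHr; first by move=> u ur; apply: Fr; rewrite inE ur orbT.
exists (m + m')%N, (b * c); rewrite exprD big_cons.
set u := x ^+ m in xb *; set v := x ^+ m' in xc *; set Pi := \prod_(_ <- _) _ in xc *.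
have -> : u * v - b * c * (F t * Pi) = v * (u - b * F t) + b * F t * (v - c * Pi).
  rewrite !mulrBr [v * u]mulrC addrA; congr (_ - _); last by rewrite mulrACA.
  by rewrite [v * (b * F t)]mulrC subrK.
by apply: idealD => //; exact: idealM.
Qed.

End Ideals.

(** * Surjectivity *)

Section Flats.
Variables (K : fieldType) (V : vectType K).
Local Notation W0 := (fullv : {vspace V}).
Local Notation S := {mpoly K[\dim W0]}.
Variable phi : {vspace V} -> {linear V -> K^o}.
Hypothesis phiP : forall L, hyperplane_of W0 L -> forall v, (v \in L) = (phi L v == 0).
Implicit Types (L H X Y : {vspace V}) (T B : seq {vspace V}).

Definition meet T : {vspace V} := (\bigcap_(L <- T) L)%VS.

Lemma mem_meet T v : (v \in meet T) = all (fun L : {vspace V} => v \in L) T.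
Proof.
rewrite /meet; elim: T => [|L T IHT]; first by rewrite big_nil memvf.
by rewrite big_cons memv_cap IHT.
Qed.

Lemma sub_meet T L : L \in T -> (meet T <= L)%VS.
Proof. by move=> LT; apply/subvP => v; rewrite mem_meet => /allP/(_ L LT). Qed.

(** On the meet of the remaining hyperplanes beta is a multiple of [phi L]; subtracting that
    multiple removes L from the list. *)
Lemma form_in_ideal (G : S -> Prop) T (beta : {linear V -> K^o}) : ideal G ->
  {in T, forall L, hyperplane_of W0 L} -> {in T, forall L, G (form phi L)} ->
  (forall v, v \in meet T -> beta v = 0) -> G (linform W0 beta).
Proof.
move=> IG; elim: T beta => [|L T IHT] beta hT GT b0.
  rewrite (_ : linform W0 beta = 0); first by case: IG.
  by rewrite /linform big1 // => m _; rewrite b0 ?scale0r // mem_meet.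
have [|c cE] := @linear_form_ratio K V (meet T) (phi L) beta.
  move=> v vT /eqP pv; apply: b0; move: vT; rewrite !mem_meet /= => ->.
  by rewrite phiP ?pv ?eqxx //; apply: hT; exact: mem_head.
have bL : linear (fun v => beta v - c * phi L v : K^o).
  move=> a u v; rewrite !linearP /= mulrDr opprD addrACA; congr (_ + _).
  by rewrite scalerBr -[a *: phi L u]/(a * _) mulrCA.
pose b' : {linear V -> K^o} :=
  HB.pack (fun v => beta v - c * phi L v : K^o) (GRing.isLinear.Build K V K^o _ _ bL).
have -> : linform W0 beta = c%:MP * form phi L + linform W0 b'.
  rewrite mul_mpolyC -linformZ /linform -big_split /=; apply: eq_bigr => m _.
  by rewrite -scalerDl addrC subrK.
case: (IG) => _ GL; apply: GL; first by apply: GT; exact: mem_head.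
apply: IHT => [L' L'T|L' L'T|v vT] /=.
- by apply: hT; rewrite inE L'T orbT.
- by apply: GT; rewrite inE L'T orbT.
- by rewrite cE // subrr.
Qed.

(* The zero set argument behind the fact that the ideal generated by the products
   of the forms not vanishing on a bigger flat contains a power of every form
   vanishing on Y, with "prime ideal" replaced by a branching over the forms that
   are added to the ideal. *)
Lemma form_power_in_ideal (G : S -> Prop) B T Y (beta : {linear V -> K^o}) : ideal G ->
  {in B, forall L, hyperplane_of W0 L} -> {subset T <= B} ->
  {in T, forall L, G (form phi L)} ->
  (forall T', {subset T <= T'} -> {subset T' <= B} -> meet T' != Y ->
     G (\prod_(L <- [seq L <- B | L \notin T']) form phi L)) ->
  (forall v, v \in Y -> beta v = 0) ->
  exists m, G (linform W0 beta ^+ m).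
Proof.
move=> + hB; move: {2}(count _ _).+1 (ltnSn (count (fun L => L \notin T) B)) => k.
elim: k G T => // k IHk G T cT IG TB GT GP b0.
have [TY|TY] := eqVneq (meet T) Y.
  exists 1%N; rewrite expr1; apply: (form_in_ideal IG _ GT); last by rewrite TY.
  by move=> L /TB; exact: hB.
have [|m [b mb]] := @ideal_add_prod _ _ [seq L <- B | L \notin T]
  (form phi) G (linform W0 beta) IG.
  move=> L; rewrite mem_filter => /andP[LT LB].
  apply: (IHk (ideal_add G (form phi L)) (L :: T)) => //.
  - apply: leq_trans (_ : count (fun L => L \notin T) B <= k)%N; last by rewrite -ltnS.
    have /perm_to_rem/seq.permP cB := LB; rewrite !cB /= mem_head LT /=.
    by apply: sub_count => L'; rewrite /= inE negb_or => /andP[].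
  - exact: ideal_addP.
  - by move=> L'; rewrite inE => /orP[/eqP ->//|/TB].
  - move=> L'; rewrite inE => /orP[/eqP ->|/GT GL'].
      by exists 1; rewrite mul1r subrr; case: IG.
    by exists 0; rewrite mul0r subr0.
  - move=> T' TT' T'B T'Y; exists 0; rewrite mul0r subr0; apply: GP => // L' L'T.
    by apply: TT'; rewrite inE L'T orbT.
exists m; rewrite -[_ ^+ m](subrK (b * \prod_(L <- [seq L <- B | L \notin T]) form phi L)).
apply: (idealD IG mb); apply: (idealM _ IG); exact: GP.
Qed.

Section Surjectivity.
Variables (A : {fset {vspace V}}) (H : {vspace V}).
Hypotheses (arrA : is_arrangement W0 A) (HA : H \in A).
Local Notation sA := (enum_fset A).

(** Flats of A inside H, given by hyperplanes of A rather than of A^H, so that their forms live in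
    S. *)
Definition flat X : Prop :=
  exists T, [/\ H \in T, {subset T <= sA} & X = meet T].

Lemma flat_in_lattice X : flat X -> in_lattice H (restriction A H) X.
Proof.
move=> [T [HT TA ->]].
exists [fset (L :&: H)%VS | L in [seq L <- T | L != H]]%fset.
  apply/fsubsetP => L' /imfsetP[L /=]; rewrite mem_filter => /andP[LH LT] ->.
  by apply/imfsetP; exists L => //=; rewrite !inE LH; exact: TA.
apply/eqP; rewrite eqEsubv; apply/andP; split; apply/subvP => v.
  rewrite mem_meet => /allP vT; rewrite memv_cap vT //= -/(meet _) mem_meet.
  apply/allP => L' /imfsetP[L /=]; rewrite mem_filter => /andP[_ LT] ->.
  by rewrite memv_cap !vT.
rewrite memv_cap -/(meet _) !mem_meet => /andP[vH /allP vT]; apply/allP => L LT.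
have [->//|LH] := eqVneq L H.
have : v \in (L :&: H)%VS; last by rewrite memv_cap => /andP[].
by apply: vT; apply/imfsetP; exists L => //=; rewrite mem_filter LH.
Qed.

Definition Qforms X : S := \prod_(L <- sA | ~~ (X <= L)%VS) form phi L.

Lemma prod_dvd (r : seq {vspace V}) (P P' : pred {vspace V}) :
  (forall L, L \in r -> P L -> P' L) ->
  dvd (\prod_(L <- r | P L) form phi L) (\prod_(L <- r | P' L) form phi L).
Proof.
move=> PP'; exists (\prod_(L <- r | P' L && ~~ P L) form phi L).
rewrite (bigID P) /=; congr (_ * _).
rewrite big_seq_cond [RHS]big_seq_cond; apply: eq_bigl => L.
by have := PP' L; case: (L \in r) => //=; case: (P L); rewrite ?andbT ?andbF // => ->.
Qed.

Section Image.
Variables (p k : nat) (eta : polyder K (\dim H) p).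
Hypothesis etaD : eta \in @logder K V H (restriction A H) p.
Hypothesis pdk : pd_le (logder_module W0 (deletion A H) p) k.
Hypothesis rhok : rho_surjective_codim A H p (k + 2).

Definition kills (f : S) : Prop := in_image A (restrict_fun H f *: eta).

Lemma kills_ideal : ideal kills.
Proof.
split.
  by rewrite /kills restrict0 scale0r; exact: in_image0.
move=> a f g kf kg; rewrite /kills restrictD restrictM scalerDl -scalerA.
by apply: in_imageD kg; exact: in_imageZ kf.
Qed.

Lemma kills_dvd f g : dvd f g -> kills f -> kills g.
Proof. by move=> [h ->] kf; rewrite mulrC; exact: (idealM h kills_ideal kf). Qed.

(** eta is also logarithmic for the restriction of A_X, where the hypothesis gives a lift theta in
    D^p(A_X). The factor Q_X supplies divisibility by the remaining forms of A. *)
Lemma kills_codim X : flat X -> (\dim {:V} - \dim X = k + 2)%N -> kills (Qforms X).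
Proof.
move=> fX codX.
have [|theta thD thE] := rhok (flat_in_lattice fX) codX (eta := eta).
  apply/asboolP => L' beta /imfsetP[L /= LA ->]; move/asboolP: etaD; apply.
  by apply/imfsetP; exists L => //=; move: LA; rewrite !inE => /andP[-> /andP[]].
exists (Qforms X *: theta); last exact: rho_eqZ.
have arrX : is_arrangement W0 (localization A X).
  by move=> L; rewrite !inE => /andP[LA _]; exact: arrA.
apply/(logderP phiP _ arrA) => L i f LA; rewrite pdapplyZ.
have [XL|XL] := boolP (X <= L)%VS.
  apply: dvdM; apply: (logderP phiP _ arrX).1 => //.
  by rewrite !inE LA.
rewrite mulrC; apply: dvdM; rewrite /Qforms (big_rem L) //= XL.
by eexists.
Qed.

Lemma dvd_form_exp L (f : S) m : hyperplane_of W0 L -> dvd (form phi L) (f ^+ m) ->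
  dvd (form phi L) f.
Proof.
move=> hL; rewrite -!(restrict_form phiP) // /restrict_fun rmorphXn /=.
by move=> /eqP; rewrite expf_eq0 => /andP[_ /eqP].
Qed.

(** Distinct coordinates are not proportional, so of any two powers of coordinates in the regular
    sequence at least one is prime to alpha_L, as [koszul_lift] requires. *)
Lemma coord_basis_dvd (b : (\dim W0).-tuple V) L (i j : 'I_(\dim W0)) :
  basis_of W0 b -> hyperplane_of W0 L -> i != j ->
  dvd (form phi L) (linform W0 (coord b i)) -> ~ dvd (form phi L) (linform W0 (coord b j)).
Proof.
move=> bB hL ij.
have b1 (u v : 'I_(\dim W0)) : coord b u b`_v = (v == u)%:R.
  by rewrite coord_free ?(basis_free bB).
have ratio u : dvd (form phi L) (linform W0 (coord b u)) ->
    exists2 c, c != 0 & forall v, coord b u v = c * phi L v.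
  move=> /(dvd_linform phiP _ hL) u0.
  have [|c cE] := @linear_form_ratio K V W0 (phi L) (coord b u).
    by move=> v _ /eqP; rewrite -phiP //; exact: u0.
  exists c => [|v]; last by rewrite cE ?memvf.
  apply/eqP => c0; have := b1 u u; rewrite eqxx cE ?memvf // c0 mul0r => /eqP.
  by rewrite eq_sym oner_eq0.
move=> /ratio[c c0 cE] /ratio[d d0 dE].
have := b1 i j; rewrite eq_sym (negbTE ij) cE => /eqP.
rewrite mulf_eq0 (negbTE c0) /= => /eqP pj.
by have := b1 j j; rewrite eqxx dE pj mulr0 => /eqP; rewrite eq_sym oner_eq0.
Qed.

Lemma kills_step Y : flat Y -> (k + 2 < \dim W0 - \dim Y)%N ->
  (forall X, flat X -> (Y <= X)%VS -> X != Y -> kills (Qforms X)) ->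
  kills (Qforms Y).
Proof.
move=> [T0 [HT0 T0A YE]] codY IH.
have hA L : L \in sA -> hyperplane_of W0 L by exact: arrA.
pose B := [seq L <- sA | (Y <= L)%VS].
have YT0 L : L \in T0 -> (Y <= L)%VS by rewrite YE; exact: sub_meet.
(* The colon ideal of [kills] by Q_Y, in which powers of the forms vanishing on Y are sought. *)
pose G f := kills (f * Qforms Y).
have IG : ideal G.
  split=> [|a f g Gf Gg]; rewrite /G; first by rewrite mul0r; exact: kills_ideal.1.
  by rewrite mulrDl -mulrA; exact: (kills_ideal.2 a _ _ Gf Gg).
(* As alpha_H restricts to 0, the branching may start from the list of H alone; every larger list
   then cuts out a flat inside H, to which [IH] applies. *)
have kH : kills (form phi H).
  rewrite /kills (_ : restrict_fun H _ = 0); first by rewrite scale0r; exact: in_image0.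
  by apply/(restrict_form phiP _ (arrA HA)); exists 1; rewrite mulr1.
have Gpow (beta : {linear V -> K^o}) : (forall v, v \in Y -> beta v = 0) ->
    exists m, G (linform W0 beta ^+ m).
  apply: (form_power_in_ideal (B := B) (T := [:: H]) IG).
  - by move=> L; rewrite mem_filter => /andP[_]; exact: hA.
  - by move=> L; rewrite inE => /eqP ->; rewrite mem_filter YT0 ?T0A.
  - by move=> L; rewrite inE => /eqP ->; rewrite /G mulrC; exact: (idealM _ kills_ideal kH).
  move=> T' HT' T'B T'Y; set X := meet T' in T'Y.
  have T'A : {subset T' <= sA} by move=> L /T'B; rewrite mem_filter => /andP[].
  have fX : flat X by exists T'; split=> //; apply: HT'; exact: mem_head.
  have YX : (Y <= X)%VS.
    apply/subvP => v vY; rewrite mem_meet; apply/allP => L /T'B.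
    by rewrite mem_filter => /andP[/subvP YL _]; exact: YL.
  (* Q_Y together with the forms through Y outside T' is the product over all L except those of T';
     no hyperplane of T' contributes to Q_X, so Q_X divides it. *)
  apply: kills_dvd (IH X fX YX T'Y).
  have [|h hE] := @prod_dvd sA (fun L => ~~ (X <= L)%VS)
      (fun L => ~~ ((Y <= L)%VS && (L \in T'))).
    by move=> L _ XL; apply: contra XL => /andP[_]; exact: sub_meet.
  exists h; rewrite -[RHS]hE [RHS](bigID (fun L => (Y <= L)%VS)) /=.
  rewrite /B -filter_predI big_filter; congr (_ * _); apply: eq_bigl => L /=.
    by case: (Y <= L)%VS; rewrite ?andbT ?andbF.
  by case: (Y <= L)%VS; rewrite ?andbT ?andbF.
have [b [bB _ bY]] := adapted_basis Y.
have [z' zz'] := basis_coordinates bB.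
have /choice[m mE] : forall i : 'I_(\dim W0), exists m, (\dim Y <= i)%N ->
    G (linform W0 (coord b i) ^+ m).
  move=> i; have [Yi|nYi] := pselect (\dim Y <= i)%N; last by exists 0%N => /nYi[].
  have [m mE] := Gpow (coord b i) (fun v => bY i v Yi).
  exists m => _; exact: mE.
have idx_lt (j : 'I_k.+3) : (\dim Y + j < \dim W0)%N.
  by rewrite -ltn_subRL; apply: leq_trans (ltn_ord j) _; move: codY; rewrite addn2.
pose idx j := Ordinal (idx_lt j).
have idx_inj : injective idx by move=> i j /(congr1 val)/addnI/val_inj.
pose s := [seq (idx j, m (idx j)) | j <- ord_enum k.+3].
rewrite /kills; set eta' := _ *: eta.
apply: (koszul_lift phiP arrA HA (k := k)
    (fs := [seq linform W0 (coord b x.1) ^+ x.2 | x <- s])) => //.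
- exact: rpredZ.
- apply: regseq_coordinates zz' _; rewrite /unzip1 -map_comp.
  by rewrite map_inj_uniq ?ord_enum_uniq.
- by rewrite !size_map -(size_map val) val_ord_enum size_iota.
- move=> _ /mapP[_ /mapP[j _ ->] ->] /=; rewrite scalerA -restrictM.
  by apply: mE; exact: leq_addr.
move=> L LA.
have [nd|nd] := pselect (dvd (form phi L) (linform W0 (coord b (idx ord0)))).
  pose j1 : 'I_k.+3 := Ordinal (isT : 1 < k.+3)%N.
  exists (linform W0 (coord b (idx j1)) ^+ m (idx j1)).
    apply/mapP; exists (idx j1, m (idx j1)) => //.
    by apply: map_f; exact: mem_ord_enum.
  move=> /(dvd_form_exp (arrA LA)); apply: coord_basis_dvd nd => //; first exact: arrA.
  by rewrite (inj_eq idx_inj).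
exists (linform W0 (coord b (idx ord0)) ^+ m (idx ord0)).
  by apply/mapP; exists (idx ord0, m (idx ord0)) => //; apply: map_f; exact: mem_ord_enum.
by move=> /(dvd_form_exp (arrA LA)).
Qed.

Lemma dim_cap_hyperplane L Y : hyperplane_of W0 L -> ~~ (Y <= L)%VS ->
  \dim Y = (\dim (Y :&: L)).+1.
Proof.
move=> hL YL; have := dimv_sum_cap Y L.
have -> : \dim (Y + L) = (\dim L).+1.
  apply/eqP; rewrite eqn_leq {1}hL.2 dimvS ?subvf //= ltn_neqAle dimvS ?addvSr // andbT.
  apply: contra YL => /eqP dE; have /eqP -> : L == (Y + L)%VS.
    by rewrite eqEdim addvSr -dE leqnn.
  exact: addvSl.
by rewrite addSnnS addnC => /addIn.
Qed.

Hypothesis center_codim : (k + 2 <= \dim W0 - \dim (meet sA))%N.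

(** Cutting Y with d further hyperplanes reaches a flat of codimension k + 2, which [center_codim]
    makes possible; the product Q of a smaller flat divides that of a larger one. *)
Lemma kills_small d Y : flat Y -> (\dim W0 - \dim Y + d = k + 2)%N -> kills (Qforms Y).
Proof.
elim: d Y => [|d IHd] Y fY; first by rewrite addn0; exact: kills_codim.
move=> codY; have [T [HT TA YE]] := fY.
have [L LA YL] : exists2 L, L \in sA & ~~ (Y <= L)%VS.
  apply: contrapT => nL; suff : (Y <= meet sA)%VS.
    move/dimvS => dY; have := leq_trans center_codim (leq_sub2l (\dim W0) dY).
    by rewrite -codY addnS ltnNge leq_addr.
  apply/subvP => v vY; rewrite mem_meet; apply/allP => L LA.
  by apply: contraT => vL; case: nL; exists L => //; apply: contra vL => /subvP; apply.
have dY := dim_cap_hyperplane (arrA LA) YL.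
have mE : (Y :&: L)%VS = meet (L :: T).
  by apply/vspaceP => v; rewrite memv_cap YE !mem_meet /= andbC.
have fYL : flat (Y :&: L)%VS.
  exists (L :: T); split=> //; first by rewrite inE HT orbT.
  by move=> L'; rewrite inE => /orP[/eqP ->|/TA].
apply: kills_dvd (IHd _ fYL _).
  apply: prod_dvd => L' _; apply: contra => YL'; apply: subv_trans YL'; exact: capvSl.
rewrite -codY -addSnnS; congr (_ + _)%N; rewrite dY subnS prednK // subn_gt0.
by rewrite -dY dimvS ?subvf.
Qed.

Lemma kills_flat Y : flat Y -> kills (Qforms Y).
Proof.
move: {2}(\dim W0 - \dim Y).+1 (ltnSn (\dim W0 - \dim Y)) => c.
elim: c Y => // c IHc Y cY fY.
have [small|big] := leqP (\dim W0 - \dim Y) (k + 2).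
  by apply: (@kills_small (k + 2 - (\dim W0 - \dim Y))) => //; rewrite subnKC.
apply: kills_step => // X fX YX XY; apply: IHc => //.
have dYX : (\dim Y < \dim X)%N.
  rewrite ltn_neqAle dimvS // andbT; apply: contra XY => /eqP dE.
  by rewrite eq_sym eqEdim YX -dE leqnn.
apply: leq_trans (_ : \dim W0 - \dim Y <= c)%N; last by rewrite -ltnS.
by apply: ltn_sub2l => //; apply: leq_trans dYX _; rewrite dimvS ?subvf.
Qed.

Lemma in_image_of_codim : in_image A eta.
Proof.
have fc : flat (meet sA) by exists sA; split.
have := kills_flat fc; rewrite /kills /Qforms big_seq_cond big_pred0.
  by rewrite restrict1 scale1r.
by move=> L; apply/negbTE; rewrite negb_and negbK -implybE; apply/implyP; exact: sub_meet.
Qed.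

End Image.
End Surjectivity.
End Flats.

(** * Arrangements of small rank *)

Section LowRank.
Variables (K : fieldType) (V : vectType K).
Local Notation W0 := (fullv : {vspace V}).
Local Notation S := {mpoly K[\dim W0]}.
Variable phi : {vspace V} -> {linear V -> K^o}.
Hypothesis phiP : forall L, hyperplane_of W0 L -> forall v, (v \in L) = (phi L v == 0).
Variables (A : {fset {vspace V}}) (H : {vspace V}).
Hypotheses (arrA : is_arrangement W0 A) (HA : H \in A).
Let hH : hyperplane_of W0 H := arrA HA.

(** The constant vector field on V along the j-th basis vector of H, a lift of the coordinate
    derivation of H. *)
Definition deriv_along (j : 'I_(\dim H)) (f : S) : S :=
  \sum_m coord (vbasis W0) m (tnth (vbasis H) j) *: mderiv m f.

Lemma deriv_along_linear j c f g :
  deriv_along j (c *: f + g) = c *: deriv_along j f + deriv_along j g.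
Proof.
rewrite /deriv_along scaler_sumr -big_split /=; apply: eq_bigr => m _.
by rewrite mderivD mderivZ scalerDr !scalerA [c * _]mulrC.
Qed.

Lemma deriv_alongM j f g : deriv_along j (f * g) = f * deriv_along j g + g * deriv_along j f.
Proof.
rewrite /deriv_along !mulr_sumr -big_split /=; apply: eq_bigr => m _.
by rewrite mderivM scalerDr -!scalerAr addrC [_ * g]mulrC.
Qed.

Lemma deriv_alongX j i : deriv_along j 'X_i = (coord (vbasis W0) i (tnth (vbasis H) j))%:MP.
Proof.
rewrite /deriv_along (bigD1 i) //= big1 ?addr0 => [|m mi].
  rewrite mderivX mnm1E eqxx scale1r (_ : (U_(i) - U_(i))%MM = 0%MM).
    by rewrite mpolyX0 -mul_mpolyC mulr1.
  by apply/mnmP => k; rewrite mnmBE subnn mnm0E.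
by rewrite mderivX mnm1E eq_sym (negbTE mi) mulr0n scale0r scaler0.
Qed.

Lemma deriv_along_linform j (b : {linear V -> K^o}) :
  deriv_along j (linform W0 b) = (b (tnth (vbasis H) j))%:MP.
Proof.
have D0 : deriv_along j 0 = 0.
  by have := deriv_along_linear j (-1) 0 0; rewrite scaler0 addr0 scaleN1r addNr.
have DZ c f : deriv_along j (c *: f) = c *: deriv_along j f.
  by have := deriv_along_linear j c f 0; rewrite D0 !addr0.
have DD f g : deriv_along j (f + g) = deriv_along j f + deriv_along j g.
  by have := deriv_along_linear j 1 f g; rewrite !scale1r.
rewrite /linform (big_morph (deriv_along j) DD D0).
rewrite [in RHS](coord_vbasis (memvf (tnth (vbasis H) j))) linear_sum.
rewrite (raddf_sum (@mpolyC (\dim W0) K)) /=; apply: eq_bigr => m _.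
by rewrite DZ deriv_alongX linearZ /= mpolyCM mul_mpolyC (tnth_nth 0) -!mul_mpolyC mulrC.
Qed.

Lemma restrict_deriv_along j f : restrict_fun H (deriv_along j f) = mderiv j (restrict_fun H f).
Proof.
elim/mpoly_lin_ind: f => [c f g IHf IHg|mu].
  by rewrite deriv_along_linear !restrictD !restrictZ IHf IHg mderivD mderivZ.
have h1 : deriv_along j 1 = 0.
  have := deriv_alongM j 1 1; rewrite !mul1r => /eqP.
  by rewrite -subr_eq0 opprD addrA subrr sub0r oppr_eq0 => /eqP.
elim/mnm_ind: mu => [|mu i IH].
  by rewrite mpolyX0 h1 restrict0 restrict1 -mpolyC1 mderivC.
rewrite mpolyXD deriv_alongM restrictD !restrictM IH mderivM addrC.
congr (_ + _).
  by rewrite mulrC.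
rewrite deriv_alongX restrict_funXU; congr (_ * _).
rewrite /linform raddf_sum (bigD1 j) //= big1 ?addr0 => [|k kj].
  rewrite mderivZ mderivX mnm1E eqxx scale1r (_ : (U_(j) - U_(j))%MM = 0%MM).
    by rewrite mpolyX0 -mul_mpolyC mulr1 /restrict_fun comp_mpolyC.
  by apply/mnmP => k; rewrite mnmBE subnn mnm0E.
by rewrite mderivZ mderivX mnm1E (negbTE kj) mulr0n scale0r scaler0.
Qed.

(* For A = {H}, contracting with the derivations along H gives a lift. *)
Lemma in_image_single p (eta : polyder K (\dim H) p) :
  (forall L, L \in A -> L = H) -> in_image A eta.
Proof.
move=> AH.
pose D (f : 'I_p -> S) : S := \sum_(I : multiindex (\dim H) p)
  lift_fun W0 (eta I) * \det (\matrix_(a < p, b < p) deriv_along (tnth (val I) a) (f b)).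
have DE f : D f = \sum_(I : multiindex (\dim H) p) lift_fun W0 (eta I) *
    \det (\matrix_(a < p, b < p) deriv_along (tnth (val I) a) (f b)) by [].
have DD : multider D.
  split=> [f i g h|f i c g h|f i j ij fij].
  - rewrite !DE !mulr_sumr -big_split; apply: eq_bigr => I _ /=.
    rewrite !(mulrCA _ (lift_fun _ _)) -mulrDr; congr (_ * _).
    rewrite -!(det_tr (\matrix_(_, _) _)).
    apply: (@determinant_multilinear _ _ _ _ _ i).
    + by apply/rowP => a; rewrite !mxE !updateE deriv_alongM.
    + by apply/matrixP => b a; rewrite !mxE !updateNE // eq_sym neq_lift.
    + by apply/matrixP => b a; rewrite !mxE !updateNE // eq_sym neq_lift.
  - rewrite !DE scaler_sumr -big_split; apply: eq_bigr => I _ /=.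
    rewrite scalerAr -mulrDr; congr (_ * _); rewrite -[X in _ = X + _]mul_mpolyC.
    rewrite -!(det_tr (\matrix_(_, _) _)) -[X in _ = _ + X]mul1r.
    apply: (@determinant_multilinear _ _ _ _ _ i).
    + by apply/rowP => a; rewrite !mxE !updateE deriv_along_linear mul_mpolyC mul1r.
    + by apply/matrixP => b a; rewrite !mxE !updateNE // eq_sym neq_lift.
    + by apply/matrixP => b a; rewrite !mxE !updateNE // eq_sym neq_lift.
  - rewrite DE big1 // => I _; rewrite -det_tr.
    by rewrite (determinant_alternate ij) ?mulr0 // => a; rewrite !mxE fij.
have [theta thE] := multider_pdapply DD; exists theta; last first.
  have rsum (I : finType) (F : I -> S) :
      restrict_fun H (\sum_i F i) = \sum_i restrict_fun H (F i).
    exact: rmorph_sum.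
  have rdet (M : 'M[S]_p) :
      restrict_fun H (\det M) = \det (map_mx (@restrict_fun K V W0 H) M).
    exact: esym (det_map_mx _ _).
  move=> f; rewrite thE DE rsum /pdapply; apply: eq_bigr => I _.
  apply: etrans _ (esym (restrictM _ _ _)); rewrite lift_funK ?subvf // rdet.
  rewrite (_ : map_mx _ _ = \matrix_(a < p, b < p)
    mderiv (tnth (val I) a) (restrict_fun H (f b))) //.
  by apply/matrixP => a b; rewrite !mxE restrict_deriv_along.
apply/(logderP phiP _ arrA) => L i f LA; rewrite thE (AH L LA) DE big1; first exact: dvd0.
move=> I _; rewrite (expand_det_col _ i) big1 ?mulr0 // => a _.
rewrite mxE updateE deriv_along_linform.
have : tnth (vbasis H) (tnth (val I) a) \in H by rewrite vbasis_mem // mem_tnth.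
by rewrite phiP // => /eqP ->; rewrite mpolyC0 mul0r.
Qed.

Section Pd.
Variable p : nat.
Local Notation n := (\dim W0).
Local Notation A' := (deletion A H).
Local Notation D' := (logder_module W0 A' p).
Let arr' : is_arrangement W0 A' := arr_deletion (H := H) arrA.
Let sA' := enum_fset A'.
Let T0 : finType := ('I_(size sA') * {ffun 'I_p -> 'I_n} * 'I_p)%type.
Let T1 : finType := (multiindex n p + T0)%type.

Let arrL (t : T0) : {vspace V} := nth H sA' t.1.1.
Let arg (t : T0) : 'I_p -> S :=
  update (fun j => 'X_(t.1.2 j)) t.2 (form phi (arrL t)).

(* The system theta (.., x_k, .., alpha_L, .., x_k', ..) = alpha_L * h_t in the
   unknowns theta and h_t, one equation for each L in A', each position of alpha_L
   and each choice of the other arguments; its solution space is D^p(A'). *)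
Let mat (t : T0) (s : T1) : S :=
  match s with
  | inl J => \det (\matrix_(a < p, b < p) mderiv (tnth (val J) a) (arg t b))
  | inr u => if u == t then - form phi (arrL t) else 0
  end.

Lemma arrL_mem t : arrL t \in A'.
Proof. by rewrite /arrL; apply: mem_nth. Qed.

Lemma mapA_mat (e : {ffun T1 -> S^o}) t : mapA mat e t =
  pdapply [ffun I => e (inl I)] (arg t) - form phi (arrL t) * e (inr t).
Proof.
rewrite /mapA ffunE big_sumType /=; congr (_ + _).
  by rewrite /pdapply; apply: eq_bigr => I _; rewrite ffunE mulrC.
rewrite (bigD1 t) //= eqxx big1 ?addr0 ?mulNr // => u ut.
by rewrite (negbTE ut) mul0r.
Qed.

(** The unknowns h_t are determined by theta because alpha_L is nonzero, so forgetting them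
    identifies the solution space with D^p(A'). *)
Lemma logder_module_kernel : exists i : {linear D' -> {ffun T1 -> S^o}},
  injective i /\ forall x, mapA mat x = 0 <-> exists y, i y = x.
Proof.
have uniq_e (e e' : {ffun T1 -> S^o}) : (forall I, e (inl I) = e' (inl I)) ->
    mapA mat e = 0 -> mapA mat e' = 0 -> e = e'.
  move=> ee' /ffunP e0 /ffunP e'0; apply/ffunP => -[I|t]; first exact: ee'.
  have := e0 t; rewrite -(e'0 t) !mapA_mat.
  have -> : [ffun I => e (inl I)] = [ffun I => e' (inl I)] :> polyder K n p.
    by apply/ffunP => I; rewrite !ffunE.
  move=> /addrI/oppr_inj; apply: mulfI; apply: form_neq0; first exact: phiP.
  exact: arr' (arrL_mem t).
have /choice[i iE] : forall y : D', exists e : {ffun T1 -> S^o},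
    (forall I, e (inl I) = \val y I) /\ mapA mat e = 0.
  move=> y; have yD : \val y \in @logder K V W0 A' p by case: y.
  have /choice[h hE] : forall t, exists h, pdapply (\val y) (arg t) = form phi (arrL t) * h.
    move=> t; exact: (logderP phiP _ arr').1 yD _ _ _ (arrL_mem t).
  exists [ffun s : T1 => match s with inl J => \val y J | inr t => h t end].
  split=> [I|]; first by rewrite ffunE.
  apply/ffunP => t; rewrite mapA_mat !ffunE /= -hE.
  rewrite (_ : [ffun I => _] = \val y) ?subrr //.
  by apply/ffunP => I; rewrite !ffunE.
have iL : linear i.
  move=> a x y; apply: uniq_e => [I||].
  - rewrite (iE (a *: x + y)).1.
    have -> : \val (a *: x + y) = a *: \val x + \val y by exact: linearP.
    by rewrite !ffunE (iE x).1 (iE y).1.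
  - exact: (iE _).2.
  - have := mapA_linear mat a (i x) (i y).
    by rewrite !(iE _).2 scaler0 addr0.
exists (pack_linear iL); split=> [x y /= xy|x].
  by apply: val_inj; apply/ffunP => I; rewrite -(iE x).1 -(iE y).1 xy.
split=> [x0|[y <-]]; last exact: (iE y).2.
pose th : polyder K n p := [ffun I => x (inl I)].
have thD : th \in @logder K V W0 A' p.
  apply: (logder_coord phiP arr') => L j f LA fj fX.
  have ilt : (index L sA' < size sA')%N by rewrite index_mem.
  have /choice[sg sgE] : forall l : 'I_p, exists k : 'I_n, l != j -> f l = 'X_k.
    move=> l; have [ll|nl] := pselect (l != j).
      by have [k kE] := fX l ll; exists k.
    (* At l = j any index will do, since [arg] overwrites that position. *)
    have n0 : (0 < n)%N by rewrite -hH.2.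
    by exists (Ordinal n0) => /nl.
  pose t : T0 := (Ordinal ilt, [ffun l => sg l], j).
  have LE : arrL t = L by rewrite /arrL /= nth_index.
  have fE : arg t = f.
    apply: funext => l; rewrite /arg LE /=; have [->|lj] := eqVneq l j.
      by rewrite updateE fj.
    by rewrite updateNE // ffunE sgE.
  have := congr1 (fun u : {ffun T0 -> S^o} => u t) x0.
  rewrite /= mapA_mat -/th fE LE ffunE => /eqP; rewrite subr_eq0 => /eqP ->.
  by exists (x (inr t)).
exists (LogDer thD); apply: uniq_e => //; last exact: (iE _).2.
by move=> I; rewrite /= (iE _).1 /= ffunE.
Qed.

Lemma mderiv_linform m (b : V -> K) : exists c : K, mderiv m (linform W0 b) = c%:MP.
Proof.
exists (b (tnth (vbasis W0) m)); rewrite /linform raddf_sum.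
rewrite (bigD1 m) //= big1 ?addr0 => [|k km].
  rewrite mderivZ mderivX mnm1E eqxx scale1r (_ : (U_(m) - U_(m))%MM = 0%MM).
    by rewrite mpolyX0 -mul_mpolyC mulr1.
  by apply/mnmP => k; rewrite mnmBE subnn mnm0E.
by rewrite mderivZ mderivX mnm1E (negbTE km) mulr0n scale0r scaler0.
Qed.

(** In a basis adapted to the centre Y, each alpha_L involves only the coordinates vanishing on Y,
    and the determinants in [mat] are constants because all arguments are linear forms. So the
    matrix lives in codim Y, at most m + 2, variables. *)
Lemma pd_logder_module m :
  (n - \dim (meet (enum_fset A)) <= m.+2)%N -> pd_le D' m.+1 -> pd_le D' m.
Proof.
set Y := meet _ => rk.
have [b [bB bY bY']] := adapted_basis Y.
have [z' zz'] := basis_coordinates bB.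
pose J := [set i : 'I_n | (i < \dim Y)%N].
have cJ : (#|~: J| <= m.+2)%N.
  apply: leq_trans rk; have dYn : (\dim Y <= n)%N by rewrite dimvS ?subvf.
  have := cardsC J; rewrite card_ord => cn.
  have -> : #|~: J| = (n - #|J|)%N by rewrite -[LHS](addKn #|J|) cn.
  suff -> : #|J| = \dim Y by [].
  rewrite -sum1dep_card (big_ord_narrow dYn) /= sum1_card card_ord //.
have free_form L : L \in A -> free_of (fun i => linform W0 (coord b i)) J (form phi L).
  move=> LA; rewrite /form (linform_basis _ bB); apply: free_of_sum => i.
  have [iY|iY] := ltnP i (\dim Y).
    have : b`_i \in L.
      by have := bY i iY; apply/subvP; apply: sub_meet.
    rewrite (phiP (arrA LA)) => /eqP ->; rewrite scale0r -mpolyC0; exact: free_ofC.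
  rewrite -mul_mpolyC; apply: free_ofM; first exact: free_ofC.
  by apply: free_of_coord; rewrite inE -leqNgt.
have AA' L : L \in A' -> L \in A by rewrite !inE => /andP[].
have freemat t s : free_of (fun i => linform W0 (coord b i)) J (mat t s).
  case: s => [I|u] /=; last first.
    case: eqP => _; last by rewrite -mpolyC0; exact: free_ofC.
    rewrite -mulN1r -mpolyC1 -mpolyCN; apply: free_ofM; first exact: free_ofC.
    by apply: free_form; exact: AA' (arrL_mem t).
  have cst a c : exists d : K, mderiv (tnth (val I) a) (arg t c) = d%:MP.
    have [->|ct] := eqVneq c t.2; first by rewrite /arg updateE; exact: mderiv_linform.
    rewrite /arg updateNE // -linform_coord; exact: mderiv_linform.
  have /choice[F FE] : forall a, exists d : 'I_p -> K,
      forall c, mderiv (tnth (val I) a) (arg t c) = (d c)%:MP.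
    by move=> a; have [d dE] := choice (cst a); exists d.
  have -> : \matrix_(a < p, c < p) mderiv (tnth (val I) a) (arg t c) =
      map_mx (@mpolyC n K) (\matrix_(a < p, c < p) F a c).
    by apply/matrixP => a c; rewrite !mxE FE.
  rewrite det_map_mx; exact: free_ofC.
have [i [iI iK]] := logder_module_kernel.
exact: (pd_kernel zz' freemat iI iK cJ).
Qed.

(* Outside the range of in_image_of_codim, no flat has codimension k + 2 and the
   surjectivity hypothesis is void; then k = 0, which leaves only A = {H}. *)
Lemma is_projdim_rank k : is_projdim D' k ->
  (n - \dim (meet (enum_fset A)) < k + 2)%N -> k = 0%N.
Proof.
case: k => // m [pdD kmin] rk.
have /pd_le_projdim_le/kmin : pd_le D' m.
  apply: pd_logder_module; first by move: rk; rewrite addn2 ltnS.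
  exact: projdim_le_pd_le.
by rewrite ltnn.
Qed.

End Pd.

Lemma rho_surjective_of_codim p k :
  is_projdim (logder_module W0 (deletion A H) p) k ->
  rho_surjective_codim A H p (k + 2) -> rho_surjective W0 A H p.
Proof.
move=> pdk rhok eta etaD.
have [rk|rk] := leqP (k + 2) (\dim W0 - \dim (meet (enum_fset A))).
  exact: (in_image_of_codim phiP arrA HA etaD (projdim_le_pd_le pdk.1) rhok rk).
have k0 := is_projdim_rank pdk rk.
(* The centre now has codimension at most 1; lying in both H and L, it equals both. *)
apply: in_image_single => L LA; move: rk; rewrite k0 add0n ltnS => rk.
set Y := meet _ in rk.
have dYH : \dim Y = \dim H.
  apply/eqP; rewrite eqn_leq dimvS ?sub_meet //=.
  by move: rk; rewrite -hH.2 leq_subLR addn1 ltnS.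
have YH : Y = H by apply/eqP; rewrite eqEdim sub_meet // dYH leqnn.
apply/esym/eqP; rewrite eqEdim -{1}YH sub_meet //=.
by move: (arrA LA).2; rewrite -hH.2 => -[->].
Qed.

End LowRank.

(** * Hilbert series *)

Section Homogeneous.
Variables (K : fieldType) (n : nat).
Implicit Types (a f g : {mpoly K[n]}) (d e : nat).

Lemma pihomog_ext f g : (forall d, pihomog mdeg d f = pihomog mdeg d g) -> f = g.
Proof.
move=> fg; pose k := maxn (msize f) (msize g).
rewrite (pihomog_partitionE (k := k) (mf := mdeg) (p := f)) ?leq_maxl //.
rewrite (pihomog_partitionE (k := k) (mf := mdeg) (p := g)) ?leq_maxr //.
by apply: eq_bigr => d _.
Qed.

Lemma pihomogMl a f e d : a \is e.-homog ->
  pihomog mdeg (e + d) (a * f) = a * pihomog mdeg d f.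
Proof.
move=> ae; pose k := maxn (msize f) d.+1.
have dk : (d < k)%N by rewrite leq_max ltnSn orbT.
rewrite {1}(pihomog_partitionE (k := k) (mf := mdeg) (p := f)) ?leq_maxl //.
rewrite mulr_sumr raddf_sum /= (bigD1 (Ordinal dk)) //= big1 ?addr0 => [|i id].
  by rewrite pihomog_dE //; apply: dhomogM => //; exact: pihomogP.
apply: (pihomog_ne0 (d := e + i)); last by apply: dhomogM => //; exact: pihomogP.
by rewrite eqn_add2l; apply: contra id => /eqP e'; apply/eqP/val_inj.
Qed.

Lemma homog_mulI a f e d : a != 0 -> a \is e.-homog -> a * f \is (e + d).-homog ->
  f \is d.-homog.
Proof.
move=> a0 ae afh; rewrite homog_piE; apply/eqP.
by apply: (mulfI a0); rewrite -(pihomogMl _ _ ae) pihomog_dE.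
Qed.

Lemma homog_mul_lt a f e d : a != 0 -> a \is e.-homog -> a * f \is d.-homog ->
  (d < e)%N -> f = 0.
Proof.
move=> a0 ae afh de; apply: pihomog_ext => i; rewrite pihomog0.
apply: (mulfI a0); rewrite mulr0 -(pihomogMl _ _ ae).
apply: (pihomog_ne0 (d := d)) => //.
by rewrite neq_ltn (leq_trans de) ?leq_addr.
Qed.

End Homogeneous.

Section Hilbert.
Variables (K : fieldType) (V : vectType K).
Local Notation W0 := (fullv : {vspace V}).
Local Notation S := {mpoly K[\dim W0]}.
Variable phi : {vspace V} -> {linear V -> K^o}.
Hypothesis phiP : forall L, hyperplane_of W0 L -> forall v, (v \in L) = (phi L v == 0).

Lemma restrict_homog (W H : {vspace V}) (f : {mpoly K[\dim W]}) d : f \is d.-homog ->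
  restrict_fun H f \is d.-homog.
Proof.
have Xh mu : restrict_fun H ('X_[mu] : {mpoly K[\dim W]}) \is (mdeg mu).-homog.
  elim/mnm_ind: mu => [|mu i IH].
    rewrite mpolyX0 /restrict_fun rmorph1; rewrite mdeg0; exact: dhomog1.
  rewrite mpolyXD /restrict_fun rmorphM mdegD mdeg1; apply: dhomogM => //=.
  rewrite -[_ \mPo _]/(restrict_fun H 'X_i) restrict_funXU; exact: linform_homog.
move=> fd; rewrite (mpolyE f) /restrict_fun raddf_sum /= big_seq.
apply: rpred_sum => mu muf; rewrite comp_mpolyZ; apply: rpredZ.
by rewrite -(dhomog_mf fd muf); exact: Xh.
Qed.

Lemma restrict_pihomog (H : {vspace V}) (f : S) d :
  restrict_fun H (pihomog mdeg d f) = pihomog mdeg d (restrict_fun H f).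
Proof.
pose k := maxn (msize f) d.+1; have dk : (d < k)%N by rewrite leq_max ltnSn orbT.
have h i : restrict_fun H (pihomog mdeg i f) \is i.-homog.
  by apply: restrict_homog; exact: pihomogP.
have fE := pihomog_partitionE (k := k) (mf := mdeg) (p := f) (leq_maxl _ _).
have -> : restrict_fun H f = \sum_(i < k) restrict_fun H (pihomog mdeg i f).
  by rewrite {1}fE /restrict_fun raddf_sum.
rewrite (raddf_sum (pihomog mdeg d)) (bigD1 (Ordinal dk)) //=.
rewrite big1 ?addr0 => [|i id]; first by rewrite (pihomog_dE (h d)).
apply: (pihomog_ne0 (d := i)); last exact: h.
by apply: contra id => /eqP e; apply/eqP/val_inj.
Qed.

Definition homog_part n p d (theta : polyder K n p) : polyder K n p :=
  [ffun I => pihomog mdeg d (theta I)].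

(** Under the assumption on f the determinants are constants, so the value is a K-combination of the
    coefficients of theta. *)
Lemma pdapply_homog_part n p d (theta : polyder K n p) (f : 'I_p -> {mpoly K[n]}) :
  (forall m b, exists c : K, mderiv m (f b) = c%:MP) ->
  pdapply (homog_part d theta) f = pihomog mdeg d (pdapply theta f).
Proof.
move=> fc; rewrite /pdapply raddf_sum; apply: eq_bigr => I _.
have [c cE] : exists c : K,
    \det (\matrix_(a < p, b < p) mderiv (tnth (val I) a) (f b)) = c%:MP.
  have /choice[F FE] : forall a, exists d : 'I_p -> K,
      forall b, mderiv (tnth (val I) a) (f b) = (d b)%:MP.
    by move=> a; have [F FE] := choice (fc (tnth (val I) a)); exists F.
  exists (\det (\matrix_(a < p, b < p) F a b)); rewrite -det_map_mx.
  by congr (\det _); apply/matrixP => a b; rewrite !mxE FE.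
rewrite cE ffunE ![_ * c%:MP]mulrC !mul_mpolyC /=.
by rewrite linearZ.
Qed.

Lemma mderivXU_const n (m i : 'I_n) : exists c : K, mderiv m ('X_i : {mpoly K[n]}) = c%:MP.
Proof.
exists (i == m)%:R; rewrite mderivX mnm1E; case: eqP => [->|_].
  rewrite scale1r (_ : (U_(m) - U_(m))%MM = 0%MM) ?mpolyX0 //.
  by apply/mnmP => k; rewrite mnmBE subnn mnm0E.
by rewrite !mulr0n scale0r mpolyC0.
Qed.

Section Arr.
Variables (A : {fset {vspace V}}) (H : {vspace V}).
Hypotheses (arrA : is_arrangement W0 A) (HA : H \in A).
Let hH : hyperplane_of W0 H := arrA HA.
Variable p : nat.
Local Notation LD := (@logder K V W0 A p).
Local Notation LDH := (@logder K V H (restriction A H) p).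
Local Notation alpha := (form phi H).

(** D^p(A) is graded: the condition may be tested on linear arguments, and divisibility by alpha_L
    is the vanishing of a restriction, which respects degrees. *)
Lemma homog_part_logder d theta : theta \in LD -> homog_part d theta \in LD.
Proof.
move=> tD; apply: (logder_coord phiP arrA) => L i f LA fi fX.
rewrite pdapply_homog_part; last first.
  move=> m b; have [->|bi] := eqVneq b i; first by rewrite fi; exact: mderiv_linform.
  by have [k ->] := fX b bi; exact: mderivXU_const.
have hL := arrA LA.
apply/(restrict_form phiP _ hL); rewrite restrict_pihomog.
have /(restrict_form phiP _ hL) -> : dvd (form phi L) (pdapply theta f).
  by rewrite -(update_id f i) fi; apply: (logderP phiP _ arrA).1.
by rewrite pihomog0.
Qed.

Lemma lift_mderiv (i : 'I_(\dim H)) m : exists c : K,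
  mderiv m (lift_fun W0 ('X_i : {mpoly K[\dim H]})) = c%:MP.
Proof.
rewrite /lift_fun comp_mpolyXU -tnth_nth tnth_mktuple.
exact: mderiv_linform.
Qed.

Lemma rho_eq_coord theta (eta : polyder K (\dim H) p) I : rho_eq theta eta ->
  eta I = restrict_fun H (pdapply theta
    (fun b => lift_fun W0 ('X_(tnth (val I) b) : {mpoly K[\dim H]}))).
Proof.
move=> e; rewrite -e -pdapply_X; congr (pdapply eta _); apply: funext => b.
by rewrite lift_funK ?subvf.
Qed.

(** rho^p preserves degrees, so homogeneous elements of its image have homogeneous lifts. The
    comparison takes place on linear lifts of the coordinates of H. *)
Lemma rho_eq_homog_part d theta (eta : polyder K (\dim H) p) :
  theta \in LD -> rho_eq theta eta -> rho_eq (homog_part d theta) (homog_part d eta).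
Proof.
move=> tD e.
have [eta' _ e'] := rho_exists phiP hH arrA HA (homog_part_logder d tD).
suff -> : homog_part d eta = eta' by [].
apply/ffunP => I; rewrite ffunE (rho_eq_coord _ e) (rho_eq_coord _ e').
rewrite pdapply_homog_part ?restrict_pihomog // => m b; exact: lift_mderiv.
Qed.

Lemma homog_partE n (theta : polyder K n p) d :
  (forall I, theta I \is d.-homog) -> homog_part d theta = theta.
Proof. by move=> th; apply/ffunP => I; rewrite ffunE pihomog_dE. Qed.

Local Notation A' := (deletion A H).
Local Notation LD' := (@logder K V W0 A' p).

Lemma kscaleE n (c : K) (x : {ffun multiindex n p -> {mpoly K[n]}}) :
  c *: x = c%:MP *: (x : polyder K n p).
Proof. by apply/ffunP => I; rewrite !ffunE -mul_mpolyC. Qed.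

Lemma rho_eq_ksum (d : nat) (c : 'I_d -> K)
    (t : 'I_d -> {ffun multiindex (\dim W0) p -> S})
    (e : 'I_d -> {ffun multiindex (\dim H) p -> {mpoly K[\dim H]}}) :
  (forall i, @rho_eq K V W0 H p (t i) (e i)) ->
  @rho_eq K V W0 H p (\sum_i c i *: t i) (\sum_i c i *: e i).
Proof.
move=> te; apply: (big_ind2 (fun x y => @rho_eq K V W0 H p x y)) => [|x u y v xu yv|i _].
- exact: rho_eq_zero.
- by have := rho_eq_lin 1 xu yv; rewrite restrict1 !scale1r.
- rewrite !kscaleE; have := rho_eqZ (c i)%:MP (te i).
  by rewrite {1}/restrict_fun comp_mpolyC.
Qed.

(** The degree j part of D^p(A')[-1], shifted because alpha_H has degree 1. *)
Definition deletion_part j (t : polyder K (\dim W0) p) : Prop :=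
  if j is i.+1 then @logder_part K V W0 A' p i t else t = 0.

Lemma deletion_partP j t : deletion_part j t <-> @logder_part K V W0 A p j (alpha *: t).
Proof.
have ah : alpha \is 1.-homog by exact: linform_homog.
have a0 : alpha != 0 by exact: form_neq0.
rewrite /logder_part; split.
  case: j => [->|j [tD tj]]; last first.
    split; first by apply/(logder_mul_form phiP hH arrA).
    by move=> I; rewrite ffunE -add1n; apply: dhomogM.
  rewrite scaler0; split; first exact: rpred0.
  by move=> I; rewrite ffunE dhomog0.
move=> [tD tj]; case: j tj => [|j] tj.
  apply/ffunP => I; rewrite [RHS]ffunE; have := tj I; rewrite ffunE => th.
  exact: (homog_mul_lt a0 ah th).
split; first by apply/(logder_mul_form phiP hH arrA).
by move=> I; have := tj I; rewrite ffunE -[j.+1]add1n; exact: homog_mulI.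
Qed.

Lemma has_dim_deletion_part j :
  has_dim (K := K) (M := {ffun multiindex (\dim W0) p -> S}) (deletion_part j)
    (if j is i.+1 then hilb W0 A' p i else 0%N).
Proof.
case: j => [|j]; last exact: has_dim_hilb.
exists (fun _ => 0); split=> [[]//|c _ []//|m ->].
by exists (fun _ => 0); rewrite big_ord0.
Qed.

(** A basis in degree j consists of alpha_H times a basis of D^p(A') in degree j - 1 and of
    homogeneous lifts of a basis of D^p(A^H) in degree j. *)
Lemma hilb_restriction j : rho_surjective W0 A H p ->
  hilb W0 A p j =
  ((if j is i.+1 then hilb W0 A' p i else 0) + hilb H (restriction A H) p j)%N.
Proof.
move=> rhoS; apply: dimK_eq.
have [b1 [b1P b1I b1S]] := has_dim_deletion_part j.
have [b2 [b2P b2I b2S]] := has_dim_hilb H (restriction A H) p j.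
have /choice[th thP] : forall a, exists t : {ffun multiindex (\dim W0) p -> S},
    @logder_part K V W0 A p j t /\ @rho_eq K V W0 H p t (b2 a).
  move=> a; have [bD bj] := b2P a; have [t tD te] := rhoS _ bD.
  exists (homog_part j t); split.
    split; first exact: homog_part_logder.
    by move=> I; rewrite ffunE; exact: pihomogP.
  by have := rho_eq_homog_part j tD te; rewrite (homog_partE bj).
set d1 := (if j is _.+1 then _ else _) in b1 b1P b1I b1S *.
set d2 := hilb _ _ _ _ in b2 b2P b2I b2S th thP *.
pose b (i : 'I_(d1 + d2)) : {ffun multiindex (\dim W0) p -> S} :=
  match split i with inl a => alpha *: (b1 a : polyder K _ p) | inr a => th a end.
have bE c : \sum_i c i *: b i =
    alpha *: (\sum_a c (lshift d2 a) *: b1 a : polyder K _ p)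
    + \sum_a c (rshift d1 a) *: th a.
  rewrite big_split_ord /=; congr (_ + _).
    rewrite scaler_sumr; apply: eq_bigr => a _.
    by rewrite /b (unsplitK (inl a)) !kscaleE !scalerA mulrC.
  by apply: eq_bigr => a _; rewrite /b (unsplitK (inr a)).
have al0 : alpha != 0 by exact: form_neq0.
exists b; split.
- move=> i; rewrite /b; case: (split i) => a; last exact: (thP a).1.
  by apply/deletion_partP; exact: b1P.
- move=> c; rewrite bE => c0.
  have cr a : c (rshift d1 a) = 0.
    apply: (b2I (fun a => c (rshift d1 a))).
    have e1 := rho_eq_ksum (fun a => c (rshift d1 a)) (fun a => (thP a).2).
    have e2 : @rho_eq K V W0 H p
        (alpha *: (\sum_a c (lshift d2 a) *: b1 a : polyder K _ p)) 0.
      by apply/(rho_eq0 phiP hH); eexists.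
    have := rho_eq_lin 1 e2 e1; rewrite !scale1r c0 restrict1 scale1r add0r => e3.
    exact: (rho_eq_uniq e3 (@rho_eq_zero _ _ _ _)).
  have cl a : c (lshift d2 a) = 0.
    apply: (b1I (fun a => c (lshift d2 a))).
    apply: (polyder_torsion_free al0); rewrite -[RHS]c0 [X in _ = _ + X]big1 ?addr0 //.
    by move=> i _; rewrite cr scale0r.
  by move=> i; rewrite -(splitK i); case: (split i) => a; [exact: cl|exact: cr].
move=> m [mD mj].
have [eta etaD me] := rho_exists phiP hH arrA HA mD.
have [c cE] : exists c : 'I_d2 -> K, eta = \sum_a c a *: b2 a.
  apply: b2S; split=> // I; have := rho_eq_homog_part j mD me.
  rewrite (homog_partE mj) => me'; rewrite (rho_eq_uniq me me') ffunE.
  exact: pihomogP.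
have e1 := rho_eq_ksum c (fun a => (thP a).2).
have e2 := rho_eqB me e1; rewrite cE subrr in e2.
have [t tE] := (rho_eq0 phiP hH _).1 e2.
have [|c' c'E] := b1S t.
  apply/deletion_partP; rewrite -tE; split.
    rewrite rpredB //; apply: rpred_sum => a _.
    by rewrite kscaleE; apply: rpredZ; exact: (thP a).1.1.
  move=> I; rewrite !ffunE; apply: rpredB; first exact: mj.
  rewrite sum_ffunE; apply: rpred_sum => a _; rewrite ffunE; apply: rpredZ.
  exact: (thP a).1.2.
exists (fun i => match split i with inl a => c' a | inr a => c a end).
rewrite bE; under [in X in _ *: X]eq_bigr => a _ do rewrite (unsplitK (inl a)).
under [X in _ + X]eq_bigr => a _ do rewrite (unsplitK (inr a)).
by rewrite -c'E -tE subrK.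
Qed.

End Arr.
End Hilbert.

(** * Power series and the identity for Psi *)

Section Series.
Variable R : nzRingType.
Implicit Types a b c : nat -> R.

Lemma psmulD a b c n : psmul (fun j => a j + b j) c n = psmul a c n + psmul b c n.
Proof. by rewrite /psmul -big_split; apply: eq_bigr => i _; rewrite mulrDl. Qed.

Lemma psmul_xmul a c n : psmul (xmul a) c n = xmul (psmul a c) n.
Proof.
case: n => [|n]; first by rewrite /psmul big_ord_recl big_ord0 mul0r addr0.
by rewrite /psmul big_ord_recl mul0r add0r.
Qed.

Lemma eq_psmul a b c n : a =1 b -> psmul a c n = psmul b c n.
Proof. by move=> ab; apply: eq_bigr => i _; rewrite ab. Qed.

Lemma xmul_sum m (F : 'I_m -> nat -> R) n :
  xmul (fun k => \sum_i F i k) n = \sum_i xmul (F i) n.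
Proof. by case: n => //=; rewrite big1. Qed.

End Series.

(** There are no p distinct indices below [\dim H], so Der^p is zero. *)
Lemma hilb_big (K : fieldType) (V : vectType K) (H : {vspace V})
    (A : {fset {vspace V}}) p j : (\dim H < p)%N -> hilb H A p j = 0%N.
Proof.
move=> Hp; apply: dimK_eq; exists (fun _ => 0); split=> [[]//|c _ []//|m _].
exists (fun _ => 0); rewrite big_ord0; apply/ffunP => I; exfalso.
have uI : uniq (val I).
  by apply: (@map_uniq _ _ val); apply: (sorted_uniq ltn_trans ltnn); exact: (valP I).
have := max_card (mem (val I)).
by rewrite (card_uniqP uI) size_tuple card_ord leqNgt Hp.
Qed.

Theorem theorem1p5 (K : fieldType) (l : nat)
    (A : {fset {vspace 'rV[K]_l}}) (H : {vspace 'rV[K]_l})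
    (arrA : is_arrangement fullv A) (HA : H \in A)
    (hyp : forall p : nat, (p <= l)%N ->
       exists k : nat,
         [/\ is_projdim (logder_module fullv (deletion A H) p) k,
             (k < l - 2)%N
           & rho_surjective_codim A H p (k + 2)]) :
  (forall n, Psi fullv A n =
     xmul (Psi fullv (deletion A H)) n + Psi H (restriction A H) n) /\
  (forall n, Psi_at fullv A (-1) n =
     xmul (Psi_at fullv (deletion A H) (-1)) n
     + Psi_at H (restriction A H) (-1) n).
Proof.
suff main n : Psi fullv A n =
    xmul (Psi fullv (deletion A H)) n + Psi H (restriction A H) n.
  split=> // n; rewrite /Psi_at main hornerD; congr (_ + _).
  by case: n => //=; rewrite horner0.
have dl : \dim (fullv : {vspace 'rV[K]_l}) = l by rewrite dimvf /dim /= mul1n.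
have /choice[phi phiE] : forall L, exists phi : {linear 'rV[K]_l -> K^o},
    hyperplane_of fullv L -> forall v, (v \in L) = (phi v == 0).
  move=> L; have [hL|nL] := pselect (hyperplane_of fullv L).
    by have [f fE] := hyperplane_form hL; exists f.
  (* The zero form is a default for subspaces that are not hyperplanes. *)
  have z : linear (fun _ : 'rV[K]_l => 0 : K^o) by move=> a x y; rewrite scaler0 addr0.
  by exists (pack_linear z) => /nL[].
have hilbE p j : (p <= l)%N -> hilb fullv A p j =
    ((if j is i.+1 then hilb fullv (deletion A H) p i else 0) +
     hilb H (restriction A H) p j)%N.
  move=> pl; have [k [pdk _ rhok]] := hyp p pl.
  apply: (hilb_restriction phiE arrA HA).
  exact: (rho_surjective_of_codim phiE arrA HA pdk rhok).
(* The sum for A^H stops at l - 1; it is extended by the zero term p = l so that the three sums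
   match term by term. *)
have -> : Psi H (restriction A H) n = \sum_(p < (\dim (fullv : {vspace 'rV[K]_l})).+1)
    psmul (fun j => (hilb H (restriction A H) p j)%:R) (fun j => (STbase ^+ p)`_j) n.
  rewrite /Psi -(arrA H HA).2 [RHS]big_ord_recr /=.
  rewrite [X in _ = _ + X]big1 ?addr0 // => i _.
  by rewrite hilb_big // mulr0n mul0r.
rewrite /Psi xmul_sum -big_split; apply: eq_bigr => p _ /=.
rewrite -psmul_xmul -psmulD; apply: eq_psmul => j.
rewrite hilbE; last by have := ltn_ord p; rewrite ltnS {2}dl.
by rewrite natrD; case: j.
Qed.
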